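(* If $A$ is an existentially closed unital $C^*$-algebra, then $K_1(A)=\{0\}$.
   Context: All $C^*$-algebras are unital, and all embeddings and inclusions are unital. We work in continuous logic in the language of unital $C^*$-algebras: a quantifier-free formula $\varphi(x_1,\dots,x_m)$ is an expression $f(\|t_1(x)\|,\dots,\|t_k(x)\|)$ with $f:\mathbb{R}^k\to\mathbb{R}$ continuous and each $t_i$ a $*$-polynomial with complex coefficients (constant terms being multiples of the unit). For $n\ge 1$, $A_{\le n}$ denotes the closed ball of radius $n$ (for tuples, each coordinate has norm at most $n$). If $A\subseteq B$, then $A$ is existentially closed in $B$ if for every quantifier-free formula $\varphi(v,w)$ ($v,w$ finite tuples of variables), every $n\ge1$ and every tuple $a$ from $A$, $\inf\{\varphi(a,b): b\in A_{\le n}\}=\inf\{\varphi(a,c): c\in B_{\le n}\}$. $A$ is existentially closed if it is existentially closed in every $C^*$-algebra $B$ containing $A$ as a unital $C^*$-subalgebra. *)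

(* Defs.v *)
From HB Require Import structures.
From mathcomp Require Import all_boot all_order all_algebra.
From mathcomp Require Import complex.
From mathcomp Require Import all_classical all_reals all_analysis.

Set Implicit Arguments.
Unset Strict Implicit.
Unset Printing Implicit Defensive.

Import Order.TTheory GRing.Theory Num.Theory.
Import numFieldNormedType.Exports.

Local Open Scope classical_set_scope.
Local Open Scope ring_scope.
Local Open Scope complex_scope.
Local Open Scope quotient_scope.

HB.mixin Record isCStarAlgebra (R : realType) A & CompleteNormedModule R[i] A := {
  cmul : A -> A -> A;
  cone : A;
  star : A -> A;
  cmulA : associative cmul;
  cmul1x : left_id cone cmul;
  cmulx1 : right_id cone cmul;
  cmulDl : left_distributive cmul +%R;
  cmulDr : right_distributive cmul +%R;
  cscaleAl : forall (c : R[i]) (x y : A), c *: cmul x y = cmul (c *: x) y;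
  cscaleAr : forall (c : R[i]) (x y : A), c *: cmul x y = cmul x (c *: y);
  cnormM : forall x y : A, `|cmul x y| <= `|x| * `|y|;
  starK : involutive star;
  starD : {morph star : x y / x + y};
  starM : forall x y : A, star (cmul x y) = cmul (star y) (star x);
  starZ : forall (c : R[i]) (x : A), star (c *: x) = (c^*)%C *: star x;
  cnorm_star : forall x : A, `|cmul (star x) x| = `|x| ^+ 2
}.

(* The multiplication is part of the mixin, rather than inherited from a ring
   structure, because Hierarchy Builder rejects a common subclass of [PzRing]
   and [NormedModule]. The zero algebra is not excluded. *)
#[short(type="cstarAlgType")]
HB.structure Definition CStarAlgebra (R : realType) :=
  {A of isCStarAlgebra R A & CompleteNormedModule R[i] A}.

HB.instance Definition _ (R : realType) (A : cstarAlgType R) :=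
  GRing.Zmodule_isPzRing.Build A
    (@cmulA R A) (@cmul1x R A) (@cmulx1 R A) (@cmulDl R A) (@cmulDr R A).

(* Norms of [R[i]]-modules are [R[i]]-valued, with imaginary part 0. *)
Definition rnorm (R : realType) (A : cstarAlgType R) (x : A) : R :=
  complex.Re `|x|.

Inductive starpoly (R : realType) (m : nat) : Type :=
  | SPvar of 'I_m
  | SPconst of R[i]
  | SPadd of starpoly R m & starpoly R m
  | SPmul of starpoly R m & starpoly R m
  | SPstar of starpoly R m.

Fixpoint speval (R : realType) (A : cstarAlgType R) (m : nat) (x : 'I_m -> A)
    (t : starpoly R m) : A :=
  match t with
  | SPvar i => x i
  | SPconst c => c *: (1 : A)
  | SPadd t1 t2 => speval x t1 + speval x t2
  | SPmul t1 t2 => speval x t1 * speval x t2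
  | SPstar t1 => star (speval x t1)
  end.

Record qfformula (R : realType) (m : nat) : Type := QFFormula {
  qf_arity : nat;
  qf_term : 'I_qf_arity -> starpoly R m;
  qf_conn : 'rV[R]_qf_arity -> R;
  qf_conn_continuous : continuous qf_conn
}.
Arguments qf_term {R m} q _.
Arguments qf_conn {R m} q _.

Definition qfeval (R : realType) (A : cstarAlgType R) (m : nat)
    (phi : qfformula R m) (x : 'I_m -> A) : R :=
  qf_conn phi (\row_i rnorm (speval x (qf_term phi i))).

Definition joint (T : Type) (p q : nat) (a : 'I_p -> T) (b : 'I_q -> T)
    (i : 'I_(p + q)) : T :=
  match fintype.split i with inl j => a j | inr j => b j end.

Definition tuple_ball (R : realType) (A : cstarAlgType R) (q n : nat) :
    set ('I_q -> A) :=
  [set b | forall i, rnorm (b i) <= n%:R].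

Definition inf_ball (R : realType) (A : cstarAlgType R) (p q : nat)
    (phi : qfformula R (p + q)) (n : nat) (a : 'I_p -> A) : \bar R :=
  ereal_inf [set (qfeval phi (joint a b))%:E | b in @tuple_ball R A q n].

(* [f] identifies [A] with a unital C*-subalgebra of [B]. *)
Record unital_embedding (R : realType) (A B : cstarAlgType R) (f : A -> B) :
    Prop := UnitalEmbedding {
  embD : {morph f : x y / x + y};
  embZ : forall (c : R[i]) (x : A), f (c *: x) = c *: f x;
  embM : forall x y : A, f (x * y) = f x * f y;
  emb1 : f 1 = 1;
  emb_star : forall x : A, f (star x) = star (f x);
  emb_norm : forall x : A, `|f x| = `|x|
}.

Definition existentially_closed_in (R : realType) (A B : cstarAlgType R)
    (f : A -> B) : Prop :=
  forall (p q : nat) (phi : qfformula R (p + q)) (n : nat) (a : 'I_p -> A),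
    (1 <= n)%N -> inf_ball phi n a = inf_ball phi n (f \o a).

Definition existentially_closed (R : realType) (A : cstarAlgType R) : Prop :=
  forall (B : cstarAlgType R) (f : A -> B),
    unital_embedding f -> existentially_closed_in f.

Section CStarTheory.
Context {R : realType} {A : cstarAlgType R}.
Implicit Types x y : A.

Lemma star0 : star 0 = 0 :> A.
Proof. by apply: (addrI (star 0)); rewrite -starD !addr0. Qed.

Lemma starMr x y : star (x * y) = star y * star x.
Proof. exact: starM. Qed.

Lemma star1 : star 1 = 1 :> A.
Proof. by rewrite -[RHS]starK -[in RHS](mul1r (star 1)) starMr starK mul1r. Qed.

Lemma star_sum (I : Type) (r : seq I) (P : pred I) (F : I -> A) :
  star (\sum_(i <- r | P i) F i) = \sum_(i <- r | P i) star (F i).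
Proof. exact: (big_morph _ (@starD R A) star0). Qed.

Lemma starB x y : star (x - y) = star x - star y.
Proof.
by apply: (addIr (star y)); rewrite -starD !subrK.
Qed.

Lemma cnormMr x y : `|x * y| <= `|x| * `|y|.
Proof. exact: cnormM. Qed.

Lemma norm_star_le x : `|x| <= `|star x|.
Proof.
have [->|x0] := eqVneq x 0; first by rewrite star0.
have nx0 : 0 < `|x| by rewrite normr_gt0.
by rewrite -(ler_pM2r nx0) -expr2 -cnorm_star cnormM.
Qed.

Lemma norm_star x : `|star x| = `|x|.
Proof.
by apply: le_anti; rewrite norm_star_le -[X in _ <= `|X|]starK norm_star_le.
Qed.

End CStarTheory.

Section Continuity.
Context {R : realType} {A : cstarAlgType R} {T : topologicalType}.

Lemma star_cts (f : T -> A) : continuous f -> continuous (fun t => star (f t)).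
Proof.
move=> fc t; apply/cvgrPdist_lt => e e0.
have /cvgrPdist_lt/(_ e e0) := fc t.
by apply: filterS => s; rewrite -starB norm_star.
Qed.

Lemma mul_cts (f g : T -> A) :
  continuous f -> continuous g -> continuous (fun t => f t * g t).
Proof.
move=> fc gc t; apply/cvgrPdist_lt => e e0.
pose a := `|f t| + 1; pose b := `|g t| + 1.
have a0 : 0 < a by rewrite ltr_wpDl.
have b0 : 0 < b by rewrite ltr_wpDl.
have ea : 0 < e / 2 / a by rewrite !divr_gt0.
have eb : 0 < e / 2 / b by rewrite !divr_gt0.
have /cvgrPdist_lt/(_ _ eb) fl1 := fc t.
have /cvgrPdist_lt/(_ _ ea) gl1 := gc t.
have /cvgrPdist_lt/(_ _ ltr01) gl2 := gc t.
near=> s.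
have -> : f t * g t - f s * g s = f t * (g t - g s) + (f t - f s) * g s.
  by rewrite mulrBr mulrBl addrA subrK.
apply: le_lt_trans (ler_normD _ _) _.
rewrite [ltRHS]splitr ler_ltD//.
- apply: le_trans (cnormMr _ _) _.
  have -> : e / 2 = a * (e / 2 / a) by rewrite [RHS]mulrC divfK// gt_eqF.
  apply: ler_pM => //; first by rewrite lerDl.
  by apply: ltW; near: s; exact: gl1.
- apply: le_lt_trans (cnormMr _ _) _.
  have -> : e / 2 = (e / 2 / b) * b by rewrite divfK// gt_eqF.
  have gb : `|g s| <= b.
    rewrite -[g s](subKr (g t)); apply: le_trans (ler_normB _ _) _.
    by rewrite lerD2l ltW//; near: s; exact: gl2.
  apply: le_lt_trans (ler_wpM2l _ gb) _ => //.
  by rewrite ltr_pM2r//; near: s; exact: fl1.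
Unshelve. all: by end_near. Qed.

Lemma sum_cts (I : Type) (r : seq I) (F : I -> T -> A) :
  (forall i, continuous (F i)) -> continuous (fun t => \sum_(i <- r) F i t).
Proof.
move=> Fc; elim: r => [|i r IH] t.
  by under eq_fun do rewrite big_nil; exact: cvg_cst.
under eq_fun do rewrite big_cons.
by apply: cvgD; [exact: Fc|exact: IH].
Qed.

Lemma mx_cts m n (g : T -> 'M[A]_(m, n)) :
  continuous g <-> forall i j, continuous (fun t => g t i j).
Proof.
split=> [gc i j t B nB|gc t].
  apply: (gc t [set M | B (M i j)]); exists (fun k l => if (k == i) && (l == j) then B else setT).
    move=> k l; case: ifPn => [/andP[/eqP-> /eqP->]//|_]; exact: filterT.
  by move=> M /(_ i j); rewrite !eqxx.
move=> B [P nP PB]; rewrite /nbhs/=.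
have : \forall s \near t, forall i j, P i j (g s i j).
  apply: filter_forall => i; apply: filter_forall => j.
  exact: (gc i j t _ (nP i j)).
by apply: filterS => s /PB.
Qed.

End Continuity.

Section UnitaryMatrices.
Context {R : realType} {A : cstarAlgType R}.

Definition adjmx m n (u : 'M[A]_(m, n)) : 'M[A]_(n, m) := map_mx star u^T.

Definition unitary n (u : 'M[A]_n) : bool :=
  (adjmx u *m u == 1%:M) && (u *m adjmx u == 1%:M).

Lemma adjmxM m n p (u : 'M[A]_(m, n)) (v : 'M[A]_(n, p)) :
  adjmx (u *m v) = adjmx v *m adjmx u.
Proof.
apply/matrixP => i j; rewrite !mxE star_sum.
by apply: eq_bigr => k _; rewrite !mxE starMr.
Qed.

Lemma adjmxK m n (u : 'M[A]_(m, n)) : adjmx (adjmx u) = u.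
Proof. by apply/matrixP => i j; rewrite !mxE starK. Qed.

Lemma adjmx1 n : adjmx 1%:M = 1%:M :> 'M[A]_n.
Proof.
apply/matrixP => i j; rewrite !mxE eq_sym.
by case: eqP => _; rewrite ?mulr1n ?mulr0n ?star1 ?star0.
Qed.

Lemma unitary1 n : unitary (1%:M : 'M[A]_n).
Proof. by rewrite /unitary adjmx1 mulmx1 eqxx. Qed.

Lemma unitary_adj n (u : 'M[A]_n) : unitary u -> unitary (adjmx u).
Proof. by rewrite /unitary adjmxK andbC. Qed.

Lemma unitaryVl n (u : 'M[A]_n) : unitary u -> adjmx u *m u = 1%:M.
Proof. by case/andP => /eqP. Qed.

Lemma unitaryVr n (u : 'M[A]_n) : unitary u -> u *m adjmx u = 1%:M.
Proof. by case/andP => _ /eqP. Qed.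

Lemma unitaryM n (u v : 'M[A]_n) : unitary u -> unitary v -> unitary (u *m v).
Proof.
move=> uu uv; rewrite /unitary adjmxM; apply/andP; split; apply/eqP.
- by rewrite mulmxA -(mulmxA (adjmx v)) unitaryVl// mulmx1 unitaryVl.
- by rewrite mulmxA -(mulmxA u) unitaryVr// mulmx1 unitaryVr.
Qed.

(* Continuity refers to the entrywise topology on ['M[A]_n]. It is the topology
   of the C*-norm of M_n(A), as
   max_ij |u_ij| <= |u| <= \sum_ij |u_ij| for that norm. *)
Definition homotopic n (u v : 'M[A]_n) : Prop :=
  exists g : R -> 'M[A]_n,
    [/\ {within `[0, 1], continuous g},
        (forall t, t \in `[0, 1] -> unitary (g t)),
        g 0 = u & g 1 = v].

Lemma homotopic_refl n (u : 'M[A]_n) : unitary u -> homotopic u u.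
Proof. by move=> uu; exists (fun=> u); split=> // t; exact: cvg_cst. Qed.

Lemma homotopicM n (u u' v v' : 'M[A]_n) :
  homotopic u u' -> homotopic v v' -> homotopic (u *m v) (u' *m v').
Proof.
move=> [g [gc gu g0 g1]] [h [hc hu h0 h1]].
exists (fun t => g t *m h t); split; rewrite ?g0 ?h0 ?g1 ?h1//.
  apply/mx_cts => i j.
  rewrite (_ : (fun t => _) = (fun t => \sum_k g t i k * h t k j)); last first.
    by apply/funext => t; rewrite mxE.
  apply: sum_cts => k; apply: mul_cts; first by move/mx_cts : gc; exact.
  by move/mx_cts : hc; exact.
by move=> t t01; rewrite unitaryM ?gu ?hu.
Qed.

Lemma homotopic_adj n (u v : 'M[A]_n) :
  homotopic u v -> homotopic (adjmx u) (adjmx v).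
Proof.
move=> [g [gc gu g0 g1]].
exists (fun t => adjmx (g t)); split; rewrite ?g0 ?g1//.
  apply/mx_cts => i j.
  rewrite (_ : (fun t => _) = (fun t => star (g t j i))); last first.
    by apply/funext => t; rewrite !mxE.
  by apply: star_cts; move/mx_cts : gc; exact.
by move=> t t01; rewrite unitary_adj ?gu.
Qed.

Lemma homotopic_unitary n (u v : 'M[A]_n) :
  homotopic u v -> unitary u /\ unitary v.
Proof.
move=> [g [_ gu <- <-]].
by split; apply: gu; rewrite in_itv/= lexx ler01.
Qed.

Lemma homotopic_sym n (u v : 'M[A]_n) : homotopic u v -> homotopic v u.
Proof.
move=> uv; have [uu uv'] := homotopic_unitary uv.
have := homotopicM (homotopicM (homotopic_refl uu) (homotopic_adj uv))
  (homotopic_refl uv').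
by rewrite unitaryVr// mul1mx -mulmxA unitaryVl// mulmx1.
Qed.

Lemma homotopic_trans n (v u w : 'M[A]_n) :
  homotopic u v -> homotopic v w -> homotopic u w.
Proof.
move=> uv vw; have [_ uv'] := homotopic_unitary uv.
have := homotopicM (homotopicM uv (homotopic_refl (unitary_adj uv'))) vw.
by rewrite unitaryVr// mul1mx -mulmxA unitaryVl// mulmx1.
Qed.

(* The embedding u |-> u (+) 1 of M_m(A) into M_n(A) *)
Definition pad m n (mn : (m <= n)%N) (u : 'M[A]_m) : 'M[A]_n :=
  castmx (subnKC mn, subnKC mn) (block_mx u 0 0 1%:M).

Lemma padE m n (mn : (m <= n)%N) (u : 'M[A]_m) i j :
  pad mn u i j = match insub (i : nat), insub (j : nat) with
                 | Some i', Some j' => u i' j'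
                 | _, _ => (i == j)%:R
                 end.
Proof.
rewrite /pad castmxE.
set i1 := cast_ord _ i; set j1 := cast_ord _ j.
have -> : (i == j) = (i1 == j1) by [].
have -> : (i : nat) = i1 by [].
have -> : (j : nat) = j1 by [].
case: (split_ordP i1) => i2 ->; case: (split_ordP j1) => j2 -> /=.
- by rewrite block_mxEul !insubT//= => p q; congr (u _ _); exact: val_inj.
- rewrite block_mxEur mxE insubT//= insubF ?ltnNge ?leq_addr//.
  by rewrite eq_lrshift.
- by rewrite block_mxEdl mxE insubF ?ltnNge ?leq_addr// eq_rlshift.
- by rewrite block_mxEdr mxE insubF ?ltnNge ?leq_addr// eq_rshift.
Qed.

Lemma pad_id n (nn : (n <= n)%N) (u : 'M[A]_n) : pad nn u = u.
Proof.
apply/matrixP => i j; rewrite padE !insubT//= => p q.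
by congr (u _ _); exact: val_inj.
Qed.

Lemma pad_pad m n p (mn : (m <= n)%N) (np : (n <= p)%N) (mp : (m <= p)%N)
    (u : 'M[A]_m) : pad np (pad mn u) = pad mp u.
Proof.
apply/matrixP => i j; rewrite !padE.
have lt_m k : (n <= k)%N -> (k < m)%N = false.
  by move=> nk; rewrite ltnNge (leq_trans mn nk).
case: (ltnP i n) => ni; last by rewrite !insubF ?lt_m// ltnNge ni.
case: (ltnP j n) => nj; rewrite insubT.
  by rewrite insubT padE.
by rewrite !(@insubF _ _ _ (j : nat)) ?lt_m// 1?ltnNge ?nj//; case: insub.
Qed.

Lemma pad_eq m n (h1 h2 : (m <= n)%N) (u : 'M[A]_m) : pad h1 u = pad h2 u.
Proof. by rewrite (bool_irrelevance h1 h2). Qed.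

Let castmxM n p (e : n = p) (u v : 'M[A]_n) :
  castmx (e, e) (u *m v) = castmx (e, e) u *m castmx (e, e) v.
Proof. by case: p / e; rewrite !castmx_id. Qed.

Lemma padM m n (mn : (m <= n)%N) (u v : 'M[A]_m) :
  pad mn (u *m v) = pad mn u *m pad mn v.
Proof.
rewrite /pad -castmxM mulmx_block.
by rewrite !mulmx0 !mul0mx !addr0 !add0r mulmx1.
Qed.

Lemma pad1 m n (mn : (m <= n)%N) : pad mn 1%:M = 1%:M.
Proof.
rewrite /pad -scalar_mx_block; apply/matrixP => i j.
by rewrite castmxE !mxE.
Qed.

Lemma pad_adj m n (mn : (m <= n)%N) (u : 'M[A]_m) :
  pad mn (adjmx u) = adjmx (pad mn u).
Proof.
apply/matrixP => i j; rewrite !mxE !padE [j == i]eq_sym.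
by case: insub => [i'|]; case: insub => [j'|]; rewrite ?mxE//;
  case: eqP; rewrite ?star1 ?star0.
Qed.

Lemma unitary_pad m n (mn : (m <= n)%N) (u : 'M[A]_m) :
  unitary u -> unitary (pad mn u).
Proof.
by move=> uu; rewrite /unitary -pad_adj -!padM unitaryVl// unitaryVr// pad1 eqxx.
Qed.

Lemma homotopic_pad m n (mn : (m <= n)%N) (u v : 'M[A]_m) :
  homotopic u v -> homotopic (pad mn u) (pad mn v).
Proof.
move=> [g [gc gu g0 g1]].
exists (fun t => pad mn (g t)); split; rewrite ?g0 ?g1//.
  apply/mx_cts => i j.
  rewrite (_ : (fun t => _) = (fun t => match insub (i : nat), insub (j : nat)
    with Some i', Some j' => g t i' j' | _, _ => (i == j)%:R end)); last first.
    by apply/funext => t; rewrite padE.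
  case: insub => [i'|]; last by move=> t; exact: cvg_cst.
  case: insub => [j'|]; last by move=> t; exact: cvg_cst.
  by move/mx_cts : gc; exact.
by move=> t t01; rewrite unitary_pad ?gu.
Qed.

End UnitaryMatrices.

Section Rotation.
Context {R : realType} {A : cstarAlgType R}.

Let r (x : R) : A := x%:C%C *: (1 : A).

Let rD x y : r (x + y) = r x + r y.
Proof. by rewrite /r rmorphD scalerDl. Qed.

Let rM x y : r (x * y) = r x * r y.
Proof.
rewrite /r rmorphM -scalerA; set a := y%:C%C *: (1 : A).
by rewrite -[in LHS](mul1r a); exact: cscaleAl.
Qed.

Let star_r x : star (r x) = r x.
Proof. by rewrite /r starZ star1 conjc_real. Qed.

Let posc (e : R[i]) : 0 < e -> e = (complex.Re e)%:C%C /\ 0 < complex.Re e.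
Proof. by case: e => a b; rewrite ltcE/= => /andP[/eqP -> ?]. Qed.

Let r_cts (T : topologicalType) (f : T -> R) :
  continuous f -> continuous (fun t => r (f t)).
Proof.
move=> fc t; apply: (@cvgZ _ _ _ _ _ (fun s => (f s)%:C%C)); last exact: cvg_cst.
apply/cvgrPdist_lt => e e0.
have [eR e0'] := posc e0.
have /cvgrPdist_lt/(_ _ e0') := fc t.
apply: filterS => s; rewrite eR -rmorphB/= => h.
by rewrite normc_def/= expr0n/= addr0 sqrtr_sqr ltcR.
Qed.

Let W n (t : R) : 'M[A]_(n + n) :=
  block_mx (r (cos (t * (pi / 2))))%:M (r (- sin (t * (pi / 2))))%:M
           (r (sin (t * (pi / 2))))%:M (r (cos (t * (pi / 2))))%:M.

Let adjW n t : adjmx (W n t) =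
  block_mx (r (cos (t * (pi / 2))))%:M (r (sin (t * (pi / 2))))%:M
           (r (- sin (t * (pi / 2))))%:M (r (cos (t * (pi / 2))))%:M.
Proof.
have adj_scalar x : map_mx star (r x)%:M = (r x)%:M :> 'M[A]_n.
  apply/matrixP => i j; rewrite !mxE.
  by case: eqP => _; rewrite ?mulr1n ?mulr0n ?star_r ?star0.
by rewrite /adjmx /W tr_block_mx map_block_mx !tr_scalar_mx !adj_scalar.
Qed.

Let unitaryW n t : unitary (W n t).
Proof.
rewrite /unitary adjW /W !mulmx_block -!scalar_mxM -!raddfD/= -!rM -!rD.
rewrite !mulNr !mulrN !opprK -!expr2 cos2Dsin2 [_ ^+ 2 + _]addrC cos2Dsin2.
rewrite [sin _ * cos _]mulrC !subrr !addNr /r rmorph1 rmorph0 scale1r scale0r.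
by rewrite raddf0 -scalar_mx_block eqxx.
Qed.

Lemma rotation_homotopic n (u : 'M[A]_n) : unitary u ->
  homotopic (block_mx u 0 0 1%:M) (block_mx 1%:M 0 0 u).
Proof.
move=> uu; pose B := block_mx u 0 0 (1%:M : 'M[A]_n).
have uB : unitary B.
  have adjB : adjmx B = block_mx (adjmx u) 0 0 1%:M.
    have adj0 : map_mx star (0 : 'M[A]_n) = 0.
      by apply/matrixP => i j; rewrite !mxE star0.
    by rewrite /adjmx tr_block_mx map_block_mx !trmx0 adj0 -!/(adjmx _) adjmx1.
  rewrite /unitary adjB /B !mulmx_block !mulmx0 !mul0mx !addr0 !add0r mulmx1.
  by rewrite unitaryVl// unitaryVr// -scalar_mx_block eqxx.
have hW : homotopic 1%:M (W n 1).
  exists (W n); split=> //.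
  - apply: continuous_subspaceT; apply/mx_cts => i j.
    have cc : continuous (fun t : R => cos (t * (pi / 2))).
      move=> t; apply: (@continuous_comp _ _ _ (fun t : R => t * (pi / 2)) cos).
        exact: mulrr_continuous.
      exact: continuous_cos.
    have cs : continuous (fun t : R => sin (t * (pi / 2))).
      move=> t; apply: (@continuous_comp _ _ _ (fun t : R => t * (pi / 2)) sin).
        exact: mulrr_continuous.
      exact: continuous_sin.
    have scal (f : R -> R) (k l : 'I_n) : continuous f ->
        continuous (fun t => ((r (f t))%:M : 'M[A]_n) k l).
      move=> fc; rewrite (_ : (fun t => _) = (fun t => r (f t) *+ (k == l))).
        by case: eqP => _; [exact: r_cts|move=> t; exact: cvg_cst].
      by apply/funext => t; rewrite mxE.
    case: (split_ordP i) => k ->; case: (split_ordP j) => l ->.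
    + under eq_fun do rewrite block_mxEul; exact: scal.
    + under eq_fun do rewrite block_mxEur; apply: scal => t.
      by apply: cvgN; exact: cs.
    + under eq_fun do rewrite block_mxEdl; exact: scal.
    + under eq_fun do rewrite block_mxEdr; exact: scal.
  - rewrite /W mul0r cos0 sin0 oppr0 /r rmorph1 rmorph0 scale1r scale0r.
    by rewrite raddf0 -scalar_mx_block.
have := homotopicM (homotopicM hW (homotopic_refl uB)) (homotopic_adj hW).
rewrite adjmx1 mulmx1 mul1mx adjW /W mul1r cos_pihalf sin_pihalf.
rewrite /B !mulmx_block.
have -> : r (-1) = - r 1 by rewrite /r rmorphN scaleNr.
have -> : r 0 = 0 by rewrite /r rmorph0 scale0r.
have -> : r 1 = 1 by rewrite /r rmorph1 scale1r.
have -> : (-1)%:M = - 1%:M :> 'M[A]_n by rewrite raddfN.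
have -> : 0%:M = 0 :> 'M[A]_n by rewrite raddf0.
by rewrite !(mulmx0, mul0mx, addr0, add0r, mul1mx, mulmx1, mulNmx, mulmxN,
  opprK, oppr0).
Qed.

End Rotation.

Section InfiniteUnitaries.
Context {R : realType} {A : cstarAlgType R}.

(* The disjoint union U_oo(A) of the unitary groups U_n(A), n >= 1 *)
Definition Uinf : Type := {u : {n : nat & 'M[A]_n.+1} | unitary (tagged u)}.
HB.instance Definition _ := Choice.on Uinf.

Implicit Types u v w : Uinf.

Definition Udim u : nat := (tag (val u)).+1.

Definition Umx u : 'M[A]_(Udim u) := tagged (val u).

Lemma unitary_Umx u : unitary (Umx u).
Proof. exact: (valP u). Qed.

Definition mkU n (M : 'M[A]_n.+1) (uM : unitary M) : Uinf :=
  exist (fun x : {n : nat & 'M[A]_n.+1} => unitary (tagged x)) (Tagged _ M) uM.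

Definition K1rel u v : bool :=
  `[< exists (k : nat) (hu : (Udim u <= k)%N) (hv : (Udim v <= k)%N),
        homotopic (pad hu (Umx u)) (pad hv (Umx v)) >].

Lemma K1rel_refl : reflexive K1rel.
Proof.
move=> u; apply/asboolP; exists (Udim u), (leqnn _), (leqnn _).
exact/homotopic_refl/unitary_pad/unitary_Umx.
Qed.

Lemma K1rel_sym : symmetric K1rel.
Proof.
move=> u v; apply/asboolP/asboolP => -[k [hu [hv h]]];
  by exists k, hv, hu; exact: homotopic_sym.
Qed.

Lemma K1rel_trans : transitive K1rel.
Proof.
move=> v u w /asboolP[k [hu [hv uv]]] /asboolP[l [hv' [hw vw]]]; apply/asboolP.
have hk := leq_maxl k l; have hl := leq_maxr k l.
exists (maxn k l), (leq_trans hu hk), (leq_trans hw hl).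
apply: (@homotopic_trans _ _ _ (pad (leq_trans hv hk) (Umx v))).
- rewrite -(pad_pad hu hk) -(pad_pad hv hk); exact: homotopic_pad.
- rewrite -(pad_pad hv' hl) -(pad_pad hw hl); exact: homotopic_pad.
Qed.

Canonical K1_equiv := EquivRel K1rel K1rel_refl K1rel_sym K1rel_trans.

Definition Uone : Uinf := mkU (unitary1 1).

Definition Uinv u : Uinf := mkU (unitary_adj (unitary_Umx u)).

Lemma Udim_maxl u v : (Udim u <= (maxn (tag (val u)) (tag (val v))).+1)%N.
Proof. by rewrite ltnS leq_maxl. Qed.

Lemma Udim_maxr u v : (Udim v <= (maxn (tag (val u)) (tag (val v))).+1)%N.
Proof. by rewrite ltnS leq_maxr. Qed.

Definition Umul u v : Uinf :=
  mkU (unitaryM (unitary_pad (Udim_maxl u v) (unitary_Umx u))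
                (unitary_pad (Udim_maxr u v) (unitary_Umx v))).

Lemma pad_Umul u v k (huv : (Udim (Umul u v) <= k)%N) (hu : (Udim u <= k)%N)
    (hv : (Udim v <= k)%N) :
  pad huv (Umx (Umul u v)) = pad hu (Umx u) *m pad hv (Umx v).
Proof. by rewrite padM (pad_pad _ _ hu) (pad_pad _ _ hv). Qed.

Lemma pad_Uinv u k (hu' : (Udim (Uinv u) <= k)%N) (hu : (Udim u <= k)%N) :
  pad hu' (Umx (Uinv u)) = adjmx (pad hu (Umx u)).
Proof. by rewrite -pad_adj; exact: pad_eq. Qed.

Lemma pad_Uone k (h : (Udim Uone <= k)%N) : pad h (Umx Uone) = 1%:M.
Proof. exact: pad1. Qed.

Lemma Udim_mul u v k :
  (Udim u <= k)%N -> (Udim v <= k)%N -> (Udim (Umul u v) <= k)%N.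
Proof. by rewrite /Udim/= gtn_max => -> ->. Qed.

Lemma K1relI u v k (hu : (Udim u <= k)%N) (hv : (Udim v <= k)%N) :
  homotopic (pad hu (Umx u)) (pad hv (Umx v)) -> K1rel u v.
Proof. by move=> h; apply/asboolP; exists k, hu, hv. Qed.

Lemma K1relI_eq u v k (hu : (Udim u <= k)%N) (hv : (Udim v <= k)%N) :
  pad hu (Umx u) = pad hv (Umx v) -> K1rel u v.
Proof.
move=> uv; apply: (@K1relI _ _ _ hu hv); rewrite -uv.
exact/homotopic_refl/unitary_pad/unitary_Umx.
Qed.

Lemma K1rel_ge u v k0 : K1rel u v ->
  exists (k : nat) (hu : (Udim u <= k)%N) (hv : (Udim v <= k)%N),
    (k0 <= k)%N /\ homotopic (pad hu (Umx u)) (pad hv (Umx v)).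
Proof.
move=> /asboolP[k [hu [hv uv]]].
have hk := leq_maxl k k0; have hk0 := leq_maxr k k0.
exists (maxn k k0), (leq_trans hu hk), (leq_trans hv hk); split=> //.
by rewrite -(pad_pad hu hk) -(pad_pad hv hk); exact: homotopic_pad.
Qed.

Lemma K1rel_mul u u' v v' :
  K1rel u u' -> K1rel v v' -> K1rel (Umul u v) (Umul u' v').
Proof.
move=> /asboolP[k [hu [hu' uu']]] /(K1rel_ge k)[l [hv [hv' [kl vv']]]].
have hul := leq_trans hu kl; have hul' := leq_trans hu' kl.
apply: (@K1relI _ _ l (Udim_mul hul hv) (Udim_mul hul' hv')).
rewrite (pad_Umul _ hul hv) (pad_Umul _ hul' hv'); apply: homotopicM => //.
by rewrite -(pad_pad hu kl) -(pad_pad hu' kl); exact: homotopic_pad.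
Qed.

Lemma K1rel_inv u v : K1rel u v -> K1rel (Uinv u) (Uinv v).
Proof.
move=> /asboolP[k [hu [hv uv]]].
apply: (@K1relI (Uinv u) (Uinv v) k hu hv).
by rewrite !pad_Uinv; exact: homotopic_adj.
Qed.

Lemma UmulA u v w : K1rel (Umul u (Umul v w)) (Umul (Umul u v) w).
Proof.
pose k := (Udim u + Udim v + Udim w)%N.
have hu : (Udim u <= k)%N by rewrite /k -addnA leq_addr.
have hv : (Udim v <= k)%N by rewrite /k addnAC leq_addl.
have hw : (Udim w <= k)%N by rewrite leq_addl.
have huv := Udim_mul hu hv; have hvw := Udim_mul hv hw.
apply: (@K1relI_eq _ _ k (Udim_mul hu hvw) (Udim_mul huv hw)).
by rewrite (pad_Umul _ hu hvw) (pad_Umul _ huv hw) !(pad_Umul _ _ _) mulmxA.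
Qed.

Lemma Umul1u u : K1rel (Umul Uone u) u.
Proof.
have h1 : (Udim Uone <= Udim u)%N by [].
apply: (@K1relI_eq _ _ _ (Udim_mul h1 (leqnn _)) (leqnn _)).
by rewrite (pad_Umul _ h1 (leqnn _)) pad_Uone mul1mx.
Qed.

Lemma UmulVu u : K1rel (Umul (Uinv u) u) Uone.
Proof.
have h1 : (Udim Uone <= Udim u)%N by [].
have hu : (Udim (Uinv u) <= Udim u)%N by [].
apply: (@K1relI_eq _ _ _ (Udim_mul hu (leqnn _)) h1).
rewrite (pad_Umul _ hu (leqnn _)) pad_Uone (pad_Uinv _ (leqnn _)) unitaryVl//.
exact/unitary_pad/unitary_Umx.
Qed.

(* uv (+) 1 = (u (+) 1)(v (+) 1) ~ (u (+) 1)(1 (+) v) = (1 (+) v)(u (+) 1)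
   ~ (v (+) 1)(u (+) 1) = vu (+) 1 *)
Lemma UmulC u v : K1rel (Umul u v) (Umul v u).
Proof.
pose n := maxn (Udim u) (Udim v).
have hu : (Udim u <= n)%N by exact: leq_maxl.
have hv : (Udim v <= n)%N by exact: leq_maxr.
have hn : (n <= n + n)%N by exact: leq_addr.
have hun := leq_trans hu hn; have hvn := leq_trans hv hn.
apply: (@K1relI _ _ _ (Udim_mul hun hvn) (Udim_mul hvn hun)).
rewrite (pad_Umul _ hun hvn) (pad_Umul _ hvn hun).
rewrite -!(pad_pad hu hn) -!(pad_pad hv hn).
have uU := unitary_pad hu (unitary_Umx u).
have uV := unitary_pad hv (unitary_Umx v).
have padn (M : 'M[A]_n) : pad hn M = block_mx M 0 0 1%:M.
  apply/matrixP => i j; rewrite padE.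
  case: (split_ordP i) => i' ->; case: (split_ordP j) => j' ->.
  - by rewrite block_mxEul !insubT//= => p q; congr (M _ _); exact: val_inj.
  - rewrite block_mxEur mxE insubT//= insubF ?ltnNge ?leq_addr//.
    by rewrite eq_lrshift.
  - by rewrite block_mxEdl mxE insubF ?ltnNge ?leq_addr// eq_rlshift.
  - by rewrite block_mxEdr mxE insubF ?ltnNge ?leq_addr// eq_rshift.
have comm : pad hn (pad hu (Umx u)) *m block_mx 1%:M 0 0 (pad hv (Umx v)) =
    block_mx 1%:M 0 0 (pad hv (Umx v)) *m pad hn (pad hu (Umx u)).
  by rewrite padn !mulmx_block
    !(mulmx0, mul0mx, addr0, add0r, mul1mx, mulmx1).
have rot := rotation_homotopic uV; rewrite -padn in rot.
have hU := homotopic_refl (unitary_pad hn uU).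
apply: homotopic_trans (homotopicM hU rot) _; rewrite comm.
exact: homotopicM (homotopic_sym rot) hU.
Qed.

End InfiniteUnitaries.

Arguments Uinf {R} A.
Arguments Uone {R A}.

(* K_1(A) = U_oo(A) / ~, the direct limit of the groups of path components of
   the U_n(A) along u |-> u (+) 1, written additively. *)
Definition K1 (R : realType) (A : cstarAlgType R) : Type :=
  {eq_quot (@K1_equiv R A)}.

Section K1Group.
Context {R : realType} {A : cstarAlgType R}.

HB.instance Definition _ := Choice.on (K1 A).
HB.instance Definition _ := EqQuotient.on (K1 A).

Definition K1zero : K1 A := \pi_(K1 A) Uone.
Definition K1opp (x : K1 A) : K1 A := \pi_(K1 A) (Uinv (repr x)).
Definition K1add (x y : K1 A) : K1 A := \pi_(K1 A) (Umul (repr x) (repr y)).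

Lemma pi_K1opp (u : Uinf A) : K1opp (\pi_(K1 A) u) = \pi_(K1 A) (Uinv u).
Proof. by apply/eqmodP/K1rel_inv/eqmodP; rewrite reprK. Qed.

Lemma pi_K1add (u v : Uinf A) : K1add (\pi_(K1 A) u) (\pi_(K1 A) v) = \pi_(K1 A) (Umul u v).
Proof. by apply/eqmodP/K1rel_mul; apply/eqmodP; rewrite reprK. Qed.

Lemma K1addA : associative K1add.
Proof.
elim/quotW=> u; elim/quotW=> v; elim/quotW=> w.
rewrite (pi_K1add v w) (pi_K1add u v) !pi_K1add.
apply/eqmodP; exact: UmulA.
Qed.

Lemma K1addC : commutative K1add.
Proof.
by elim/quotW=> u; elim/quotW=> v; rewrite !pi_K1add; apply/eqmodP; exact: UmulC.
Qed.

Lemma K1add0x : left_id K1zero K1add.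
Proof. by elim/quotW=> u; rewrite pi_K1add; apply/eqmodP; exact: Umul1u. Qed.

Lemma K1addNx : left_inverse K1zero K1opp K1add.
Proof.
by elim/quotW=> u; rewrite pi_K1opp pi_K1add; apply/eqmodP; exact: UmulVu.
Qed.

HB.instance Definition _ :=
  GRing.isZmodule.Build (K1 A) K1addA K1addC K1add0x K1addNx.

End K1Group.

(* Main.v *)
(** Let B be the algebra of adjointable operators of the Hilbert module l^2(A), in
which A acts diagonally. The even and odd shifts of l^2(A) are isometries s_0 and
s_1 of B that commute with A and satisfy s_0 s_0^* + s_1 s_1^* = 1. If A is
existentially closed then, up to any given error, A itself contains such elements
commuting with the entries of a unitary u of M_n(A). The self-adjoint matrix
W = [[0, s_0, s_1], [s_0^*, 0, 0], [s_1^*, 0, 0]] over M_n(A) is then nearly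
unitary, and it nearly conjugates diag(1, u, u) to diag(u, 1, 1). Replacing W by
the unitary W (W^2)^(-1/2), and since nearby unitaries are homotopic, we get
2[u] = [u] in K_1(A), that is [u] = 0.

That l^2(A) is a Hilbert module rests on the positivity of a^* a, proved from
iterated square roots alone, without spectral theory. *)
From HB Require Import structures.
Require Import Defs.
From mathcomp Require Import all_boot all_order all_algebra.
From mathcomp Require Import complex ring lra.
From mathcomp Require Import all_classical all_reals all_analysis.

Set Implicit Arguments.
Unset Strict Implicit.
Unset Printing Implicit Defensive.

Import Order.TTheory GRing.Theory Num.Theory.
Import numFieldNormedType.Exports.

Local Open Scope classical_set_scope.
Local Open Scope ring_scope.
Local Open Scope complex_scope.

(** * Norms and limits *)

(** For exact relations, [W^2] has the blocks s_0 s_0^* + s_1 s_1^* and s_p^* s_q, so W is a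
    self-adjoint unitary. Since u commutes with both s_p, W diag(1, u, u) W has the corner s_0 u
    s_0^* + s_1 u s_1^* = u, and its other blocks are those of the identity. These relations are
    finitely many, have the entries of u as parameters and unknowns in the unit ball, which is the
    form that existential closedness transfers. Taking B inside operators on l^2(A) replaces a
    tensor product with the Cuntz algebra O_2, for which a C*-norm would have to be built. The
    obstacle is that the infimum of a formula need not be attained in A, so only approximate
    relations come back and each later step has to be stable. M_n(A) itself is never made into a
    C*-algebra: square roots, inverses and paths of matrices are limits in an entrywise norm,
    controlled by scalar recursions. That norm costs factors depending on the matrix size, which are
    harmless because the size is fixed by u before the tolerance is chosen. *)

Section ComplexScalars.
Context {R : realType}.
Implicit Types c e : R[i].

Lemma Re_norm_ge0 c : 0 <= complex.Re `|c|.
Proof. by have := normr_ge0 c; rewrite lecE => /andP[]. Qed.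

Lemma normc_ReE c : `|c| = (complex.Re `|c|)%:C.
Proof. by have := normr_ge0 c; rewrite lecE; case: `|c| => a b /= /andP[/eqP-> _]. Qed.

Lemma gt0_ReE e : 0 < e -> e = (complex.Re e)%:C /\ 0 < complex.Re e.
Proof. by case: e => a b; rewrite ltcE/= => /andP[/eqP -> ?]. Qed.

Lemma conjc_i : ('i^*)%C = - 'i :> R[i].
Proof. by simpc; apply/eqP; rewrite eq_complex /= ?oppr0 !eqxx. Qed.

End ComplexScalars.

Section RealNorm.
Context {R : realType} {A : cstarAlgType R}.
Implicit Types (x y : A) (c : R[i]).

Lemma rnormE x : `|x| = (rnorm x)%:C.
Proof.
have := normr_ge0 x; rewrite /rnorm; case: `|x| => a b.
by rewrite lecE/= => /andP[/eqP -> _].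
Qed.

Lemma rnorm_ge0 x : 0 <= rnorm x.
Proof. by have := normr_ge0 x; rewrite rnormE lecR. Qed.

Lemma rnorm0 : rnorm (0 : A) = 0.
Proof. by rewrite /rnorm normr0. Qed.

Lemma rnorm0_eq0 x : rnorm x = 0 -> x = 0.
Proof. by move=> h; apply/normr0_eq0; rewrite rnormE h. Qed.

Lemma rnormD x y : rnorm (x + y) <= rnorm x + rnorm y.
Proof. by have := ler_normD x y; rewrite !rnormE -rmorphD lecR. Qed.

Lemma rnormN x : rnorm (- x) = rnorm x.
Proof. by rewrite /rnorm normrN. Qed.

Lemma rnormB x y : rnorm (x - y) <= rnorm x + rnorm y.
Proof. by rewrite (le_trans (rnormD _ _))// rnormN. Qed.

Lemma rnormC x y : rnorm (x - y) = rnorm (y - x).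
Proof. by rewrite -rnormN opprB. Qed.

Lemma rnorm_triangle z x y : rnorm (x - y) <= rnorm (x - z) + rnorm (z - y).
Proof. by rewrite (le_trans _ (rnormD _ _))// addrA subrK. Qed.

Lemma rnormM x y : rnorm (x * y) <= rnorm x * rnorm y.
Proof. by have := cnormMr x y; rewrite !rnormE -rmorphM lecR. Qed.

Lemma rnorm_star x : rnorm (star x) = rnorm x.
Proof. by rewrite /rnorm norm_star. Qed.

Lemma rnorm_starM x : rnorm (star x * x) = rnorm x ^+ 2.
Proof.
have := cnorm_star x; rewrite -[cmul _ _]/(star x * x) !rnormE -rmorphXn.
by case.
Qed.

Lemma rnormZ c x : rnorm (c *: x) = complex.Re `|c| * rnorm x.
Proof.
rewrite {1}/rnorm normrZ rnormE normc_def /=.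
by rewrite mulr0 subr0.
Qed.

Lemma rnormZr (t : R) x : rnorm (t%:C *: x) = `|t| * rnorm x.
Proof. by rewrite rnormZ normc_def/= expr0n/= addr0 sqrtr_sqr. Qed.

Lemma rnorm_sum (I : Type) (r : seq I) (P : pred I) (F : I -> A) :
  rnorm (\sum_(i <- r | P i) F i) <= \sum_(i <- r | P i) rnorm (F i).
Proof.
elim/big_ind2: _ => [|x a y b xa yb|//]; first by rewrite rnorm0.
exact: le_trans (rnormD _ _) (lerD xa yb).
Qed.

Lemma rnorm1 : rnorm (1 : A) <= 1.
Proof.
have := rnorm_starM (1 : A); rewrite star1 mulr1 => h.
have := rnorm_ge0 (1 : A); nra.
Qed.

Lemma cscalerAl c x y : (c *: x) * y = c *: (x * y).
Proof. exact/esym/cscaleAl. Qed.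

Lemma cscalerAr c x y : x * (c *: y) = c *: (x * y).
Proof. exact/esym/cscaleAr. Qed.

Lemma starN x : star (- x) = - star x.
Proof. by rewrite -[- x]sub0r starB star0 sub0r. Qed.

Lemma starZr (t : R) x : star (t%:C *: x) = t%:C *: star x.
Proof. by rewrite starZ conjc_real. Qed.

End RealNorm.

Section SequenceLimits.
Context {R : realType} {A : cstarAlgType R}.
Implicit Types (u v : nat -> A) (l : A).

(** Tolerances are taken in the totally ordered field [R], so that all estimates are real
    arithmetic, whereas the norms of the module structure take values in [R[i]]. *)
Definition tends u l := forall e : R, 0 < e ->
  exists N, forall n, (N <= n)%N -> rnorm (u n - l) < e.

Definition cauchyseq u := forall e : R, 0 < e ->
  exists N, forall m n, (N <= m)%N -> (N <= n)%N -> rnorm (u m - u n) < e.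

Lemma cauchy_tends u : cauchyseq u -> exists l, tends u l.
Proof.
move=> cu.
have cvu : cvgn u.
  apply: cauchy_cvg; apply: cauchy_exP => e /gt0_ReE[eE e0].
  have [N HN] := cu _ e0; exists (u N); exists N => // n /= Nn.
  by rewrite -ball_normE /= rnormE eE ltcR; apply: HN.
exists (limn u) => e e0.
have e0' : 0 < e%:C by rewrite ltcR.
have /cvgrPdist_lt/(_ _ e0')[N _ HN] := cvu.
by exists N => n /HN /=; rewrite rnormE ltcR rnormC.
Qed.

Lemma rnorm_small (x : A) : (forall e : R, 0 < e -> rnorm x <= e) -> x = 0.
Proof.
move=> h; apply: rnorm0_eq0; apply/le_anti; rewrite rnorm_ge0 andbT.
by apply/ler_addgt0Pr => e /h; rewrite add0r.
Qed.

Lemma tends_unique u l l' : tends u l -> tends u l' -> l = l'.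
Proof.
move=> h h'; apply/subr0_eq/rnorm_small => e e0.
have e20 : 0 < e / 2 by lra.
have [N HN] := h _ e20; have [N' HN'] := h' _ e20.
have := HN _ (leq_maxl N N'); have := HN' _ (leq_maxr N N').
set x := u _ => h1 h2.
by have := rnorm_triangle x l l'; rewrite [rnorm (l - x)]rnormC; lra.
Qed.

Lemma tends_cst l : tends (fun=> l) l.
Proof. by move=> e e0; exists 0%N => n _; rewrite subrr rnorm0. Qed.

Lemma tends_ext u v l : (forall n, u n = v n) -> tends u l -> tends v l.
Proof. by move=> /funext ->. Qed.

Lemma tendsD u v l l' : tends u l -> tends v l' ->
  tends (fun n => u n + v n) (l + l').
Proof.
move=> h h' e e0.
have e20 : 0 < e / 2 by lra.
have [N HN] := h _ e20; have [N' HN'] := h' _ e20.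
exists (maxn N N') => n; rewrite geq_max => /andP[/HN h1 /HN' h2].
have := rnormD (u n - l) (v n - l'); rewrite addrACA -opprD; lra.
Qed.

Lemma tends_lip (f : A -> A) (K : R) u l :
  (forall x y, rnorm (f x - f y) <= K * rnorm (x - y)) ->
  tends u l -> tends (fun n => f (u n)) (f l).
Proof.
move=> fK h e e0.
have K0 : 0 < `|K| + 1 by rewrite ltr_wpDl.
have [N HN] := h _ (divr_gt0 e0 K0).
exists N => n /HN; rewrite ltr_pdivlMr// => h1.
have h2 := rnorm_ge0 (u n - l); have h3 := ler_norm K.
by have := fK (u n) l; nra.
Qed.

Lemma tends_star u l : tends u l -> tends (fun n => star (u n)) (star l).
Proof.
by apply: (@tends_lip star 1) => x y; rewrite -starB rnorm_star mul1r.
Qed.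

Lemma tendsZ c u l : tends u l -> tends (fun n => c *: u n) (c *: l).
Proof.
by apply: (@tends_lip (fun x => c *: x) (complex.Re `|c|)) => x y; rewrite -scalerBr rnormZ.
Qed.

Lemma tendsN u l : tends u l -> tends (fun n => - u n) (- l).
Proof.
by apply: (@tends_lip (fun x => - x) 1) => x y; rewrite -opprD rnormN mul1r.
Qed.

Lemma tendsB u v l l' : tends u l -> tends v l' ->
  tends (fun n => u n - v n) (l - l').
Proof. by move=> h /tendsN; exact: tendsD. Qed.

Lemma tends_bounded u l : tends u l ->
  exists (M : R) N, 0 < M /\ forall n, (N <= n)%N -> rnorm (u n) <= M.
Proof.
move=> h; have [N HN] := h 1 ltr01.
exists (rnorm l + 1), N; split; first by rewrite ltr_wpDl// rnorm_ge0.
move=> n /HN h1; have := rnormD (u n - l) l; rewrite subrK; lra.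
Qed.

Lemma tendsM u v l l' : tends u l -> tends v l' ->
  tends (fun n => u n * v n) (l * l').
Proof.
move=> h h'; have [M [N0 [M0 HM]]] := tends_bounded h => e e0.
have L0 : 0 < rnorm l' + 1 by rewrite ltr_wpDl// rnorm_ge0.
have e1 : 0 < e / 2 / M by rewrite !divr_gt0.
have e2 : 0 < e / 2 / (rnorm l' + 1) by rewrite !divr_gt0.
have [N1 HN1] := h _ e2; have [N2 HN2] := h' _ e1.
exists (maxn N0 (maxn N1 N2)) => n.
rewrite !geq_max => /and3P[/HM h1 /HN1 h2 /HN2 h3].
have -> : u n * v n - l * l' = u n * (v n - l') + (u n - l) * l'.
  by rewrite mulrBr mulrBl addrA subrK.
move: h2 h3; rewrite !ltr_pdivlMr// => h2 h3.
have := rnormD (u n * (v n - l')) ((u n - l) * l').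
have := rnormM (u n) (v n - l'); have := rnormM (u n - l) l'.
have := rnorm_ge0 (v n - l'); have := rnorm_ge0 (u n - l).
have := rnorm_ge0 l'; have := rnorm_ge0 (u n); nra.
Qed.

Lemma tends_le u l (M : R) : tends u l ->
  (exists N, forall n, (N <= n)%N -> rnorm (u n) <= M) -> rnorm l <= M.
Proof.
move=> h [N HN]; apply/ler_addgt0Pr => e e0.
have [N' HN'] := h _ e0.
have := HN _ (leq_maxl N N'); have := HN' _ (leq_maxr N N').
set x := u _ => h1 h2.
have := rnormD (l - x) x; rewrite subrK rnormC; lra.
Qed.

Lemma tends_ge u l (M : R) : tends u l ->
  (exists N, forall n, (N <= n)%N -> M <= rnorm (u n)) -> M <= rnorm l.
Proof.
move=> h [N HN]; apply/ler_addgt0Pr => e e0.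
have [N' HN'] := h _ e0.
have := HN _ (leq_maxl N N'); have := HN' _ (leq_maxr N N').
set x := u _ => h1 h2.
have := rnormD (x - l) l; rewrite subrK; lra.
Qed.

(** Steps of [u] telescope against those of [w], and [w] converges because it is monotone and
    bounded. No rate is asked for, which matters for square roots of [1 - Y] with [Y] of norm
    exactly 1, where the convergence need not be geometric. *)
Lemma majorant_tends u (w : nat -> R) :
  (forall k, w k <= 1) -> (forall k, rnorm (u k.+1 - u k) <= w k.+1 - w k) ->
  exists l, tends u l.
Proof.
move=> w1 uw.
have w_nd : nondecreasing_seq w.
  by apply/nondecreasing_seqP => k; rewrite -subr_ge0 (le_trans _ (uw k))// rnorm_ge0.
have tel m n : rnorm (u (m + n)%N - u m) <= w (m + n)%N - w m.
  elim: n => [|n IH]; first by rewrite addn0 !subrr rnorm0.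
  rewrite addnS; have := rnorm_triangle (u (m + n)%N) (u (m + n).+1) (u m).
  have := uw (m + n)%N; lra.
have cw : cvgn w.
  by apply: nondecreasing_is_cvgn => //; exists 1 => _ [k _ <-].
apply: cauchy_tends => e e0.
have e20 : 0 < e / 2 by lra.
have /cvgrPdist_lt/(_ _ e20)[N _ HN] := cw.
have tail m : (N <= m)%N -> rnorm (u m - u N) < e / 2.
  move=> Nm; have := tel N (m - N)%N; rewrite subnKC// => h.
  have := HN _ (leqnn N) => /=; have := nondecreasing_cvgn_le w_nd cw m.
  by rewrite ltr_norml => ? /andP[? ?]; lra.
exists N => m n /tail hm /tail hn.
by have := rnorm_triangle (u N) (u m) (u n); rewrite [rnorm (u N - _)]rnormC; lra.
Qed.

End SequenceLimits.

(** * Matrices over A with an entrywise norm *)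

Section MatrixNorm.
Context {R : realType} {A : cstarAlgType R}.

(* Not the C*-norm of M_n(A), but a submultiplicative, star-invariant norm that
   defines the same topology and needs no representation theory. *)
Definition mnorm m n (M : 'M[A]_(m, n)) : R := \sum_i \sum_j rnorm (M i j).

(** Complex scalars act through the module structure of each entry; the scaling that belongs to the
    matrix type takes its scalars in the coefficient ring [A]. *)
Definition zmx m n (c : R[i]) (M : 'M[A]_(m, n)) : 'M[A]_(m, n) :=
  map_mx (fun x => c *: x) M.

Lemma mnorm_ge0 m n (M : 'M[A]_(m, n)) : 0 <= mnorm M.
Proof. by apply: sumr_ge0 => i _; apply: sumr_ge0 => j _; exact: rnorm_ge0. Qed.

Lemma mnorm0 m n : mnorm (0 : 'M[A]_(m, n)) = 0.
Proof. by rewrite /mnorm big1// => i _; rewrite big1// => j _; rewrite mxE rnorm0. Qed.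

Lemma mnormD m n (M M' : 'M[A]_(m, n)) : mnorm (M + M') <= mnorm M + mnorm M'.
Proof.
rewrite /mnorm -big_split/=; apply: ler_sum => i _.
by rewrite -big_split/=; apply: ler_sum => j _; rewrite mxE rnormD.
Qed.

Lemma mnormN m n (M : 'M[A]_(m, n)) : mnorm (- M) = mnorm M.
Proof. by apply: eq_bigr => i _; apply: eq_bigr => j _; rewrite mxE rnormN. Qed.

Lemma mnormB m n (M M' : 'M[A]_(m, n)) : mnorm (M - M') <= mnorm M + mnorm M'.
Proof. by rewrite (le_trans (mnormD _ _))// mnormN. Qed.

Lemma mnormC m n (M M' : 'M[A]_(m, n)) : mnorm (M - M') = mnorm (M' - M).
Proof. by rewrite -mnormN opprB. Qed.

Lemma mnorm_entry m n (M : 'M[A]_(m, n)) i j : rnorm (M i j) <= mnorm M.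
Proof.
rewrite /mnorm (bigD1 i)//= (bigD1 j)//= -addrA lerDl addr_ge0//.
  by apply: sumr_ge0 => k _; exact: rnorm_ge0.
by apply: sumr_ge0 => k _; apply: sumr_ge0 => l _; exact: rnorm_ge0.
Qed.

Lemma mnorm0_eq0 m n (M : 'M[A]_(m, n)) : mnorm M = 0 -> M = 0.
Proof.
move=> M0; apply/matrixP => i j; rewrite mxE; apply: rnorm0_eq0.
by apply/le_anti; rewrite rnorm_ge0 andbT -M0 mnorm_entry.
Qed.

Lemma mnormM m n p (M : 'M[A]_(m, n)) (M' : 'M[A]_(n, p)) :
  mnorm (M *m M') <= mnorm M * mnorm M'.
Proof.
rewrite /mnorm mulr_suml; apply: ler_sum => i _.
apply: (@le_trans _ _ (\sum_k \sum_j rnorm (M i j) * rnorm (M' j k))).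
  apply: ler_sum => k _; rewrite mxE (le_trans (rnorm_sum _ _ _))//.
  by apply: ler_sum => j _; exact: rnormM.
rewrite exchange_big mulr_suml/=; apply: ler_sum => j _.
rewrite -mulr_sumr ler_wpM2l ?rnorm_ge0// [leRHS](bigD1 j)//= lerDl.
by apply: sumr_ge0 => l _; apply: sumr_ge0 => k _; exact: rnorm_ge0.
Qed.

Lemma mnorm_adj m n (M : 'M[A]_(m, n)) : mnorm (adjmx M) = mnorm M.
Proof.
rewrite /mnorm exchange_big; apply: eq_bigr => i _; apply: eq_bigr => j _.
by rewrite !mxE rnorm_star.
Qed.

Lemma mnorm_zmx m n (t : R) (M : 'M[A]_(m, n)) :
  mnorm (zmx t%:C M) = `|t| * mnorm M.
Proof.
rewrite /mnorm mulr_sumr; apply: eq_bigr => i _; rewrite mulr_sumr.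
by apply: eq_bigr => j _; rewrite mxE rnormZr.
Qed.

Lemma mnorm_scalar n (a : A) : mnorm (a%:M : 'M[A]_n) = n%:R * rnorm a.
Proof.
rewrite /mnorm (eq_bigr (fun=> rnorm a)); first by rewrite sumr_const card_ord mulr_natl.
move=> i _; rewrite (bigD1 i)//= big1 ?addr0 ?mxE ?eqxx//.
by move=> j ji; rewrite mxE eq_sym (negbTE ji) rnorm0.
Qed.

Lemma mnorm_block m n p q (a : 'M[A]_(m, p)) (b : 'M[A]_(m, q)) (c : 'M[A]_(n, p))
    (d : 'M[A]_(n, q)) :
  mnorm (block_mx a b c d) = (mnorm a + mnorm b) + (mnorm c + mnorm d).
Proof.
rewrite /mnorm big_split_ord -!big_split; congr (_ + _); apply: eq_bigr => i _.
  rewrite big_split_ord; congr (_ + _); apply: eq_bigr => j _.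
    by rewrite block_mxEul.
  by rewrite block_mxEur.
rewrite big_split_ord; congr (_ + _); apply: eq_bigr => j _.
  by rewrite block_mxEdl.
by rewrite block_mxEdr.
Qed.

Lemma zmxMl m n p c (M : 'M[A]_(m, n)) (M' : 'M[A]_(n, p)) :
  zmx c M *m M' = zmx c (M *m M').
Proof.
apply/matrixP => i j; rewrite !mxE scaler_sumr.
by apply: eq_bigr => k _; rewrite !mxE cscalerAl.
Qed.

Lemma zmxMr m n p c (M : 'M[A]_(m, n)) (M' : 'M[A]_(n, p)) :
  M *m zmx c M' = zmx c (M *m M').
Proof.
apply/matrixP => i j; rewrite !mxE scaler_sumr.
by apply: eq_bigr => k _; rewrite !mxE cscalerAr.
Qed.

Lemma zmxD m n c (M M' : 'M[A]_(m, n)) : zmx c (M + M') = zmx c M + zmx c M'.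
Proof. by apply/matrixP => i j; rewrite !mxE scalerDr. Qed.

Lemma zmxN m n c (M : 'M[A]_(m, n)) : zmx c (- M) = - zmx c M.
Proof. by apply/matrixP => i j; rewrite !mxE scalerN. Qed.

Lemma zmxB m n c (M M' : 'M[A]_(m, n)) : zmx c (M - M') = zmx c M - zmx c M'.
Proof. by rewrite zmxD zmxN. Qed.

Lemma zmxDl m n c d (M : 'M[A]_(m, n)) : zmx (c + d) M = zmx c M + zmx d M.
Proof. by apply/matrixP => i j; rewrite !mxE scalerDl. Qed.

Lemma zmxA m n c d (M : 'M[A]_(m, n)) : zmx c (zmx d M) = zmx (c * d) M.
Proof. by apply/matrixP => i j; rewrite !mxE scalerA. Qed.

Lemma zmxNl m n c (M : 'M[A]_(m, n)) : zmx (- c) M = - zmx c M.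
Proof. by apply/matrixP => i j; rewrite !mxE scaleNr. Qed.

Lemma zmxBl m n c d (M : 'M[A]_(m, n)) : zmx (c - d) M = zmx c M - zmx d M.
Proof. by rewrite zmxDl zmxNl. Qed.

Lemma zmx1 m n (M : 'M[A]_(m, n)) : zmx 1 M = M.
Proof. by apply/matrixP => i j; rewrite !mxE scale1r. Qed.

Lemma zmx0 m n (M : 'M[A]_(m, n)) : zmx 0 M = 0.
Proof. by apply/matrixP => i j; rewrite !mxE scale0r. Qed.

Lemma adj_zmx m n c (M : 'M[A]_(m, n)) : adjmx (zmx c M) = zmx (c^*)%C (adjmx M).
Proof. by apply/matrixP => i j; rewrite !mxE starZ. Qed.

Lemma adj_zmxr m n (t : R) (M : 'M[A]_(m, n)) :
  adjmx (zmx t%:C M) = zmx t%:C (adjmx M).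
Proof. by rewrite adj_zmx conjc_real. Qed.

Lemma adjmxD m n (M M' : 'M[A]_(m, n)) : adjmx (M + M') = adjmx M + adjmx M'.
Proof. by apply/matrixP => i j; rewrite !mxE starD. Qed.

Lemma adjmxN m n (M : 'M[A]_(m, n)) : adjmx (- M) = - adjmx M.
Proof. by apply/matrixP => i j; rewrite !mxE starN. Qed.

Lemma adjmx0 m n : adjmx (0 : 'M[A]_(m, n)) = 0.
Proof. by apply/matrixP => i j; rewrite !mxE star0. Qed.

Lemma adjmxB m n (M M' : 'M[A]_(m, n)) : adjmx (M - M') = adjmx M - adjmx M'.
Proof. by rewrite adjmxD adjmxN. Qed.

End MatrixNorm.

Section MatrixLimits.
Context {R : realType} {A : cstarAlgType R}.

Definition mtends m n (u : nat -> 'M[A]_(m, n)) (l : 'M[A]_(m, n)) :=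
  forall i j, tends (fun k => u k i j) (l i j).

Lemma tends_sum (I : Type) (r : seq I) (u : I -> nat -> A) (l : I -> A) :
  (forall i, tends (u i) (l i)) ->
  tends (fun k => \sum_(i <- r) u i k) (\sum_(i <- r) l i).
Proof.
move=> ul; elim: r => [|i r IH].
  by rewrite big_nil; apply: tends_ext (tends_cst 0) => k; rewrite big_nil.
by rewrite big_cons; apply: tends_ext (tendsD (ul i) IH) => k; rewrite big_cons.
Qed.

Lemma mtendsM m n p (u : nat -> 'M[A]_(m, n)) (v : nat -> 'M[A]_(n, p)) l l' :
  mtends u l -> mtends v l' -> mtends (fun k => u k *m v k) (l *m l').
Proof.
move=> ul vl i j; rewrite mxE.
apply: (@tends_ext _ _ (fun k => \sum_h u k i h * v k h j)); first by move=> k; rewrite mxE.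
by apply: tends_sum => h; exact: tendsM.
Qed.

Lemma mtendsD m n (u v : nat -> 'M[A]_(m, n)) l l' :
  mtends u l -> mtends v l' -> mtends (fun k => u k + v k) (l + l').
Proof.
move=> ul vl i j; rewrite mxE; apply: tends_ext (tendsD (ul i j) (vl i j)).
by move=> k; rewrite mxE.
Qed.

Lemma mtends_zmx m n c (u : nat -> 'M[A]_(m, n)) l :
  mtends u l -> mtends (fun k => zmx c (u k)) (zmx c l).
Proof.
move=> ul i j; rewrite mxE; apply: tends_ext (tendsZ c (ul i j)).
by move=> k; rewrite mxE.
Qed.

Lemma mtends_adj m n (u : nat -> 'M[A]_(m, n)) l :
  mtends u l -> mtends (fun k => adjmx (u k)) (adjmx l).
Proof.
move=> ul i j; rewrite !mxE; apply: tends_ext (tends_star (ul j i)).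
by move=> k; rewrite !mxE.
Qed.

Lemma mtends_cst m n (l : 'M[A]_(m, n)) : mtends (fun=> l) l.
Proof. by move=> i j; exact: tends_cst. Qed.

Lemma mtends_ext m n (u v : nat -> 'M[A]_(m, n)) l :
  (forall k, u k = v k) -> mtends u l -> mtends v l.
Proof. by move=> /funext ->. Qed.

Lemma mtends_shift m n (u : nat -> 'M[A]_(m, n)) l :
  mtends u l -> mtends (fun k => u k.+1) l.
Proof.
move=> ul i j e /(ul i j e)[N HN]; exists N => k Nk; apply: HN.
exact: leq_trans Nk _.
Qed.

Lemma mtends_unique m n (u : nat -> 'M[A]_(m, n)) l l' :
  mtends u l -> mtends u l' -> l = l'.
Proof. by move=> ul ul'; apply/matrixP => i j; exact: tends_unique (ul i j) (ul' i j). Qed.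

Lemma mtends_mnorm m n (u : nat -> 'M[A]_(m, n)) l (e : R) : mtends u l -> 0 < e ->
  exists N, forall k, (N <= k)%N -> mnorm (u k - l) <= e.
Proof.
move=> ul e0.
have sumlt (I : Type) (r : seq I) (f : I -> nat -> R) :
    (forall i (d : R), 0 < d -> exists N, forall k, (N <= k)%N -> f i k <= d) ->
    forall d, 0 < d -> exists N, forall k, (N <= k)%N -> \sum_(i <- r) f i k <= d.
  move=> fi; elim: r => [|i r IH] d d0.
    by exists 0%N => k _; rewrite big_nil ltW.
  have d20 : 0 < d / 2 by lra.
  have [N HN] := fi i _ d20; have [N' HN'] := IH _ d20.
  exists (maxn N N') => k; rewrite geq_max big_cons => /andP[/HN h /HN' h'].
  lra.
apply: (sumlt) e0 => i d d0; apply: (sumlt) d0 => j d' d0'.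
have [N HN] := ul i j d' d0'.
by exists N => k /HN; rewrite !mxE => /ltW.
Qed.

Lemma mtends_le m n (u : nat -> 'M[A]_(m, n)) l (K : R) :
  mtends u l -> (forall k, mnorm (u k) <= K) -> mnorm l <= K.
Proof.
move=> ul uK; apply/ler_addgt0Pr => e e0.
have [N /(_ _ (leqnn N)) HN] := mtends_mnorm ul e0.
by have := mnormB (u N) (u N - l); rewrite subKr; have := uK N; lra.
Qed.

Lemma majorant_mtends m n (u : nat -> 'M[A]_(m, n)) (w : nat -> R) :
  (forall k, w k <= 1) -> (forall k, mnorm (u k.+1 - u k) <= w k.+1 - w k) ->
  exists l, mtends u l.
Proof.
move=> w1 uw.
have ex i j : exists l, tends (fun k => u k i j) l.
  apply: (majorant_tends w1) => k; apply: le_trans (uw k).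
  by have := mnorm_entry (u k.+1 - u k) i j; rewrite !mxE.
(* The limits are chosen entry by entry; the default 0 is never taken, since each entry
   converges. *)
exists (\matrix_(i, j) xget 0 [set l | tends (fun k => u k i j) l]) => i j.
rewrite mxE; have [l Hl] := ex i j.
exact: (@xgetPex _ 0 [set l | tends (fun k => u k i j) l] (ex_intro _ l Hl)).
Qed.

End MatrixLimits.

(** * Square roots, inverses and nearby unitaries *)

Section SquareRoot.
Context {R : realType} {A : cstarAlgType R} {n : nat}.
Implicit Types Y Z C : 'M[A]_n.

Let half : R[i] := (2^-1)%:C.

Let zhalf Z : zmx half Z + zmx half Z = Z.
Proof. by rewrite -zmxDl -rmorphD /= -[2^-1]mul1r -splitr zmx1. Qed.

Let mnorm_half Z : mnorm (zmx half Z) = mnorm Z / 2.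
Proof. by rewrite mnorm_zmx ger0_norm 1?mulrC. Qed.

Let subsq Z Z' : Z *m Z - Z' *m Z' = Z *m (Z - Z') + (Z - Z') *m Z'.
Proof. by rewrite mulmxBr mulmxBl addrA subrK. Qed.

Let mnorm_subsq Z Z' :
  mnorm (Z *m Z - Z' *m Z') <= (mnorm Z + mnorm Z') * mnorm (Z - Z').
Proof.
rewrite subsq mulrDl [mnorm Z' * _]mulrC (le_trans (mnormD _ _))//.
by rewrite lerD ?mnormM.
Qed.

(* [1 - sqrt_iter Y k] tends to the square root of [1 - Y]: a fixed point [Z] of
   the recursion satisfies [2 Z = Y + Z^2]. *)
Fixpoint sqrt_iter Y k : 'M[A]_n :=
  if k is k'.+1 then zmx half (Y + sqrt_iter Y k' *m sqrt_iter Y k') else 0.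

(** The same recursion with the number 1 in place of [Y]. It stays in [0, 1] and dominates the norms
    and the steps of the matrix recursion for every [Y] of norm at most 1. *)
Let Fixpoint w k : R := if k is k'.+1 then (1 + w k' ^+ 2) / 2 else 0.

Let w_bnd k : 0 <= w k <= 1.
Proof. by elim: k => [|k] /=; [lra|nra]. Qed.

Let iter_w Y k : mnorm Y <= 1 -> mnorm (sqrt_iter Y k) <= w k.
Proof.
move=> Y1; elim: k => [|k IH] /=; first by rewrite mnorm0.
rewrite mnorm_half ler_wpM2r//; set Z := sqrt_iter Y k in IH *.
have := mnormD Y (Z *m Z); have := mnormM Z Z; have := mnorm_ge0 Z; nra.
Qed.

(** The step of the recursion is half of [Z'^2 - Z^2], of norm at most [(|Z'| + |Z|) |Z' - Z|]; by
    induction this is bounded by [(w' + w) (w' - w) = w'^2 - w^2]. *)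
Let iter_step Y k : mnorm Y <= 1 ->
  mnorm (sqrt_iter Y k.+1 - sqrt_iter Y k) <= w k.+1 - w k.
Proof.
move=> Y1; elim: k => [|k IH].
  by rewrite /= mul0mx addr0 subr0 mnorm_half; lra.
have h1 := iter_w k Y1; have h2 := iter_w k.+1 Y1.
rewrite [sqrt_iter Y k.+2]/= [in X in _ - X]/= -zmxB mnorm_half [w k.+2]/=.
rewrite -/(sqrt_iter Y k.+1) -/(w k.+1).
set Z' := sqrt_iter Y k.+1 in IH h2 *; set Z := sqrt_iter Y k in IH h1 *.
rewrite opprD addrACA subrr add0r.
have [/andP[w0 _] /andP[w0' _]] := (w_bnd k, w_bnd k.+1).
have := mnorm_subsq Z' Z; have := mnorm_ge0 (Z' - Z).
have -> : w k.+2 - w k.+1 = (w k.+1 ^+ 2 - w k ^+ 2) / 2 by rewrite /=; lra.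
have := mnorm_ge0 Z; have := mnorm_ge0 Z'; nra.
Qed.

(** The norm hypothesis stands under the existential so that [msq] can be a total function of
    [Y]. *)
Lemma ex_msq Y : exists Z, mnorm Y <= 1 -> mtends (sqrt_iter Y) Z.
Proof.
have [Y1|Y1] := leP (mnorm Y) 1; last by exists 0.
have [Z HZ] := @majorant_mtends _ _ _ _ (sqrt_iter Y) w
  (fun k => proj2 (andP (w_bnd k))) (fun k => iter_step k Y1).
by exists Z.
Qed.

Definition msq Y : 'M[A]_n := projT1 (cid (ex_msq Y)).

Lemma msqP Y : mnorm Y <= 1 -> mtends (sqrt_iter Y) (msq Y).
Proof. exact: (projT2 (cid (ex_msq Y))). Qed.

Lemma msq_fix Y : mnorm Y <= 1 -> msq Y = zmx half (Y + msq Y *m msq Y).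
Proof.
move=> Y1; apply: mtends_unique (mtends_shift (msqP Y1)) _.
apply: mtends_zmx; apply: mtendsD; first exact: mtends_cst.
by apply: mtendsM; exact: msqP.
Qed.

Let sub1sq Z : (1%:M - Z) *m (1%:M - Z) = 1%:M - (Z + Z - Z *m Z).
Proof.
by rewrite mulmxBl mul1mx mulmxBr mulmx1 -addrA; congr (_ + _); rewrite !opprD !opprK addrA.
Qed.

Lemma msqK Y : mnorm Y <= 1 -> (1%:M - msq Y) *m (1%:M - msq Y) = 1%:M - Y.
Proof.
move=> Y1; rewrite sub1sq; congr (_ - _).
by rewrite [X in X + X - _]msq_fix// zhalf addrK.
Qed.

Lemma msq_norm Y : mnorm Y <= 1 -> mnorm (msq Y) <= 1.
Proof.
move=> Y1; apply: (mtends_le (msqP Y1)) => k.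
by rewrite (le_trans (iter_w k Y1))//; case/andP: (w_bnd k).
Qed.

(** The value 1/2 is the fixed point of the scalar recursion for 3/4, as (3/4 + 1/4) / 2 = 1/2. On
    the ball of radius 1/2 squaring has Lipschitz constant 1, which makes the fixed-point equation
    contractive. *)
Lemma msq_small Y : mnorm Y <= 3 / 4 -> mnorm (msq Y) <= 1 / 2.
Proof.
move=> Y1; have Y2 : mnorm Y <= 1 by lra.
apply: (mtends_le (msqP Y2)); elim=> [|k IH] /=; first by rewrite mnorm0; lra.
rewrite mnorm_half; set Z := sqrt_iter Y k in IH *.
have := mnormD Y (Z *m Z); have := mnormM Z Z; have := mnorm_ge0 Z; nra.
Qed.

Lemma msq_adj Y : mnorm Y <= 1 -> adjmx Y = Y -> adjmx (msq Y) = msq Y.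
Proof.
move=> Y1 aY; apply: mtends_unique (msqP Y1).
apply: mtends_ext (mtends_adj (msqP Y1)).
elim=> [|k IH] /=; first exact: adjmx0.
by rewrite adj_zmxr adjmxD adjmxM aY !IH.
Qed.

(** The iterates are polynomials in [Y], so whatever commutes with [Y] commutes with them and with
    their limit. *)
Lemma msq_comm Y C : mnorm Y <= 1 -> C *m Y = Y *m C ->
  C *m msq Y = msq Y *m C.
Proof.
move=> Y1 CY; apply: mtends_unique (mtendsM (mtends_cst C) (msqP Y1)) _.
apply: mtends_ext (mtendsM (msqP Y1) (mtends_cst C)).
elim=> [|k IH] /=; first by rewrite mulmx0 mul0mx.
by rewrite zmxMl zmxMr mulmxDl mulmxDr CY mulmxA -IH -!mulmxA IH.
Qed.

(** With [D] the difference of the two values, the fixed-point equation gives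
    [|D| <= (|Y - Y'| + |D|) / 2]. *)
Lemma msq_lip Y Y' : mnorm Y <= 3 / 4 -> mnorm Y' <= 3 / 4 ->
  mnorm (msq Y - msq Y') <= mnorm (Y - Y').
Proof.
move=> h h'; have k := msq_small h; have k' := msq_small h'.
have := mnorm_subsq (msq Y) (msq Y'); have := mnorm_ge0 (msq Y - msq Y').
have h1 : mnorm Y <= 1 by lra. have h1' : mnorm Y' <= 1 by lra.
have -> : msq Y - msq Y' = zmx half ((Y - Y') + (msq Y *m msq Y - msq Y' *m msq Y')).
  by rewrite addrACA -opprD zmxB -!msq_fix.
rewrite [X in mnorm (zmx _ X)]/= mnorm_half.
set D := Y - Y'; set S := _ - _.
have := mnormD D S; have := mnorm_ge0 D; nra.
Qed.

(** Equality of the squares reads [2 (Z - Z') = Z^2 - Z'^2], and the right-hand side has norm at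
    most [|Z - Z'|]. *)
Lemma sqrt_unique Z Z' : mnorm Z <= 1 / 2 -> mnorm Z' <= 1 / 2 ->
  (1%:M - Z) *m (1%:M - Z) = (1%:M - Z') *m (1%:M - Z') -> Z = Z'.
Proof.
move=> h h'; rewrite !sub1sq => /addrI/oppr_inj e.
have e2 : (Z - Z') + (Z - Z') = Z *m Z - Z' *m Z'.
  by move/(congr1 (fun M => M + Z *m Z - (Z' + Z'))) : e;
    rewrite subrK addrACA -opprD => ->; rewrite addrAC [_ - (Z' + Z')]addrAC subrr add0r addrC.
apply/subr0_eq/mnorm0_eq0.
have := mnorm_subsq Z Z'; rewrite -e2.
have -> : mnorm (Z - Z' + (Z - Z')) = 2 * mnorm (Z - Z').
  have := mnorm_half (Z - Z' + (Z - Z')); rewrite zmxD zhalf => ->; lra.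
have := mnorm_ge0 (Z - Z'); nra.
Qed.

Lemma msq0 : msq 0 = 0 :> 'M[A]_n.
Proof.
have n0 : mnorm (0 : 'M[A]_n) = 0 by exact: mnorm0.
apply: sqrt_unique; first by apply: msq_small; rewrite n0; lra.
  by rewrite n0; lra.
by rewrite msqK ?n0 ?ler01// !subr0 mulmx1.
Qed.

Lemma msq_le Y : mnorm Y <= 3 / 4 -> mnorm (msq Y) <= mnorm Y.
Proof.
move=> hY; have h0 : mnorm (0 : 'M[A]_n) <= 3 / 4 by rewrite mnorm0; lra.
by have := msq_lip hY h0; rewrite msq0 !subr0.
Qed.

End SquareRoot.

Section MatrixInverse.
Context {R : realType} {A : cstarAlgType R} {n : nat}.
Implicit Types Z P : 'M[A]_n.

(** Partial sums of the Neumann series without its constant term. Thus the bound on [P - 1] is read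
    off directly and does not involve the norm of the identity, which grows with [n]. *)
Fixpoint neumann Z k : 'M[A]_n :=
  if k is k'.+1 then Z + Z *m neumann Z k' else 0.

Lemma inverse_near1 Z : mnorm Z <= 1 / 2 -> exists P,
  [/\ P *m (1%:M - Z) = 1%:M, (1%:M - Z) *m P = 1%:M &
      mnorm (P - 1%:M) <= 2 * mnorm Z].
Proof.
move=> hZ.
have [Q HQ] : exists Q, mtends (neumann Z) Q.
  apply: (@majorant_mtends _ _ _ _ _ (fun k => 1 - (1 / 2) ^+ k)).
    by move=> k; rewrite gerBl exprn_ge0//; lra.
  elim=> [|k IH]; first by rewrite /= mulmx0 addr0 subr0 expr0 expr1; lra.
  rewrite [neumann Z k.+2]/= [in X in _ - X]/= -/(neumann Z k.+1).
  rewrite opprD addrACA subrr add0r -mulmxBr !(exprS (1 / 2)).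
  move: IH; rewrite exprS; set M := _ - _; move: ((1 / 2) ^+ k) => x IH.
  have := mnormM Z M; have := mnorm_ge0 M; have := mnorm_ge0 Z; nra.
have eQl : Q = Z + Z *m Q.
  apply: mtends_unique (mtends_shift HQ) _.
  apply: mtendsD; first exact: mtends_cst.
  by apply: mtendsM => //; exact: mtends_cst.
have cQ : Q *m Z = Z *m Q.
  apply: mtends_unique (mtendsM HQ (mtends_cst Z)) _.
  apply: mtends_ext (mtendsM (mtends_cst Z) HQ).
  elim=> [|k IH] /=; first by rewrite mulmx0 mul0mx.
  by rewrite mulmxDl mulmxDr -[in RHS]mulmxA -IH.
exists (1%:M + Q); split.
- by rewrite mulmxDl mul1mx mulmxBr mulmx1 cQ {1}eQl addrK subrK.
- by rewrite mulmxDr mulmx1 mulmxBl mul1mx {1}eQl addrK subrK.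
- rewrite [1%:M + Q]addrC addrK.
  have := mnormD Z (Z *m Q); rewrite -eQl; have := mnormM Z Q.
  have := mnorm_ge0 Q; nra.
Qed.

End MatrixInverse.

Section NearbyUnitaries.
Context {R : realType} {A : cstarAlgType R}.

Let iC : R[i] := 'i.

Let iC2 : iC * iC = - 1.
Proof. exact: sqr_i. Qed.

Let mnorm_i n (M : 'M[A]_n) : mnorm (zmx iC M) = mnorm M.
Proof.
apply: eq_bigr => i _; apply: eq_bigr => j _; rewrite mxE rnormZ normc_def /=.
by rewrite expr0n/= expr1n add0r sqrtr1 mul1r.
Qed.

Let halfD n (M : 'M[A]_n) : zmx (2^-1)%:C M + zmx (2^-1)%:C M = M.
Proof. by rewrite -zmxDl -rmorphD /= -[2^-1]mul1r -splitr zmx1. Qed.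

(* If [c = h + ik] with [h], [k] self-adjoint and [k] small then
   [t |-> sqrt (1 - t^2 k^2) + itk] is a path of unitaries from [1] to [c]. *)
Lemma near1_homotopic n (c : 'M[A]_n) :
  unitary c -> mnorm (c - 1%:M) <= 1 / 4 -> homotopic 1%:M c.
Proof.
move=> uc c1; set d := adjmx c.
have cd : c *m d = 1%:M by exact: unitaryVr.
have dc : d *m c = 1%:M by exact: unitaryVl.
have d1 : mnorm (d - 1%:M) <= 1 / 4 by rewrite -(@adjmx1 _ A n) -adjmxB mnorm_adj.
pose hf : R[i] := (2^-1)%:C.
pose h := zmx hf (c + d); pose k := zmx (- iC) (zmx hf (c - d)).
have ad : adjmx d = c by rewrite adjmxK.
have ak : adjmx k = k.
  rewrite /k adj_zmx adj_zmxr adjmxB ad -/d.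
  have -> : ((- iC)^*)%C = iC by rewrite rmorphN /= [X in - X]conjc_i opprK.
  by rewrite /k -[d - c]opprB !(zmxN, zmxNl).
have ck : c = h + zmx iC k.
  rewrite /h /k zmxA mulrN iC2 opprK zmx1 -zmxD.
  by rewrite addrACA subrr addr0 zmxD halfD.
(* Since [c d = d c = 1], one has [(c + d)^2 - (c - d)^2 = 2 (c d + d c) = 4], and after division by
   4 this says [h^2 + k^2 = 1]. *)
have kk : k *m k = 1%:M - h *m h.
  have cross (V : zmodType) (x a y : V) :
      (x + a + (a + y)) - (x - a - (a - y)) = (a + a) + (a + a).
    rewrite !opprD !opprK !addrA [LHS](ACl (1*5*(4*8)*(2*3)*(6*7)))/=.
    by rewrite !subrr !add0r !addrA.
  apply/esym/subr0_eq; rewrite -addrA -opprD; apply/eqP.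
  rewrite subr_eq0 (_ : k = zmx (- iC * hf) (c - d)); last by rewrite /k zmxA.
  rewrite /h zmxMl zmxMr zmxMl zmxMr !zmxA.
  have -> : - iC * hf * (- iC * hf) = - (hf * hf).
    by rewrite !mulNr mulrN opprK mulrACA iC2 mulN1r.
  rewrite zmxNl -zmxB mulmxBl !mulmxBr mulmxDl !mulmxDr cd dc cross.
  by rewrite -zmxA !zmxD !halfD.
have nk : mnorm k <= 1 / 4.
  have -> : k = zmx (- iC) (zmx hf ((c - 1%:M) - (d - 1%:M))).
    by rewrite /k opprB addrA subrK.
  have := mnormB (c - 1%:M) (d - 1%:M); set M := (c - _ - _) => hM.
  have -> : zmx (- iC) (zmx hf M) = - zmx iC (zmx hf M).
    by rewrite zmxNl.
  by rewrite mnormN mnorm_i mnorm_zmx ger0_norm; lra.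
clearbody k.
have nh : mnorm (1%:M - h) <= 1 / 2.
  have -> : 1%:M - h = - zmx hf ((c - 1%:M) + (d - 1%:M)).
    by rewrite addrACA -opprD zmxB -/h zmxD halfD opprB.
  have := mnormD (c - 1%:M) (d - 1%:M); set M := (_ + _) => hM.
  by rewrite mnormN mnorm_zmx ger0_norm; lra.
have nkk : mnorm (k *m k) <= 1 / 16.
  by have := mnormM k k; have := mnorm_ge0 k; nra.
pose Y (r : R) := zmx (r ^+ 2)%:C (k *m k).
have nY r : `|r| <= 1 -> mnorm (Y r) <= 3 / 4.
  move=> r1; rewrite mnorm_zmx normrX; have := normr_ge0 r.
  by have := mnorm_ge0 (k *m k); nra.
have nY1 r : `|r| <= 1 -> mnorm (Y r) <= 1 by move=> /nY; lra.
pose G (r : R) := (1%:M - msq (Y r)) + zmx iC (zmx r%:C k).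
have adjG r : `|r| <= 1 -> adjmx (G r) = (1%:M - msq (Y r)) - zmx iC (zmx r%:C k).
  move=> r1; rewrite /G adjmxD adjmxB adjmx1 msq_adj ?nY1//; last first.
    by rewrite /Y adj_zmxr adjmxM ak.
  congr (_ + _); rewrite adj_zmx adj_zmxr ak -zmxNl; congr zmx.
  exact: conjc_i.
have comm r : `|r| <= 1 ->
    (1%:M - msq (Y r)) *m zmx iC (zmx r%:C k) = zmx iC (zmx r%:C k) *m (1%:M - msq (Y r)).
  move=> r1; rewrite mulmxBl mulmxBr mul1mx mulmx1; congr (_ - _).
  rewrite -msq_comm ?nY1// /Y !(zmxMl, zmxMr) !zmxA mulmxA.
  congr zmx; ring.
have sq r : zmx iC (zmx r%:C k) *m zmx iC (zmx r%:C k) = - Y r.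
  rewrite !zmxA zmxMl zmxMr zmxA /Y.
  have -> : iC * r%:C * (iC * r%:C) = - (r ^+ 2)%:C.
    by rewrite mulrACA iC2 mulN1r -rmorphM expr2.
  by rewrite zmxNl.
have uG r : `|r| <= 1 -> unitary (G r).
  move=> r1; rewrite /unitary adjG// /G.
  have := comm r r1; have := sq r; have := msqK (nY1 _ r1).
  set s := 1%:M - _; set p := zmx iC _; move: s p => s p s2 p2 sp.
  apply/andP; split; apply/eqP.
    by rewrite mulmxBl !mulmxDr sp opprD addrA addrK s2 p2 opprK subrK.
  by rewrite mulmxDl !mulmxBr sp addrA subrK s2 p2 opprK subrK.
(* The root contributes at most [|r + r'| |k^2| <= 1/8] to the Lipschitz constant and the linear
   term [|k| <= 1/4]. *)
have lipG r r' : `|r| <= 1 -> `|r'| <= 1 -> mnorm (G r - G r') <= `|r - r'|.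
  move=> r1 r1'.
  have -> : G r - G r' = (msq (Y r') - msq (Y r)) + zmx iC (zmx (r - r')%:C k).
    rewrite /G rmorphB /= zmxBl zmxB opprD addrACA.
    by congr (_ + _); rewrite opprB addrC addrA subrK.
  apply: le_trans (mnormD _ _) _; rewrite mnorm_i mnorm_zmx.
  have := msq_lip (nY _ r1') (nY _ r1).
  have -> : Y r' - Y r = zmx (r' ^+ 2 - r ^+ 2)%:C (k *m k).
    by rewrite /Y rmorphB zmxBl.
  rewrite mnorm_zmx subr_sqr normrM [`|r' - r|]distrC => h1.
  have h2 : `|r' + r| <= 2 by rewrite (le_trans (ler_normD _ _))//; lra.
  have := normr_ge0 (r - r'); have := mnorm_ge0 (k *m k); have := mnorm_ge0 k.
  have := normr_ge0 (r' + r); move: h1 h2 nk nkk.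
  move: `|r' + r| `|r - r'| (mnorm _) (mnorm _) (mnorm _) => x y a b c'.
  rewrite -mulrA => h1 h2 nk nkk x0 c0 b0 y0.
  have h3 : x * b <= 1 / 8 by nra.
  nra.
have sin1 (t : R) : `|sin t| <= 1.
  by rewrite ler_norml sin_geN1 sin_le1.
(* Parametrising by the sine keeps the argument of [G] in [-1, 1] for every real [t], so the path is
   continuous on the whole line and not merely on the unit interval. *)
exists (fun t => G (sin (t * (pi / 2)))); split.
- apply: continuous_subspaceT; apply/mx_cts => i j t.
  have cs : continuous (fun t : R => sin (t * (pi / 2))).
    move=> t'; apply: (@continuous_comp _ _ _ (fun t : R => t * (pi / 2)) sin).
      exact: mulrr_continuous.
    exact: continuous_sin.
  apply/cvgrPdist_lt => e.
  case: e => e e'; rewrite ltcE /= => /andP[/eqP-> e0].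
  have /cvgrPdist_lt/(_ _ e0) := cs t.
  apply: filterS => s hs; rewrite rnormE ltcR; apply: le_lt_trans hs.
  apply: le_trans (lipG _ _ (sin1 _) (sin1 _)).
  by have := mnorm_entry (G (sin (t * (pi / 2))) - G (sin (s * (pi / 2)))) i j; rewrite !mxE.
- by move=> t _; exact: uG.
- rewrite mul0r sin0 /G.
  have -> : Y 0 = 0 by rewrite /Y expr0n zmx0.
  rewrite zmx0 /= msq0 subr0.
  by apply/matrixP => i j; rewrite !mxE scaler0 addr0.
- rewrite mul1r sin_pihalf /G [in RHS]ck zmx1; congr (_ + _).
  have one : `|1 : R| <= 1 by rewrite normr1.
  (* Both [1 - msq (Y 1)] and [h] are square roots of [1 - k^2] within 1/2 of the identity, hence
     they agree and the path ends at [c]. *)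
  suff -> : msq (Y 1) = 1%:M - h by rewrite subKr.
  apply: sqrt_unique => //; first by apply: msq_small; exact: nY.
  by rewrite msqK ?nY1// /Y expr1n zmx1 kk !subKr.
Qed.

Lemma near_homotopic n (a b : 'M[A]_n) : unitary a -> unitary b ->
  mnorm (adjmx a *m b - 1%:M) <= 1 / 4 -> homotopic a b.
Proof.
move=> ua ub /(near1_homotopic (unitaryM (unitary_adj ua) ub)) h.
have := homotopicM (homotopic_refl ua) h.
by rewrite mulmx1 mulmxA unitaryVr// mul1mx.
Qed.

End NearbyUnitaries.

(** * Positive elements of a C*-algebra *)

Section Positivity.
Context {R : realType} {A : cstarAlgType R}.
Implicit Types (a b c h k x y z : A) (t s : R).

Definition rscal t : A := t%:C *: (1 : A).

(** Positivity is encoded without spectra. In this form closure under sums is not evident, nor is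
    the positivity of [star a * a]; these are [nonnegD] and [starM_nonneg]. *)
Definition nonneg x := exists h, star h = h /\ x = h * h.

Lemma rscalM t x : rscal t * x = t%:C *: x.
Proof. by rewrite cscalerAl mul1r. Qed.

Lemma mulrscal t x : x * rscal t = t%:C *: x.
Proof. by rewrite cscalerAr mulr1. Qed.

Lemma star_rscal t : star (rscal t) = rscal t.
Proof. by rewrite starZr star1. Qed.

Lemma rscalD t s : rscal (t + s) = rscal t + rscal s.
Proof. by rewrite /rscal rmorphD scalerDl. Qed.

Lemma rnorm_rscal t : 0 <= t -> rnorm (rscal t) <= t.
Proof.
by move=> t0; rewrite rnormZr ger0_norm// ler_piMr// rnorm1.
Qed.

Lemma rhalfD x : (2^-1)%:C *: x + (2^-1)%:C *: x = x.
Proof. by rewrite -scalerDl -rmorphD /= -[2^-1]mul1r -splitr scale1r. Qed.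

(** This is [msq] on 1-by-1 matrices, where [mnorm] is [rnorm]. *)
Lemma sqrt_1m y : star y = y -> rnorm y <= 1 -> exists z,
  [/\ star z = z, rnorm z <= 1, (1 - z) * (1 - z) = 1 - y &
      forall c, c * y = y * c -> c * z = z * c].
Proof.
move=> sy y1; pose Y := y%:M : 'M[A]_1.
have nY : mnorm Y <= 1 by rewrite mnorm_scalar mul1r.
have mE (M : 'M[A]_1) : M = (M 0 0)%:M by exact: mx11_scalar.
have sM (u v : A) : (u%:M : 'M[A]_1) = v%:M -> u = v.
  by move/matrixP/(_ 0 0); rewrite !mxE eqxx !mulr1n.
have mD (u v : A) : (u%:M : 'M[A]_1) *m v%:M = (u * v)%:M by rewrite scalar_mxM.
set Z := msq Y; have ZE := mE Z.
exists (Z 0 0); split.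
- have aY : adjmx Y = Y by apply/matrixP => i j; rewrite !mxE !ord1 eqxx !mulr1n.
  by have /matrixP/(_ 0 0) := msq_adj nY aY; rewrite !mxE.
- by have := msq_norm nY; rewrite -/Z {1}ZE mnorm_scalar mul1r.
- have sB (u v : A) : (u - v)%:M = u%:M - v%:M :> 'M[A]_1 by rewrite raddfB.
  by apply: sM; rewrite -mD !sB -ZE msqK.
- move=> c cy; apply: sM; rewrite -!mD -ZE.
  by apply: msq_comm => //; rewrite /Y !mD cy.
Qed.

Lemma rnorm_sqr_sa h : star h = h -> rnorm (h * h) = rnorm h ^+ 2.
Proof. by move=> sh; rewrite -{1}sh rnorm_starM. Qed.

Let iC : R[i] := 'i.

Let iC2 : iC * iC = - 1.
Proof. exact: sqr_i. Qed.

Let conj_iC : (iC^*)%C = - iC.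
Proof. exact: conjc_i. Qed.

Let cartesian h k : star h = h -> star k = k -> h * k = k * h ->
  star (h + iC *: k) * (h + iC *: k) = h * h + k * k.
Proof.
move=> sh sk hk; rewrite starD starZ sh sk conj_iC scaleNr mulrDr !mulrDl.
rewrite !mulNr !(cscalerAl, cscalerAr) hk addrA subrK; congr (_ + _).
by rewrite scalerA iC2 scaleN1r opprK.
Qed.

Let le_cartesian h k : star h = h -> star k = k ->
  rnorm h <= rnorm (h + iC *: k).
Proof.
move=> sh sk; set v := h + _.
have -> : h = (2^-1)%:C *: (v + star v).
  by rewrite /v starD starZ sh sk conj_iC scaleNr addrACA subrr addr0 scalerDr rhalfD.
rewrite rnormZr ger0_norm; last lra.
by have := rnormD v (star v); rewrite rnorm_star; lra.
Qed.

(** This replaces the spectral argument. The element [v = h + i sqrt (1 - h^2)] is unitary with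
    [v + v^* = 2 h], and [1 - h^2 = (1 - (v^2 + v^*^2) / 2) / 2], the identity sin^2 x = (1 - cos
    2x) / 2; the right-hand side has norm at most (1 + 1) / 2. *)
Lemma rnorm_1m_sqr h : star h = h -> rnorm h <= 1 -> rnorm (1 - h * h) <= 1.
Proof.
move=> sh h1.
have nh2 : rnorm (h * h) <= 1.
  by rewrite rnorm_sqr_sa//; have := rnorm_ge0 h; nra.
have shh : star (h * h) = h * h by rewrite starMr sh.
have [z [sz z1 zz zc]] := sqrt_1m shh nh2.
set s := 1 - z; have ss : star s = s by rewrite starB star1 sz.
have hs : h * s = s * h.
  by rewrite mulrBl mulrBr mul1r mulr1 zc// mulrA.
set v := h + iC *: s.
have vv : star v * v = 1 by rewrite cartesian// zz addrC subrK.
have vv' : v * star v = 1.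
  have := @cartesian h (- s) sh; rewrite starN ss => /(_ erefl).
  rewrite mulrN mulNr hs scalerN mulrNN => /(_ erefl).
  have -> : h - iC *: s = star v by rewrite /v starD starZ sh ss conj_iC scaleNr.
  by rewrite starK => ->; rewrite zz addrC subrK.
have v1 : rnorm (v * v) <= 1.
  apply: le_trans (rnormM _ _) _; rewrite -expr2 -rnorm_starM vv; exact: rnorm1.
have vD : v + star v = h + h.
  by rewrite /v starD starZ sh ss conj_iC scaleNr addrACA subrr addr0.
clearbody v; pose W := v * v + star v * star v.
have hW : W = (h * h + h * h - 1) + (h * h + h * h - 1).
  have : (v + star v) * (v + star v) = W + (1 + 1).
    by rewrite mulrDr !mulrDl vv vv' [v * v + 1]addrC addrACA [1 + 1 + _]addrC /W.
  rewrite vD mulrDr !mulrDl => e.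
  by rewrite addrACA -opprD e addrK.
have -> : 1 - h * h = (2^-1)%:C *: (1 - (2^-1)%:C *: W).
  have -> : (2^-1)%:C *: W = h * h + h * h - 1 by rewrite hW scalerDr rhalfD.
  by rewrite opprB addrA opprD addrACA scalerDr rhalfD.
rewrite rnormZr ger0_norm; last lra.
have := rnormB 1 ((2^-1)%:C *: W).
rewrite rnormZr ger0_norm; last lra.
have := rnormD (v * v) (star v * star v); rewrite -starMr rnorm_star -/W.
by have := @rnorm1 _ A; rewrite /W starMr; lra.
Qed.

Lemma nonneg_sa x : nonneg x -> star x = x.
Proof. by move=> [h [sh ->]]; rewrite starMr sh. Qed.

Lemma nonneg0 : nonneg 0.
Proof. by exists 0; rewrite star0 mulr0. Qed.

Lemma nonnegZ t x : 0 <= t -> nonneg x -> nonneg (t%:C *: x).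
Proof.
move=> t0 [h [sh ->]]; exists ((Num.sqrt t)%:C *: h); rewrite starZr sh; split=> //.
by rewrite cscalerAl cscalerAr scalerA -rmorphM /= -[_ * Num.sqrt t]expr2 sqr_sqrtr.
Qed.

Lemma nonneg_rscal t : 0 <= t -> nonneg (rscal t).
Proof. by move=> t0; apply: nonnegZ => //; exists 1; rewrite star1 mulr1. Qed.

(** Together with [near_nonneg] this turns positivity into a metric condition, which passes to sums
    by the triangle inequality. After rescaling [h] by the square root of [t] it is
    [rnorm_1m_sqr]. *)
Lemma nonneg_near t x : nonneg x -> 0 < t -> rnorm x <= t -> rnorm (rscal t - x) <= t.
Proof.
move=> [h [sh ->]] t0; rewrite rnorm_sqr_sa// => ht.
pose r := Num.sqrt t; have r0 : 0 < r by rewrite sqrtr_gt0.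
have r2 : r ^+ 2 = t by rewrite sqr_sqrtr// ltW.
pose g := r^-1%:C *: h.
have sg : star g = g by rewrite starZr sh.
have g1 : rnorm g <= 1.
  rewrite rnormZr ger0_norm ?invr_ge0 ?(ltW r0)// ler_pdivrMl// mulr1.
  by rewrite -(ler_pXn2r (n:=2))// ?nnegrE ?rnorm_ge0 ?(ltW r0)// r2.
have hg : h = r%:C *: g by rewrite scalerA -rmorphM divff ?gt_eqF// scale1r.
have -> : rscal t - h * h = t%:C *: (1 - g * g).
  rewrite scalerBr hg cscalerAl cscalerAr scalerA -rmorphM /= -[r * r]expr2 r2.
  by [].
rewrite rnormZr ger0_norm ?(ltW t0)// ler_piMr ?(ltW t0)//.
exact: rnorm_1m_sqr.
Qed.

(** The bound on [h] has the same shape as the one on [x], so [near_nonneg] applies again and shows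
    in [nonneg_sqrt] that the root is positive. *)
Lemma near_sqrt t x : star x = x -> 0 < t -> rnorm (rscal t - x) <= t ->
  exists h, [/\ star h = h, h * h = x, rnorm (rscal (Num.sqrt t) - h) <= Num.sqrt t &
             forall c, c * x = x * c -> c * h = h * c].
Proof.
move=> sx t0 xt; pose y := 1 - t^-1%:C *: x.
have tx : t%:C *: (t^-1%:C *: x) = x.
  by rewrite scalerA -rmorphM divff ?gt_eqF// scale1r.
have sy : star y = y by rewrite starB star1 starZr sx.
have y1 : rnorm y <= 1.
  move: xt; have -> : rscal t - x = t%:C *: y by rewrite scalerBr tx.
  by rewrite rnormZr ger0_norm ?(ltW t0)// ger_pMr.
have [z [sz z1 zz zc]] := sqrt_1m sy y1.
pose r := Num.sqrt t; have r0 : 0 <= r by rewrite sqrtr_ge0.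
have r2 : r * r = t by rewrite -[r * r]expr2 sqr_sqrtr// ltW.
exists (r%:C *: (1 - z)); split.
- by rewrite starZr starB star1 sz.
- by rewrite cscalerAl cscalerAr scalerA -rmorphM r2 zz /y subKr tx.
- by rewrite /rscal -scalerBr subKr rnormZr ger0_norm// ler_piMr.
- move=> c cx; rewrite cscalerAl cscalerAr mulrBl mulrBr mul1r mulr1 zc//.
  by rewrite mulrBl mulrBr mul1r mulr1 cscalerAl cscalerAr cx.
Qed.

Lemma near_nonneg t x : star x = x -> 0 < t -> rnorm (rscal t - x) <= t -> nonneg x.
Proof. by move=> sx t0 /near_sqrt[]// h [sh hh _ _]; exists h. Qed.

Lemma nonneg_sqrt x : nonneg x -> exists h,
  [/\ nonneg h, h * h = x & forall c, c * x = x * c -> c * h = h * c].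
Proof.
move=> px; have t0 : 0 < rnorm x + 1 by rewrite ltr_wpDl// rnorm_ge0.
have [|h [sh hh ht hc]] := near_sqrt (nonneg_sa px) t0.
  by apply: nonneg_near => //; rewrite lerDl.
by exists h; split=> //; apply: near_nonneg ht => //; rewrite sqrtr_gt0.
Qed.

Lemma nonnegD x y : nonneg x -> nonneg y -> nonneg (x + y).
Proof.
move=> px py.
have t0 : 0 < rnorm x + 1 by rewrite ltr_wpDl// rnorm_ge0.
have s0 : 0 < rnorm y + 1 by rewrite ltr_wpDl// rnorm_ge0.
apply: (@near_nonneg ((rnorm x + 1) + (rnorm y + 1))).
- by rewrite starD !nonneg_sa.
- by rewrite addr_gt0.
- rewrite rscalD opprD addrACA (le_trans (rnormD _ _))// lerD//.
    by apply: nonneg_near => //; rewrite lerDl.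
  by apply: nonneg_near => //; rewrite lerDl.
Qed.

Lemma nonnegM_comm x y : nonneg x -> nonneg y -> x * y = y * x -> nonneg (x * y).
Proof.
move=> /nonneg_sqrt[h [ph hh hc]] /nonneg_sqrt[k [pk kk kc]] xy.
have hy : h * y = y * h by rewrite hc.
have hk : h * k = k * h by rewrite kc.
exists (h * k); rewrite starMr !nonneg_sa//; split; first by rewrite hk.
by rewrite -hh -kk -!mulrA; congr (_ * _); rewrite mulrA [in LHS]hk mulrA.
Qed.

Lemma rscalB_nonneg t x : nonneg x -> 0 <= t -> rnorm x <= t -> nonneg (rscal t - x).
Proof.
move=> px; rewrite le_eqVlt => /predU1P[<- x0|t0 xt].
  have -> : x = 0 by apply: rnorm0_eq0; apply/le_anti; rewrite x0 rnorm_ge0.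
  by rewrite subr0; exact: nonneg_rscal.
apply: (@near_nonneg t) => //; last by rewrite subKr.
by rewrite starB star_rscal nonneg_sa.
Qed.

(** Write [x = h^2] and [t - x = k^2] with commuting roots. Then [h + i k] has squared norm
    [|h^2 + k^2| = |t 1|], and its real part [h] has no larger norm. *)
Lemma nonneg_le_norm t x : 0 <= t -> nonneg x -> nonneg (rscal t - x) -> rnorm x <= t.
Proof.
move=> t0 /nonneg_sqrt[h [/nonneg_sa sh hh hc]] /nonneg_sqrt[k [/nonneg_sa sk kk kc]].
have hx : h * x = x * h by rewrite -hh mulrA.
have hk : h * k = k * h.
  by apply: kc; rewrite mulrBl mulrBr mulrscal rscalM hx.
have := cartesian sh sk hk; rewrite hh kk [x + (_ - x)]addrC subrK.
move/(congr1 (@rnorm R A)); rewrite rnorm_starM => e.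
rewrite -hh rnorm_sqr_sa//; have := le_cartesian sh sk.
have := rnorm_rscal t0; rewrite -e; have := rnorm_ge0 h.
set u := rnorm (h + _); nra.
Qed.

Lemma nonneg_mono x y : nonneg x -> nonneg (y - x) -> rnorm x <= rnorm y.
Proof.
move=> px pxy; have py : nonneg y by have := nonnegD pxy px; rewrite subrK.
apply: nonneg_le_norm => //; first exact: rnorm_ge0.
have -> : rscal (rnorm y) - x = (rscal (rnorm y) - y) + (y - x).
  by rewrite addrA subrK.
apply: nonnegD => //.
by apply: rscalB_nonneg => //; exact: rnorm_ge0.
Qed.

Lemma rnorm_Mstar b : rnorm (b * star b) = rnorm b ^+ 2.
Proof. by rewrite -{1}[b]starK rnorm_starM rnorm_star. Qed.

(* If [y = b b*] and [z = - b* b] are both positive then [b = 0]: with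
   [M = |b|^2], the element [(M - y) b = b (M + z)] has norm at most [M |b| / 2]
   by its first expression and at least [M |b|] by its second one. *)
Lemma opp_starM_nonneg b : nonneg (b * star b) -> nonneg (- (star b * b)) -> b = 0.
Proof.
set y := b * star b; set z := - _ => py pz; have [M ME] : exists M, M = rnorm b ^+ 2 by eexists.
have M0 : 0 <= M by rewrite ME exprn_ge0 ?rnorm_ge0.
have yM : rnorm y = M by rewrite ME; exact: rnorm_Mstar.
have zM : rnorm z = M by rewrite ME rnormN rnorm_starM.
have sy := nonneg_sa py; have sz := nonneg_sa pz.
pose c := (rscal M - y) * b.
have cE : c = b * (rscal M + z).
  by rewrite /c /y /z mulrBl mulrDr mulrscal rscalM mulrN mulrA.
have upper : rnorm (c * star c) <= M * (M ^+ 2 / 4).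
  have -> : c * star c = (rscal M - y) * (y * (rscal M - y)).
    by rewrite /c starMr starB star_rscal sy !mulrA.
  apply: le_trans (rnormM _ _) _; apply: ler_pM; rewrite ?rnorm_ge0//.
    rewrite le_eqVlt in M0; case/predU1P: M0 => [M0|M0].
      by rewrite -M0 /rscal rmorph0 scale0r sub0r rnormN yM -M0.
    by apply: nonneg_near => //; rewrite yM.
  apply: nonneg_le_norm; first by rewrite divr_ge0// exprn_ge0.
    apply: nonnegM_comm => //; last by rewrite mulrBl mulrBr mulrscal rscalM.
    by apply: rscalB_nonneg => //; rewrite yM.
  (* Completing the square: [M^2 / 4 - y (M - y) = (M / 2 - y)^2]. *)
  exists (rscal (M / 2) - y); rewrite starB star_rscal sy; split=> //.
  rewrite !mulrBl !mulrBr !mulrscal !rscalM scalerA -rmorphM /=.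
  have -> : M / 2 * (M / 2) = M ^+ 2 / 4 by lra.
  have -> : M%:C *: y = (M / 2)%:C *: y + (M / 2)%:C *: y.
    by rewrite -scalerDl -rmorphD /= -splitr.
  rewrite -/(rscal _) !opprB [RHS]addrACA -opprD -[RHS]addrA.
  by congr (_ + _); rewrite addrC.
have lower : M ^+ 3 <= rnorm (star c * c).
  have -> : star c * c = - ((rscal M + z) * z * (rscal M + z)).
    rewrite cE starMr starD star_rscal sz /z mulrN mulNr opprK.
    by rewrite -/z !mulrA.
  rewrite rnormN.
  have -> : M ^+ 3 = rnorm ((M * M)%:C *: z).
    by rewrite rnormZr ger0_norm ?mulr_ge0// zM -expr2 -exprSr.
  apply: nonneg_mono; first by apply: nonnegZ => //; rewrite mulr_ge0.
  have -> : (rscal M + z) * z * (rscal M + z) =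
      (M * M)%:C *: z + (M%:C *: (z * z) + (M%:C *: (z * z) + z * z * z)).
    rewrite [(_ + z) * z]mulrDl rscalM mulrDr mulrscal mulrDl scalerDr scalerA.
    by rewrite -rmorphM cscalerAl -addrA.
  have pzz : nonneg (z * z) by exists z.
  rewrite addrC addrA addNr add0r.
  apply: nonnegD; first exact: nonnegZ.
  apply: nonnegD; first exact: nonnegZ.
  by apply: nonnegM_comm; rewrite ?mulrA.
apply: rnorm0_eq0.
move: upper lower; rewrite rnorm_Mstar rnorm_starM => h1 h2.
have M3 : M ^+ 3 <= M * (M ^+ 2 / 4) by exact: le_trans h2 h1.
have : M ^+ 3 = 0 by have : 0 <= M ^+ 3 by [exact: exprn_ge0]; nra.
by move/eqP; rewrite ME !expf_eq0/= => /eqP.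
Qed.

(** Let [m] be the positive root of [x^2] and [n = (m - x) / 2], the negative part of [x]. For
    [b = a n] one gets [b^* b = n x n = - n m n], which is negative, while [b b^*] is positive
    because [b b^* + b^* b] is a sum of squares. By [opp_starM_nonneg] then [b = 0], so
    [n^3 = n m n = 0], [n = 0] and [x = m]. *)
Lemma starM_nonneg a : nonneg (star a * a).
Proof.
set x := star a * a; have sx : star x = x by rewrite starMr starK.
have [m [pm mm mc]] : exists h, [/\ nonneg h, h * h = x * x &
    forall c, c * (x * x) = x * x * c -> c * h = h * c].
  by apply: nonneg_sqrt; exists x.
have xm : x * m = m * x by apply: mc; rewrite mulrA.
have [h [ph hh hc]] := nonneg_sqrt pm.
have [sm sh] := (nonneg_sa pm, nonneg_sa ph).
pose n := (2^-1)%:C *: (m - x).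
have sn : star n = n by rewrite starZr starB sm sx.
have nm : n * m = m * n by rewrite cscalerAl cscalerAr mulrBl mulrBr xm.
have xn : x * n = - (m * n).
  by rewrite !cscalerAr !mulrBr mm xm -scalerN opprB.
have nn : n * n = m * n.
  rewrite {1}/n cscalerAl mulrBl xn opprK scalerDr; exact: rhalfD.
have pz : nonneg (n * m * n).
  exists (h * n); rewrite starMr sn sh.
  have hn : n * h = h * n by apply: hc.
  by split=> //; rewrite -hh [n * (h * h)]mulrA hn -mulrA.
have bz : star (a * n) * (a * n) = - (n * m * n).
  by rewrite starMr sn -!mulrA [star a * _]mulrA -/x xn mulrN.
set b := a * n in bz.
have py : nonneg (b * star b).
  have cross (u v w t : A) : (u + v + (w + t)) - (u - v - (w - t)) = (v + w) + (v + w).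
    rewrite !opprD !opprK !addrA [LHS](ACl (1*5*(4*8)*(2*3)*(6*7)))/=.
    by rewrite !subrr !add0r !addrA.
  (* Up to sign and the factor 2 these are the real and imaginary parts of [b], and
     [p^2 + q^2 = 2 (b b^* + b^* b)]. *)
  clearbody b; pose p := b + star b; pose q := iC *: (b - star b).
  have sp : star p = p by rewrite starD starK addrC.
  have sq : star q = q by rewrite starZ conj_iC starB starK scaleNr -scalerN opprB.
  have -> : b * star b = (2^-1)%:C *: (p * p + q * q) + n * m * n.
    rewrite -[n * m * n]opprK -bz /q cscalerAl cscalerAr scalerA iC2 scaleN1r /p.
    rewrite [(b + _) * _]mulrDr [(b - _) * _]mulrBr !mulrDl !mulNr cross scalerDr rhalfD.
    by rewrite addrC addKr.
  apply: nonnegD => //; apply: nonnegZ; first by rewrite invr_ge0.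
  by apply: nonnegD; [exists p|exists q].
have b0 : b = 0.
  by apply: opp_starM_nonneg => //; rewrite bz opprK.
have n3 : n * m * n = 0 by apply: oppr_inj; rewrite -bz b0 mulr0 oppr0.
have n0 : n = 0.
  have n4 : rnorm ((n * n) * (n * n)) = 0.
    by rewrite -mulrA [n * (n * n)]mulrA {1}nn -[m * n]nm n3 mulr0 rnorm0.
  apply: rnorm0_eq0; move/eqP: n4; rewrite rnorm_sqr_sa ?starMr ?sn//.
  by rewrite rnorm_sqr_sa// !expf_eq0/= => /eqP.
suff -> : x = m by [].
move/(congr1 (fun u => u + u)): n0; rewrite rhalfD addr0 => /subr0_eq.
by [].
Qed.

End Positivity.

(** * The Hilbert module l^2(A) and its adjointable operators *)

Section CauchySchwarz.
Context {R : realType} {A : cstarAlgType R}.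
Implicit Types (x y : nat -> A) (a c : A) (m n : nat).

Lemma nonneg_conj a c : nonneg c -> nonneg (star a * c * a).
Proof.
move=> [h [sh ->]]; have := starM_nonneg (h * a).
by rewrite starMr sh !mulrA.
Qed.

(* Partial inner products of l^2(A), conjugate-linear in the first argument. *)
Definition pip m n x y : A := \sum_(m <= i < n) star (x i) * y i.

Lemma pipDr m n x y z : pip m n x (y + z) = pip m n x y + pip m n x z.
Proof. by rewrite /pip -big_split; apply: eq_bigr => i _; exact: mulrDr. Qed.

Lemma pipZr m n (c : R[i]) x y : pip m n x (c *: y) = c *: pip m n x y.
Proof. by rewrite /pip scaler_sumr; apply: eq_bigr => i _; exact: cscalerAr. Qed.

Lemma star_pip m n x y : star (pip m n x y) = pip m n y x.
Proof. by rewrite /pip star_sum; apply: eq_bigr => i _; rewrite starMr starK. Qed.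

Lemma pipDl m n x y z : pip m n (y + z) x = pip m n y x + pip m n z x.
Proof. by rewrite -star_pip pipDr starD !star_pip. Qed.

Lemma nonneg_pip m n x : nonneg (pip m n x x).
Proof.
rewrite /pip; elim/big_ind: _ => [|u v|i _]; first exact: nonneg0.
  exact: nonnegD.
exact: starM_nonneg.
Qed.

Lemma pip_mono m n m' n' x : (m <= m')%N -> (n' <= n)%N ->
  rnorm (pip m' n' x x) <= rnorm (pip m n x x).
Proof.
move=> mm nn; have [m'n'|n'm'] := leqP m' n'; last first.
  by rewrite /pip [X in rnorm X <= _]big_geq ?rnorm0 ?rnorm_ge0// ltnW.
apply: nonneg_mono; first exact: nonneg_pip.
have -> : pip m n x x = pip m m' x x + (pip m' n' x x + pip n' n x x).
  by rewrite /pip -!big_cat_nat// (leq_trans m'n').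
by rewrite addrCA [_ - _]addrC addKr; apply: nonnegD; exact: nonneg_pip.
Qed.

(** For [P > |p|] and [s = 1 / P], expand the positive element [pip (s x w - y) (s x w - y)] and
    bound [w^* p w] by [P w^* w]. What remains is that [q - s w^* w] is positive, and norms are
    monotone. The strict inequality makes [P] invertible; it is removed by letting [P] decrease to
    [|p|]. *)
Lemma pip_CS m n x y :
  rnorm (pip m n x y) ^+ 2 <= rnorm (pip m n x x) * rnorm (pip m n y y).
Proof.
set p := pip m n x x; set q := pip m n y y; set w := pip m n x y.
suff H (P : R) : rnorm p < P -> rnorm w ^+ 2 <= P * rnorm q.
  apply/ler_addgt0Pr => e e0.
  have q0 : 0 < rnorm q + 1 by rewrite ltr_wpDl// rnorm_ge0.
  have e1 : 0 < e / (rnorm q + 1) by rewrite divr_gt0.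
  have h : rnorm p < rnorm p + e / (rnorm q + 1) by rewrite ltrDl.
  apply: le_trans (H _ h) _; rewrite mulrDl lerD2l mulrAC ler_pdivrMr//.
  by rewrite ler_pM2l// lerDl.
move=> pP; have P0 : 0 < P by rewrite (le_lt_trans _ pP) ?rnorm_ge0.
pose s := P^-1; have s0 : 0 < s by rewrite invr_gt0.
have sP : s * P = 1 by rewrite mulVf ?gt_eqF.
have H1 : nonneg (s%:C *: (s%:C *: (star w * p * w)) - s%:C *: (star w * w)
    - s%:C *: (star w * w) + q).
  have -> : s%:C *: (s%:C *: (star w * p * w)) - s%:C *: (star w * w)
    - s%:C *: (star w * w) + q =
    pip m n (fun i => s%:C *: (x i * w) - y i) (fun i => s%:C *: (x i * w) - y i).
    rewrite /pip [RHS](eq_bigr (fun i => s%:C *: (s%:C *: (star w * (star (x i) * x i) * w))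
      - s%:C *: (star w * (star (x i) * y i)) - s%:C *: ((star (y i) * x i) * w)
      + star (y i) * y i)); last first.
      move=> i _; rewrite starB starZr starMr mulrBr !mulrBl !cscalerAr !cscalerAl !mulrA.
      by rewrite opprB addrA [LHS](ACl (1*4*2*3))/=.
    rewrite !big_split /= !sumrN -!scaler_sumr -!mulr_sumr -!mulr_suml -!mulr_sumr.
    by rewrite -/(pip m n x x) -/(pip m n y y) -/(pip m n x y) -/(pip m n y x) -(star_pip m n x y).
  exact: nonneg_pip.
have H2 : nonneg (s%:C *: (s%:C *: (P%:C *: (star w * w) - star w * p * w))).
  apply: nonnegZ; rewrite ?ltW//; apply: nonnegZ; rewrite ?ltW//.
  have -> : P%:C *: (star w * w) - star w * p * w = star w * (rscal P - p) * w.
    by rewrite mulrBr mulrBl mulrscal cscalerAl.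
  apply: nonneg_conj; apply: rscalB_nonneg; rewrite ?ltW//; exact: nonneg_pip.
have : nonneg (q - s%:C *: (star w * w)).
  have := nonnegD H2 H1; congr nonneg.
  rewrite [in LHS]scalerBr [s%:C *: (P%:C *: _)]scalerA -rmorphM sP scale1r.
  by rewrite scalerBr !addrA subrK subrr sub0r addrC.
move=> /(nonneg_mono (nonnegZ (ltW s0) (starM_nonneg w))).
by rewrite rnormZr gtr0_norm// rnorm_starM ler_pdivrMl.
Qed.

Definition snorm m n x : R := Num.sqrt (rnorm (pip m n x x)).

Lemma snorm_ge0 m n x : 0 <= snorm m n x.
Proof. exact: sqrtr_ge0. Qed.

Lemma snorm_sqr m n x : snorm m n x ^+ 2 = rnorm (pip m n x x).
Proof. by rewrite sqr_sqrtr// rnorm_ge0. Qed.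

Lemma snorm_mono m n m' n' x : (m <= m')%N -> (n' <= n)%N ->
  snorm m' n' x <= snorm m n x.
Proof. by move=> mm nn; rewrite ler_wsqrtr// pip_mono. Qed.

Lemma pip_le m n x y : rnorm (pip m n x y) <= snorm m n x * snorm m n y.
Proof.
rewrite -(ler_pXn2r (n:=2))// ?nnegrE ?mulr_ge0 ?snorm_ge0 ?rnorm_ge0//.
by rewrite exprMn !snorm_sqr pip_CS.
Qed.

Lemma snormD m n x y : snorm m n (x + y) <= snorm m n x + snorm m n y.
Proof.
rewrite -(ler_pXn2r (n:=2))// ?nnegrE ?addr_ge0 ?snorm_ge0//.
rewrite snorm_sqr pipDr !pipDl; have := pip_le m n x y; have := pip_le m n y x.
have := snorm_sqr m n x; have := snorm_sqr m n y.
have := rnormD (pip m n x x + pip m n y x) (pip m n x y + pip m n y y).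
have := rnormD (pip m n x x) (pip m n y x).
have := rnormD (pip m n x y) (pip m n y y).
nra.
Qed.

Lemma snormZ m n (c : R[i]) x : snorm m n (c *: x) = complex.Re `|c| * snorm m n x.
Proof.
have c0 := Re_norm_ge0 c.
rewrite /snorm.
have -> : pip m n (c *: x) (c *: x) = c *: ((c^*)%C *: pip m n x x).
  by rewrite pipZr -star_pip pipZr starZ star_pip.
rewrite !rnormZ mulrA.
have -> : `|(c^*)%C| = `|c| by case: c {c0} => a b; rewrite !normc_def /= sqrrN.
by rewrite sqrtrM ?mulr_ge0// -expr2 sqrtr_sqr ger0_norm.
Qed.

Lemma snormN m n x : snorm m n (- x) = snorm m n x.
Proof. by rewrite -scaleN1r snormZ normrN normr1 mul1r. Qed.

Lemma snormB m n x y : snorm m n (x - y) <= snorm m n x + snorm m n y.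
Proof. by rewrite (le_trans (snormD _ _ _ _))// snormN. Qed.

Lemma snorm_entry n x i : (i < n)%N -> rnorm (x i) <= snorm 0 n x.
Proof.
move=> i_n; apply: le_trans (@snorm_mono 0 n i i.+1 x _ _) => //.
by rewrite /snorm /pip big_nat1 rnorm_starM sqrtr_sqr ger0_norm ?rnorm_ge0.
Qed.

Lemma snorm_lim m n (u : nat -> nat -> A) x (K : R) :
  (forall i, tends (fun k => u k i) (x i)) ->
  (exists N, forall k, (N <= k)%N -> snorm m n (u k) <= K) -> snorm m n x <= K.
Proof.
move=> ux [N HN].
have K0 : 0 <= K by rewrite (le_trans _ (HN _ (leqnn N)))// snorm_ge0.
rewrite -(ler_pXn2r (n:=2))// ?nnegrE ?snorm_ge0// snorm_sqr.
apply: (@tends_le _ _ (fun k => pip m n (u k) (u k))).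
  by apply: tends_sum => i; apply: tendsM => //; exact: tends_star.
exists N => k /HN; rewrite -snorm_sqr => h.
by rewrite ler_pXn2r// ?nnegrE ?snorm_ge0.
Qed.

End CauchySchwarz.

Section Ell2.
Context {R : realType} {A : cstarAlgType R}.
Implicit Types (f g : nat -> A).

(** The tails are required to be small in norm: over a general C*-algebra, bounded partial sums of
    [star (f i) * f i] do not imply norm convergence, and the inner product must be an element of
    [A]. *)
Definition sqsummable f := forall e : R, 0 < e ->
  exists N, forall m n, (N <= m)%N -> snorm m n f <= e.

Definition l2pred : {pred nat -> A} := fun f => `[< sqsummable f >].

Lemma l2predP f : reflect (sqsummable f) (f \in l2pred).
Proof. exact: asboolP. Qed.

Lemma l2pred_submod : submod_closed l2pred.
Proof.
split=> [|c f g /l2predP hf /l2predP hg]; apply/l2predP => e e0.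
  exists 0%N => m n _; rewrite /snorm /pip big1 ?rnorm0 ?sqrtr0 ?ltW// => i _.
  exact: mulr0.
have c0 := Re_norm_ge0 c.
pose C := complex.Re `|c| + 1; have C0 : 0 < C by rewrite ltr_wpDl.
have e1 : 0 < e / 2 / C by rewrite !divr_gt0.
have e2 : 0 < e / 2 by rewrite divr_gt0.
have [N HN] := hf _ e1; have [N' HN'] := hg _ e2.
exists (maxn N N') => m n; rewrite geq_max => /andP[Nm N'm].
have := snormD m n (c *: f) g; rewrite snormZ.
have := HN m n Nm; rewrite ler_pdivlMr// => h; have := HN' m n N'm.
have := snorm_ge0 m n f; rewrite /C in h; nra.
Qed.

HB.instance Definition _ := GRing.isSubmodClosed.Build R[i] (nat -> A) l2pred l2pred_submod.

Record ell2 := Ell2 { ell2_val :> nat -> A; _ : ell2_val \in l2pred }.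

HB.instance Definition _ := [isSub for ell2_val].
HB.instance Definition _ := [Choice of ell2 by <:].
HB.instance Definition _ := [SubChoice_isSubLmodule of ell2 by <:].

Implicit Types x y z : ell2.

Lemma ell2P x : sqsummable x.
Proof. by apply/l2predP; case: x. Qed.

Lemma ell2_eq x y : (forall i, ell2_val x i = ell2_val y i) -> x = y.
Proof. by move=> h; apply: val_inj; apply/funext. Qed.

Lemma ell2D x y : ell2_val (x + y) = ell2_val x + ell2_val y.
Proof. by []. Qed.

Lemma ell2B x y : ell2_val (x - y) = ell2_val x - ell2_val y.
Proof. by []. Qed.

Lemma ell2Z (c : R[i]) x : ell2_val (c *: x) = c *: ell2_val x.
Proof. by []. Qed.

End Ell2.
Arguments ell2 {R} A.

Section InnerProduct.
Context {R : realType} {A : cstarAlgType R}.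
Implicit Types (x y z : ell2 A).

Lemma pip_cvg x y : exists l, tends (fun n => pip 0 n x y) l.
Proof.
apply: cauchy_tends => e e0.
pose d := Num.min (e / 2) 1.
have d0 : 0 < d by rewrite lt_min divr_gt0// ltr01.
have [N HN] := ell2P x d0; have [N' HN'] := ell2P y d0.
have key m n : (maxn N N' <= n <= m)%N -> rnorm (pip 0 m x y - pip 0 n x y) < e.
  rewrite geq_max => /andP[/andP[Nn N'n] nm].
  have -> : pip 0 m x y - pip 0 n x y = pip n m x y.
    by rewrite /pip (@big_cat_nat _ _ _ n 0 m)//= addrAC subrr add0r.
  apply: le_lt_trans (pip_le _ _ _ _) _.
  have := HN n m Nn; have := HN' n m N'n.
  have := snorm_ge0 n m x; have := snorm_ge0 n m y.
  have : d <= e / 2 by rewrite /d ge_min lexx.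
  have : d <= 1 by rewrite /d ge_min lexx orbT.
  nra.
exists (maxn N N') => m n Nm Nn; case: (leqP n m) => [nm|/ltnW mn].
  by apply: key; rewrite Nn.
by rewrite rnormC; apply: key; rewrite Nm.
Qed.

Definition dot x y : A := projT1 (cid (pip_cvg x y)).

Lemma dotP x y : tends (fun n => pip 0 n x y) (dot x y).
Proof. exact: (projT2 (cid (pip_cvg x y))). Qed.

Lemma dotE x y l : tends (fun n => pip 0 n x y) l -> dot x y = l.
Proof. exact: tends_unique (dotP x y). Qed.

Lemma dotDr x y z : dot x (y + z) = dot x y + dot x z.
Proof.
apply: dotE; apply: tends_ext (tendsD (dotP x y) (dotP x z)) => n.
by rewrite ell2D pipDr.
Qed.

Lemma dotZr c x y : dot x (c *: y) = c *: dot x y.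
Proof. by apply: dotE; apply: tends_ext (tendsZ c (dotP x y)) => n; rewrite ell2Z pipZr. Qed.

Lemma star_dot x y : star (dot x y) = dot y x.
Proof. by apply/esym/dotE; apply: tends_ext (tends_star (dotP x y)) => n; rewrite star_pip. Qed.

Lemma dotDl x y z : dot (x + y) z = dot x z + dot y z.
Proof. by rewrite -star_dot dotDr starD !star_dot. Qed.

Lemma dotZl c x y : dot (c *: x) y = (c^*)%C *: dot x y.
Proof. by rewrite -star_dot dotZr starZ star_dot. Qed.

Lemma dotNr x y : dot x (- y) = - dot x y.
Proof. by rewrite -scaleN1r dotZr scaleN1r. Qed.

Lemma dotBr x y z : dot x (y - z) = dot x y - dot x z.
Proof. by rewrite dotDr dotNr. Qed.

Lemma dotBl x y z : dot (x - y) z = dot x z - dot y z.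
Proof. by rewrite -star_dot dotBr starB !star_dot. Qed.

Definition enorm x : R := Num.sqrt (rnorm (dot x x)).

Lemma enorm_ge0 x : 0 <= enorm x.
Proof. exact: sqrtr_ge0. Qed.

Lemma enorm_sqr x : enorm x ^+ 2 = rnorm (dot x x).
Proof. by rewrite sqr_sqrtr// rnorm_ge0. Qed.

Lemma snorm_le_enorm n x : snorm 0 n x <= enorm x.
Proof.
rewrite ler_wsqrtr//; apply: (tends_ge (dotP x x)).
by exists n => m nm; apply: pip_mono.
Qed.

Lemma enorm_le x (K : R) : (forall n, snorm 0 n x <= K) -> enorm x <= K.
Proof.
move=> xK; have K0 : 0 <= K := le_trans (snorm_ge0 0 0 x) (xK 0%N).
rewrite -(ler_pXn2r (n:=2))// ?nnegrE ?enorm_ge0// enorm_sqr.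
apply: (tends_le (dotP x x)); exists 0%N => n _.
by rewrite -snorm_sqr ler_pXn2r// ?nnegrE ?snorm_ge0.
Qed.

Lemma dot_le x y : rnorm (dot x y) <= enorm x * enorm y.
Proof.
apply: (tends_le (dotP x y)); exists 0%N => n _.
by rewrite (le_trans (pip_le _ _ _ _))// ler_pM ?snorm_ge0 ?snorm_le_enorm.
Qed.

Lemma enormD x y : enorm (x + y) <= enorm x + enorm y.
Proof.
apply: enorm_le => n; rewrite ell2D (le_trans (snormD _ _ _ _))//.
by rewrite lerD ?snorm_le_enorm.
Qed.

Lemma enormZ (c : R[i]) x : enorm (c *: x) = complex.Re `|c| * enorm x.
Proof.
have c0 := Re_norm_ge0 c.
have le (d : R[i]) (y : ell2 A) : enorm (d *: y) <= complex.Re `|d| * enorm y.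
  apply: enorm_le => n; rewrite ell2Z snormZ ler_wpM2l ?snorm_le_enorm//.
  exact: Re_norm_ge0.
apply/le_anti/andP; split; first exact: le.
have [->|cn0] := eqVneq c 0; first by rewrite normr0 mul0r enorm_ge0.
have := le c^-1 (c *: x); rewrite scalerA mulVf// scale1r normfV.
have rc : 0 < complex.Re `|c|.
  by have := cn0; rewrite -normr_gt0 normc_ReE ltcR.
rewrite normc_ReE -fmorphV /= -ler_pdivrMl ?invr_gt0// invrK.
by [].
Qed.

Lemma enormN x : enorm (- x) = enorm x.
Proof. by rewrite -scaleN1r enormZ normrN normr1 mul1r. Qed.

Lemma enormC x y : enorm (x - y) = enorm (y - x).
Proof. by rewrite -enormN opprB. Qed.

Lemma enorm_triangle z x y : enorm (x - y) <= enorm (x - z) + enorm (z - y).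
Proof. by rewrite (le_trans _ (enormD _ _))// addrA subrK. Qed.

Lemma ell2_entry x i : rnorm (ell2_val x i) <= enorm x.
Proof. exact: le_trans (snorm_entry x (ltnSn i)) (snorm_le_enorm _ _). Qed.

Lemma enorm0_eq0 x : enorm x = 0 -> x = 0.
Proof.
move=> x0; apply: ell2_eq => i; apply: rnorm0_eq0.
by apply/le_anti; rewrite rnorm_ge0 andbT -x0 ell2_entry.
Qed.

Lemma enorm0 : enorm 0 = 0.
Proof. by rewrite -(scale0r (0 : ell2 A)) enormZ normr0 mul0r. Qed.

Lemma dot_eq0 x : (forall y, dot x y = 0) -> x = 0.
Proof. by move=> h; apply: enorm0_eq0; rewrite /enorm h rnorm0 sqrtr0. Qed.

Lemma ell2_complete (u : nat -> ell2 A) :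
  (forall e : R, 0 < e -> exists N, forall m n, (N <= m)%N -> (N <= n)%N ->
     enorm (u m - u n) <= e) ->
  exists l, forall e : R, 0 < e -> exists N, forall n, (N <= n)%N ->
     enorm (u n - l) <= e.
Proof.
move=> cu.
have ex i : exists l, tends (fun n => ell2_val (u n) i) l.
  apply: cauchy_tends => e e0; have e20 : 0 < e / 2 by lra.
  have [N HN] := cu _ e20; exists N => m n Nm Nn.
  have := ell2_entry (u m - u n) i; rewrite ell2B.
  by move=> /le_trans /(_ (HN m n Nm Nn)) /le_lt_trans; apply; lra.
pose l i := projT1 (cid (ex i)).
have lP i : tends (fun n => ell2_val (u n) i) (l i) := projT2 (cid (ex i)).
(* The bound is passed to the coordinatewise limit on every finite window [p <= i < q]: far windows
   show that the limit is square-summable, initial ones that convergence holds in norm. *)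
have close e N : 0 < e -> (forall m n, (N <= m)%N -> (N <= n)%N -> enorm (u m - u n) <= e) ->
    forall p q k, (N <= k)%N -> snorm p q (ell2_val (u k) - l) <= e.
  move=> e0 HN p q k Nk.
  apply: (@snorm_lim _ _ p q (fun n => ell2_val (u k) - ell2_val (u n))).
    by move=> i; apply: tendsB => //; exact: tends_cst.
  exists N => n Nn; rewrite -ell2B; apply: le_trans (HN k n Nk Nn).
  by apply: le_trans (snorm_le_enorm q _); exact: snorm_mono.
have l2l : l \in l2pred.
  apply/l2predP => e e0; have e20 : 0 < e / 2 by lra.
  have [N HN] := cu _ e20; have [N' HN'] := ell2P (u N) e20.
  exists N' => m n N'm.
  have := snormB m n (ell2_val (u N)) (ell2_val (u N) - l).
  rewrite subKr; have := close _ _ e20 HN m n N (leqnn N); have := HN' m n N'm.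
  lra.
exists (Ell2 l2l) => e e0; have [N HN] := cu _ e0.
by exists N => n Nn; apply: enorm_le => q; exact: (close _ _ e0 HN 0%N q n Nn).
Qed.

End InnerProduct.

(** * The C*-algebra of bounded adjointable operators *)

Section AdjointableOperators.
Context {R : realType} {A : cstarAlgType R}.
Implicit Types (x y z : ell2 A) (T S : ell2 A -> ell2 A).

Definition adjoint_to T S := forall x y, dot (T x) y = dot x (S y).

Definition op_bounded T := exists M : R, forall x, enorm (T x) <= M * enorm x.

Definition adjpred : {pred ell2 A -> ell2 A} :=
  fun T => `[< (exists S, adjoint_to T S) /\ op_bounded T >].

Lemma adjpredP T : reflect ((exists S, adjoint_to T S) /\ op_bounded T) (T \in adjpred).
Proof. exact: asboolP. Qed.

Lemma adjpred_submod : submod_closed adjpred.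
Proof.
split=> [|c T T' /adjpredP[[S TS] [M TM]] /adjpredP[[S' TS'] [M' TM']]]; apply/adjpredP.
  have d0 x : dot 0 x = 0 by rewrite -(scale0r (0 : ell2 A)) dotZl rmorph0 scale0r.
  split; first by exists 0 => x y; rewrite d0 -star_dot d0 star0.
  by exists 0 => x; rewrite enorm0 mul0r.
split.
  exists ((c^*)%C *: S + S') => x y.
  rewrite -[(c *: T + T') x]/(c *: T x + T' x) -[(_ + S') y]/((c^*)%C *: S y + S' y).
  by rewrite dotDl dotDr dotZl dotZr TS TS'.
exists (complex.Re `|c| * M + M') => x.
rewrite -[(c *: T + T') x]/(c *: T x + T' x) (le_trans (enormD _ _))// enormZ mulrDl.
by rewrite lerD// -mulrA ler_wpM2l// Re_norm_ge0.
Qed.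

HB.instance Definition _ :=
  GRing.isSubmodClosed.Build R[i] (ell2 A -> ell2 A) adjpred adjpred_submod.

Record adjop := AdjOp { op_fun :> ell2 A -> ell2 A; _ : op_fun \in adjpred }.

HB.instance Definition _ := [isSub for op_fun].
HB.instance Definition _ := [Choice of adjop by <:].
HB.instance Definition _ := [SubChoice_isSubLmodule of adjop by <:].

End AdjointableOperators.
Arguments adjop {R} A.

Section OperatorAlgebra.
Context {R : realType} {A : cstarAlgType R}.
Implicit Types (x y z : ell2 A) (T S : adjop A).

Lemma adjop_adjoint T : exists S : ell2 A -> ell2 A, adjoint_to (op_fun T) S.
Proof. by case: T => T /= /adjpredP[]. Qed.

Lemma adjop_bounded T : op_bounded (op_fun T).
Proof. by case: T => T /= /adjpredP[]. Qed.

Lemma adjop_eq T S : (forall x, op_fun T x = op_fun S x) -> T = S.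
Proof. by move=> h; apply: val_inj; apply/funext. Qed.

Lemma opDE T S x : op_fun (T + S) x = op_fun T x + op_fun S x.
Proof. by []. Qed.

Lemma opBE T S x : op_fun (T - S) x = op_fun T x - op_fun S x.
Proof. by []. Qed.

Lemma opZE (c : R[i]) T x : op_fun (c *: T) x = c *: op_fun T x.
Proof. by []. Qed.

(** Linearity is not built into [adjpred]: it follows from the existence of an adjoint, because
    inner products separate vectors. *)
Lemma op_add T x y : op_fun T (x + y) = op_fun T x + op_fun T y.
Proof.
have [S TS] := adjop_adjoint T; apply/subr0_eq/dot_eq0 => z.
by rewrite dotBl dotDl !TS dotDl subrr.
Qed.

Lemma op_scale T (c : R[i]) x : op_fun T (c *: x) = c *: op_fun T x.
Proof.
have [S TS] := adjop_adjoint T; apply/subr0_eq/dot_eq0 => z.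
by rewrite dotBl dotZl !TS dotZl subrr.
Qed.

Definition opset T : set R :=
  [set M : R | 0 <= M /\ forall x, enorm (op_fun T x) <= M * enorm x].

Definition opnorm T : R := inf (opset T).

Lemma opset_inf T : has_inf (opset T).
Proof.
split; last by exists 0 => M [].
have [M HM] := adjop_bounded T; exists `|M|; split=> // x.
by rewrite (le_trans (HM x))// ler_wpM2r ?enorm_ge0 ?ler_norm.
Qed.

Lemma opnorm_ge0 T : 0 <= opnorm T.
Proof. by apply: lb_le_inf => [|M []//]; case: (opset_inf T). Qed.

Lemma opnormP T x : enorm (op_fun T x) <= opnorm T * enorm x.
Proof.
have := enorm_ge0 x; rewrite le_eqVlt => /predU1P[x0|x0].
  have [[M [_ HM]] _] := opset_inf T; have := HM x.
  by rewrite -x0 !mulr0.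
rewrite -ler_pdivrMr//; apply: lb_le_inf; first by case: (opset_inf T).
by move=> M [_ HM]; rewrite ler_pdivrMr.
Qed.

Lemma opnorm_le T (M : R) :
  0 <= M -> (forall x, enorm (op_fun T x) <= M * enorm x) -> opnorm T <= M.
Proof. by move=> M0 HM; apply: ge_inf; [case: (opset_inf T)|split]. Qed.

Lemma opnormD T S : opnorm (T + S) <= opnorm T + opnorm S.
Proof.
apply: opnorm_le => [|x]; first by rewrite addr_ge0 ?opnorm_ge0.
by rewrite opDE (le_trans (enormD _ _))// mulrDl lerD ?opnormP.
Qed.

Lemma opnormZ (c : R[i]) T : opnorm (c *: T) = complex.Re `|c| * opnorm T.
Proof.
have le (d : R[i]) S : opnorm (d *: S) <= complex.Re `|d| * opnorm S.
  apply: opnorm_le => [|x]; first by rewrite mulr_ge0 ?Re_norm_ge0 ?opnorm_ge0.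
  by rewrite opZE enormZ -mulrA ler_wpM2l ?Re_norm_ge0 ?opnormP.
apply/le_anti/andP; split; first exact: le.
have [->|cn0] := eqVneq c 0; first by rewrite normr0 mul0r opnorm_ge0.
have := le c^-1 (c *: T); rewrite scalerA mulVf// scale1r normfV.
have rc : 0 < complex.Re `|c|.
  by have := cn0; rewrite -normr_gt0 normc_ReE ltcR.
by rewrite normc_ReE -fmorphV /= -ler_pdivrMl ?invr_gt0// invrK.
Qed.

Lemma opnorm0_eq0 T : opnorm T = 0 -> T = 0.
Proof.
move=> T0; apply: adjop_eq => x; apply: enorm0_eq0.
by apply/le_anti; rewrite enorm_ge0 andbT (le_trans (opnormP T x))// T0 mul0r.
Qed.

Definition opnormC T : R[i] := (opnorm T)%:C.

Lemma opnormC_D T S : opnormC (T + S) <= opnormC T + opnormC S.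
Proof. by rewrite -rmorphD lecR opnormD. Qed.

Lemma opnormC_Z (c : R[i]) T : opnormC (c *: T) = `|c| * opnormC T.
Proof.
by rewrite /opnormC opnormZ rmorphM.
Qed.

Lemma opnormC_eq0 T : opnormC T = 0 -> T = 0.
Proof. by move=> [] /opnorm0_eq0. Qed.

HB.instance Definition _ :=
  Lmodule_isNormed.Build R[i] (adjop A) opnormC_D opnormC_Z opnormC_eq0.

Lemma normr_adjop T : `|T| = (opnorm T)%:C.
Proof. by []. Qed.

(** The adjoint is bounded by [opnorm T], since [|S x|^2 = |dot (T (S x)) x| <= opnorm T * |S x| *
    |x|]. *)
Lemma ex_adj T : exists S : adjop A, adjoint_to (op_fun T) (op_fun S).
Proof.
have [S TS] := adjop_adjoint T.
have Sa : S \in adjpred.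
  apply/adjpredP; split.
    by exists (op_fun T) => x y; rewrite -star_dot -TS star_dot.
  exists (opnorm T) => x; have := enorm_ge0 (S x).
  rewrite le_eqVlt => /predU1P[<-|Sx0]; first by rewrite mulr_ge0 ?opnorm_ge0 ?enorm_ge0.
  rewrite -(ler_pM2r Sx0) -expr2 enorm_sqr -TS (le_trans (dot_le _ _))//.
  by rewrite mulrAC ler_wpM2r ?enorm_ge0 ?opnormP.
by exists (AdjOp Sa).
Qed.

Definition op_adj T : adjop A := projT1 (cid (ex_adj T)).

Lemma op_adjP T x y : dot (op_fun T x) y = dot x (op_fun (op_adj T) y).
Proof. exact: (projT2 (cid (ex_adj T))). Qed.

Lemma op_adjE T S : (forall x y, dot (op_fun T x) y = dot x (op_fun S y)) -> op_adj T = S.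
Proof.
move=> TS; apply: adjop_eq => y; apply/subr0_eq/dot_eq0 => x.
by rewrite -star_dot dotBr -op_adjP TS subrr star0.
Qed.

Lemma op_adjK : involutive op_adj.
Proof. by move=> T; apply: op_adjE => x y; rewrite -star_dot -op_adjP star_dot. Qed.

Lemma op_adjD : {morph op_adj : T S / T + S}.
Proof. by move=> T S; apply: op_adjE => x y; rewrite !opDE dotDl dotDr !op_adjP. Qed.

Lemma op_adjZ (c : R[i]) T : op_adj (c *: T) = (c^*)%C *: op_adj T.
Proof. by apply: op_adjE => x y; rewrite !opZE dotZl dotZr op_adjP. Qed.

Lemma op_adjB T S : op_adj (T - S) = op_adj T - op_adj S.
Proof. by apply: op_adjE => x y; rewrite !opBE dotBl dotBr !op_adjP. Qed.

Lemma opnorm_adj_le T : opnorm (op_adj T) <= opnorm T.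
Proof.
apply: opnorm_le => [|x]; first exact: opnorm_ge0.
have := enorm_ge0 (op_fun (op_adj T) x); rewrite le_eqVlt => /predU1P[<-|Sx0].
  by rewrite mulr_ge0 ?opnorm_ge0 ?enorm_ge0.
rewrite -(ler_pM2r Sx0) -expr2 enorm_sqr -op_adjP (le_trans (dot_le _ _))//.
by rewrite mulrAC ler_wpM2r ?enorm_ge0 ?opnormP.
Qed.

Lemma comp_adjpred T S : op_fun T \o op_fun S \in adjpred.
Proof.
apply/adjpredP; split.
  by exists (op_fun (op_adj S) \o op_fun (op_adj T)) => x y; rewrite /= !op_adjP.
exists (opnorm T * opnorm S) => x; rewrite (le_trans (opnormP T (op_fun S x)))//.
by rewrite -mulrA ler_wpM2l ?opnorm_ge0 ?opnormP.
Qed.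

Definition opmul T S : adjop A := AdjOp (comp_adjpred T S).

Lemma id_adjpred : id \in @adjpred R A.
Proof.
apply/adjpredP; split; first by exists id.
by exists 1 => x; rewrite mul1r.
Qed.

Definition opone : adjop A := AdjOp id_adjpred.

Lemma opnorm_mul T S : opnorm (opmul T S) <= opnorm T * opnorm S.
Proof.
apply: opnorm_le => [|x]; first by rewrite mulr_ge0 ?opnorm_ge0.
by rewrite (le_trans (opnormP T (op_fun S x)))// -mulrA ler_wpM2l ?opnorm_ge0 ?opnormP.
Qed.

Lemma opnorm_star T : opnorm (opmul (op_adj T) T) = opnorm T ^+ 2.
Proof.
apply/le_anti/andP; split.
  by rewrite (le_trans (opnorm_mul _ _))// expr2 ler_wpM2r ?opnorm_ge0 ?opnorm_adj_le.
set K := opnorm (opmul _ _); have K0 : 0 <= K by exact: opnorm_ge0.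
rewrite -(sqr_sqrtr K0) ler_pXn2r// ?nnegrE ?opnorm_ge0 ?sqrtr_ge0//.
apply: opnorm_le => [|x]; first exact: sqrtr_ge0.
rewrite -(ler_pXn2r (n:=2))// ?nnegrE ?mulr_ge0 ?enorm_ge0 ?sqrtr_ge0//.
rewrite enorm_sqr exprMn sqr_sqrtr// op_adjP (le_trans (dot_le _ _))//.
rewrite expr2 mulrCA ler_wpM2l ?enorm_ge0//.
exact: (opnormP (opmul (op_adj T) T) x).
Qed.

(** A pointwise limit of operators must be given an adjoint. As [op_adj] does not increase norms,
    the adjoints also form a Cauchy sequence, and their pointwise limit is adjoint to that of
    [u]. *)
Lemma adjop_cauchy_seq (u : nat -> adjop A) :
  (forall e : R, 0 < e -> exists N, forall m n, (N <= m)%N -> (N <= n)%N ->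
     opnorm (u m - u n) <= e) ->
  exists l, forall e : R, 0 < e -> exists N, forall n, (N <= n)%N ->
     opnorm (u n - l) <= e.
Proof.
move=> cu.
have lim (v : nat -> adjop A) : (forall e : R, 0 < e -> exists N, forall m n, (N <= m)%N -> (N <= n)%N ->
     opnorm (v m - v n) <= e) -> forall x, exists y, forall e : R, 0 < e -> exists N, forall n, (N <= n)%N ->
     enorm (op_fun (v n) x - y) <= e.
  move=> cv x; apply: ell2_complete => e e0.
  have x1 : 0 < enorm x + 1 by rewrite ltr_wpDl// enorm_ge0.
  have [N HN] := cv _ (divr_gt0 e0 x1); exists N => m n Nm Nn.
  rewrite -opBE (le_trans (opnormP _ _))//.
  have := HN m n Nm Nn; rewrite ler_pdivlMr// => /(le_trans _); apply.
  by rewrite ler_wpM2l ?opnorm_ge0// lerDl.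
have ca : forall e : R, 0 < e -> exists N, forall m n, (N <= m)%N -> (N <= n)%N ->
     opnorm (op_adj (u m) - op_adj (u n)) <= e.
  move=> e /cu[N HN]; exists N => m n Nm Nn.
  by rewrite -op_adjB (le_trans (opnorm_adj_le _))// HN.
pose T x := projT1 (cid (lim u cu x)).
have TP x := projT2 (cid (lim u cu x)) : forall e : R, 0 < e -> exists N, forall n, (N <= n)%N ->
     enorm (op_fun (u n) x - T x) <= e.
pose S x := projT1 (cid (lim (op_adj \o u) ca x)).
have SP x := projT2 (cid (lim (op_adj \o u) ca x)) : forall e : R, 0 < e -> exists N, forall n, (N <= n)%N ->
     enorm (op_fun (op_adj (u n)) x - S x) <= e.
have TS : adjoint_to T S.
  move=> x y; apply/subr0_eq/rnorm_small => e e0.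
  pose K := enorm x + enorm y + 1.
  have K0 : 0 < K by rewrite ltr_wpDl// addr_ge0// enorm_ge0.
  have e1 : 0 < e / K by rewrite divr_gt0.
  have [N HN] := TP x _ e1; have [N' HN'] := SP y _ e1.
  have h := HN _ (leq_maxl N N'); have h' := HN' _ (leq_maxr N N').
  set n := maxn N N' in h h'.
  have -> : dot (T x) y - dot x (S y) =
      dot x (op_fun (op_adj (u n)) y - S y) - dot (op_fun (u n) x - T x) y.
    by rewrite dotBr dotBl op_adjP opprB [RHS]addrC addrA subrK.
  apply: le_trans (rnormB _ _) _.
  have d1 := dot_le x (op_fun (op_adj (u n)) y - S y).
  have d2 := dot_le (op_fun (u n) x - T x) y.
  have p1 := ler_wpM2l (enorm_ge0 x) h'; have p2 := ler_wpM2r (enorm_ge0 y) h.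
  have eK : e / K * K = e by rewrite divfK// gt_eqF.
  apply: le_trans (lerD (le_trans d1 p1) (le_trans d2 p2)) _.
  by rewrite -[leRHS]eK [enorm x * _]mulrC -mulrDr ler_wpM2l ?(ltW e1)// lerDl.
have close (e : R) N : 0 < e -> (forall m n, (N <= m)%N -> (N <= n)%N -> opnorm (u m - u n) <= e) ->
    forall k x, (N <= k)%N -> enorm (op_fun (u k) x - T x) <= e * enorm x.
  move=> e0 HN k x Nk; apply/ler_addgt0Pr => d d0.
  have [N' HN'] := TP x _ d0.
  have h := HN k _ Nk (leq_maxl N N'); have h' := HN' _ (leq_maxr N N').
  apply: le_trans (enorm_triangle (op_fun (u (maxn N N')) x) _ _) _.
  rewrite lerD// -opBE (le_trans (opnormP _ _))//.
  by rewrite ler_wpM2r ?enorm_ge0.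
have Ta : T \in adjpred.
  apply/adjpredP; split; first by exists S.
  have [N HN] := cu 1 ltr01; exists (opnorm (u N) + 1) => x.
  have := close _ _ ltr01 HN N x (leqnn N).
  have := enorm_triangle (op_fun (u N) x) (T x) 0; rewrite !subr0 enormC.
  have := opnormP (u N) x; rewrite mulrDl; lra.
exists (AdjOp Ta) => e e0; have [N HN] := cu _ e0.
exists N => n Nn; apply: opnorm_le => [|x]; first exact: ltW.
exact: (close _ _ e0 HN n x Nn).
Qed.

(** Reduction of filters to sequences: [F] contains a ball of radius 1/(k+1) for each k, any two of
    these balls meet, so their centres form a Cauchy sequence. *)
Lemma adjop_complete (F : set_system (adjop A)) :
  ProperFilter F -> cauchy F -> cvg F.
Proof.
move=> FF /cauchyP cF.
pose r (k : nat) : R := k.+1%:R^-1.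
have r0 k : 0 < r k by rewrite invr_gt0 ltr0n.
have rsmall (e : R) : 0 < e -> exists N, forall k, (N <= k)%N -> r k < e.
  move=> e0; have [N] := ltr_add_invr e0; rewrite add0r => hN.
  exists N => k Nk; apply: le_lt_trans hN.
  by rewrite /r lef_pV2 ?posrE ?ltr0n// ler_nat.
have ex k : exists T, F (ball T (r k)%:C) by apply: cF; rewrite ltcR.
have [u uP] : exists u : nat -> adjop A, forall k, F (ball (u k) (r k)%:C).
  by exists (fun k => projT1 (cid (ex k))) => k; exact: (projT2 (cid (ex k))).
have ballE T S (e : R) : ball T e%:C S -> opnorm (T - S) < e.
  by rewrite -ball_normE /= ltcR.
have [e e0|l Hl] := @adjop_cauchy_seq u.
  have [N HN] := rsmall _ (divr_gt0 e0 (ltr0n R 2)).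
  exists N => m n /HN hm /HN hn.
  have [S [/ballE h1 /ballE h2]] := filter_ex (filterI (uP m) (uP n)).
  have -> : u m - u n = (u m - S) + -1 *: (u n - S).
    by rewrite scaleN1r opprB addrA subrK.
  have := opnormD (u m - S) (-1 *: (u n - S)); rewrite opnormZ normrN normr1 /= mul1r.
  move=> /le_trans; apply; rewrite [leRHS]splitr.
  exact: lerD (ltW (lt_trans h1 hm)) (ltW (lt_trans h2 hn)).
apply/cvg_ex; exists l; apply/cvg_ballP => e /gt0_ReE[-> e0].
have e2 : 0 < complex.Re e / 2 by rewrite divr_gt0.
have [N HN] := rsmall _ e2; have [N' HN'] := Hl _ e2.
have := uP (maxn N N'); apply: filterS => S /ballE h1.
rewrite -ball_normE /= normr_adjop ltcR.
have h2 := HN _ (leq_maxl N N'); have h3 := HN' _ (leq_maxr N N').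
set T := u _ in h1 h3.
have -> : l - S = (T - S) + -1 *: (T - l) by rewrite scaleN1r opprB [RHS]addrC addrA subrK.
have := opnormD (T - S) (-1 *: (T - l)); rewrite opnormZ normrN normr1 /= mul1r.
move=> /le_lt_trans; apply; rewrite [ltRHS]splitr.
exact: ltr_leD (lt_trans h1 h2) h3.
Qed.

HB.instance Definition _ := Uniform_isComplete.Build (adjop A) adjop_complete.

End OperatorAlgebra.

Section OperatorCStar.
Context {R : realType} {A : cstarAlgType R}.
Implicit Types (x y z : ell2 A) (T S : adjop A).

Lemma opmulA : associative (@opmul R A).
Proof. by move=> T S U; exact: val_inj. Qed.

Lemma opmul1 : left_id opone (@opmul R A).
Proof. by move=> T; apply: adjop_eq. Qed.

Lemma opmulr1 : right_id opone (@opmul R A).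
Proof. by move=> T; apply: adjop_eq. Qed.

Lemma opmulDl : left_distributive (@opmul R A) +%R.
Proof. by move=> T S U; apply: adjop_eq. Qed.

Lemma opmulDr : right_distributive (@opmul R A) +%R.
Proof. by move=> T S U; apply: adjop_eq => x; exact: op_add. Qed.

Lemma opscaleAl (c : R[i]) T S : c *: opmul T S = opmul (c *: T) S.
Proof. exact: adjop_eq. Qed.

Lemma opscaleAr (c : R[i]) T S : c *: opmul T S = opmul T (c *: S).
Proof. by apply: adjop_eq => x; exact: esym (op_scale T c (op_fun S x)). Qed.

Lemma opmul_norm T S : `|opmul T S| <= `|T| * `|S|.
Proof. by rewrite !normr_adjop -rmorphM lecR opnorm_mul. Qed.

Lemma op_adjM T S : op_adj (opmul T S) = opmul (op_adj S) (op_adj T).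
Proof. by apply: op_adjE => x y; exact: etrans (op_adjP T (op_fun S x) y) (op_adjP S x _). Qed.

Lemma op_adj_norm T : `|opmul (op_adj T) T| = `|T| ^+ 2.
Proof. by rewrite !normr_adjop opnorm_star rmorphXn. Qed.

HB.instance Definition _ := isCStarAlgebra.Build R (adjop A)
  opmulA opmul1 opmulr1 opmulDl opmulDr opscaleAl opscaleAr opmul_norm
  (@op_adjK R A) (@op_adjD R A) op_adjM (@op_adjZ R A) op_adj_norm.

End OperatorCStar.

(* An alias of [adjop A] from which the ring structure of the C*-algebra is
   inferred. *)
Definition opalg (R : realType) (A : cstarAlgType R) : cstarAlgType R := adjop A.

Section DiagonalEmbedding.
Context {R : realType} {A : cstarAlgType R}.
Implicit Types (a b : A) (f g : nat -> A) (x y : ell2 A).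

Definition lmulseq a f : nat -> A := fun i => a * f i.

Lemma pip_lmul m n a f g : pip m n (lmulseq a f) g = pip m n f (lmulseq (star a) g).
Proof. by apply: eq_bigr => i _; rewrite /lmulseq starMr mulrA. Qed.

(** With [c = a^* a], the element [|c| - c] is positive and remains so under conjugation by each
    [f i]; sum over [i] and use monotonicity of the norm. Here [starM_nonneg] is indispensable. *)
Lemma snorm_lmul m n a f : snorm m n (lmulseq a f) <= rnorm a * snorm m n f.
Proof.
rewrite -(ler_pXn2r (n:=2))// ?nnegrE ?mulr_ge0 ?snorm_ge0 ?rnorm_ge0//.
rewrite exprMn !snorm_sqr -rnorm_starM; set c := star a * a.
have c0 : nonneg c by exact: starM_nonneg.
have -> : rnorm c * rnorm (pip m n f f) = rnorm ((rnorm c)%:C *: pip m n f f).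
  by rewrite rnormZr ger0_norm ?rnorm_ge0.
apply: nonneg_mono; first exact: nonneg_pip.
rewrite /pip scaler_sumr -sumrB; elim/big_ind: _ => [|u v|i _]; first exact: nonneg0.
  exact: nonnegD.
have -> : (rnorm c)%:C *: (star (f i) * f i) - star (lmulseq a f i) * lmulseq a f i =
    star (f i) * (rscal (rnorm c) - c) * f i.
  by rewrite mulrBr mulrBl mulrscal cscalerAl starMr !mulrA.
by apply: nonneg_conj; apply: rscalB_nonneg => //; exact: rnorm_ge0.
Qed.

Lemma lmul_l2 a x : lmulseq a x \in l2pred.
Proof.
apply/l2predP => e e0.
have K0 : 0 < rnorm a + 1 by rewrite ltr_wpDl// rnorm_ge0.
have [N HN] := ell2P x (divr_gt0 e0 K0).
exists N => m n /HN -/(_ n); rewrite ler_pdivlMr// mulrC => h.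
apply: le_trans (snorm_lmul _ _ _ _) (le_trans _ h).
by rewrite ler_wpM2r ?snorm_ge0// lerDl.
Qed.

Definition lmul a x : ell2 A := Ell2 (lmul_l2 a x).

Lemma lmul_adj a : adjoint_to (lmul a) (lmul (star a)).
Proof.
move=> x y; apply: dotE; apply: tends_ext (dotP x (lmul (star a) y)) => n.
by rewrite pip_lmul.
Qed.

Lemma enorm_lmul a x : enorm (lmul a x) <= rnorm a * enorm x.
Proof.
apply: enorm_le => n; apply: le_trans (snorm_lmul _ _ _ _) _.
by rewrite ler_wpM2l ?rnorm_ge0 ?snorm_le_enorm.
Qed.

Lemma lmul_adjpred a : lmul a \in adjpred.
Proof.
apply/adjpredP; split; first by exists (lmul (star a)); exact: lmul_adj.
by exists (rnorm a) => x; exact: enorm_lmul.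
Qed.

Definition diag_op a : opalg A := AdjOp (lmul_adjpred a).

(** The vector that tests the norm of [diag_op a] from below. Its own norm is only shown to be at
    most 1, because [A] may be the zero algebra. *)
Definition delta0 : nat -> A := fun i => if i is 0%N then 1 else 0.

Lemma pip_delta0 m n : pip m.+1 n delta0 delta0 = 0.
Proof.
rewrite /pip big_nat big1// => -[|i] /andP[//] _ _.
by rewrite /delta0 mulr0.
Qed.

Lemma delta0_l2 : delta0 \in l2pred.
Proof.
apply/l2predP => e e0; exists 1%N => -[//|m] n _.
by rewrite /snorm pip_delta0 rnorm0 sqrtr0 ltW.
Qed.

Definition delta0E : ell2 A := Ell2 delta0_l2.

Lemma enorm_delta0 : enorm delta0E <= 1.
Proof.
apply: enorm_le => -[|n].
  by rewrite /snorm /pip big_geq// rnorm0 sqrtr0 ler01.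
rewrite /snorm /pip big_nat_recl//= big1 ?addr0; last by move=> i _; rewrite mulr0.
by rewrite star1 mulr1 -[leRHS]sqrtr1 ler_wsqrtr// rnorm1.
Qed.

Lemma opnorm_diag a : opnorm (diag_op a) = rnorm a.
Proof.
apply/le_anti/andP; split.
  by apply: opnorm_le => [|x]; [exact: rnorm_ge0|exact: enorm_lmul].
have : rnorm (a * 1) <= enorm (lmul a delta0E) := ell2_entry (lmul a delta0E) 0%N.
rewrite mulr1 => /le_trans; apply.
apply: le_trans (opnormP (diag_op a) delta0E) _.
by rewrite ler_piMr ?opnorm_ge0 ?enorm_delta0.
Qed.

Lemma diag_embedding : unital_embedding diag_op.
Proof.
split.
- by move=> a b; apply: adjop_eq => x; apply: ell2_eq => i; exact: mulrDl.
- by move=> c a; apply: adjop_eq => x; apply: ell2_eq => i; exact: cscalerAl.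
- by move=> a b; apply: adjop_eq => x; apply: ell2_eq => i; exact/esym/mulrA.
- by apply: adjop_eq => x; apply: ell2_eq => i; exact: mul1r.
- by move=> a; apply/esym/op_adjE; exact: lmul_adj.
- by move=> a; rewrite normr_adjop opnorm_diag rnormE.
Qed.

End DiagonalEmbedding.

(** * Isometries satisfying the Cuntz relations *)

Section CuntzIsometries.
Context {R : realType} {A : cstarAlgType R}.
Implicit Types (f g : nat -> A) (x y : ell2 A) (p : bool).

(* [spread p] moves the [i]-th coordinate to position [2i + p], and [gather p]
   is its adjoint. *)
Definition spread p f : nat -> A := fun j => if odd j == p then f j./2 else 0.

Definition gather p f : nat -> A := fun i => f (p + i.*2)%N.

Lemma sum_double (F : nat -> A) n :
  \sum_(0 <= j < n.*2) F j =
  \sum_(0 <= i < n) F i.*2 + \sum_(0 <= i < n) F (1 + i.*2)%N.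
Proof.
elim: n => [|n IH]; first by rewrite !big_geq// addr0.
by rewrite doubleS !big_nat_recr//= IH addrACA addrA.
Qed.

Lemma tends_sub (u : nat -> A) l (h : nat -> nat) :
  (forall n, (n <= h n)%N) -> tends u l -> tends (fun n => u (h n)) l.
Proof.
move=> hn ul e /ul[N HN]; exists N => n Nn; apply: HN.
exact: leq_trans Nn (hn n).
Qed.

Lemma pip_spread p n f g : pip 0 n.*2 (spread p f) g = pip 0 n f (gather p g).
Proof.
rewrite /pip sum_double /spread /gather; case: p => /=.
  rewrite [X in X + _]big1 ?add0r; last by move=> i _; rewrite odd_double star0 mul0r.
  by apply: eq_bigr => i _; rewrite add0n odd_double/= uphalf_double.
rewrite [X in _ + X]big1 ?addr0; last by move=> i _; rewrite /= odd_double star0 mul0r.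
by apply: eq_bigr => i _; rewrite odd_double /= doubleK.
Qed.

Lemma gather_spread p q f : gather p (spread q f) = if p == q then f else 0.
Proof.
apply/funext => i; rewrite /gather /spread oddD odd_double addbF oddb.
by case: p q => [] [] //=; rewrite ?add0n ?add1n /= ?doubleK ?uphalf_double.
Qed.

Lemma spread_gather f : spread false (gather false f) + spread true (gather true f) = f.
Proof.
apply/funext => j; rewrite -[LHS]/(spread _ _ j + spread _ _ j) /spread /gather.
have := odd_double_half j; case: (odd j) => /= h.
  by rewrite add0r -[in RHS]h.
by rewrite addr0 -[in RHS]h.
Qed.

Lemma snorm0_spread p n f : snorm 0 n.*2 (spread p f) = snorm 0 n f.
Proof. by rewrite /snorm pip_spread gather_spread eqxx. Qed.

Lemma pip_tail k l f : (k <= l)%N -> pip k l f f = pip 0 l f f - pip 0 k f f.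
Proof. by move=> kl; rewrite /pip (@big_cat_nat _ _ _ k 0 l)//= addrAC subrr add0r. Qed.

Lemma spread_l2 p x : spread p x \in l2pred.
Proof.
apply/l2predP => e e0; have [N HN] := ell2P x e0.
exists N.*2 => m n Nm.
have h : snorm N.*2 n.*2 (spread p x) <= e.
  apply: le_trans (HN N n (leqnn N)); rewrite /snorm ler_wsqrtr//.
  have [nN|Nn] := leqP n N.
    by rewrite [X in rnorm X <= _]big_geq ?leq_double// rnorm0 rnorm_ge0.
  rewrite (@pip_tail N.*2 n.*2) ?leq_double ?(ltnW Nn)//.
  by rewrite (@pip_tail N n) ?(ltnW Nn)// !pip_spread gather_spread eqxx.
apply: le_trans h; apply: snorm_mono => //.
by rewrite -addnn leq_addr.
Qed.

(** A window [[2m, 2n)] of [x] splits into the windows [[m, n)] of its even and odd parts, so each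
    part is dominated by the whole. *)
Lemma gather_l2 p x : gather p x \in l2pred.
Proof.
apply/l2predP => e e0; have [N HN] := ell2P x e0.
exists N => m n Nm; apply: le_trans (HN m.*2 n.*2 _); last first.
  by rewrite (leq_trans Nm)// -addnn leq_addr.
have [nm|mn] := leqP n m; first by rewrite /snorm /pip !big_geq ?leq_double.
rewrite /snorm ler_wsqrtr//; apply: nonneg_mono; first exact: nonneg_pip.
have split k : pip 0 k.*2 x x =
    pip 0 k (gather p x) (gather p x) + pip 0 k (gather (~~ p) x) (gather (~~ p) x).
  by rewrite /pip sum_double /gather; case: p => //=; rewrite addrC.
rewrite (@pip_tail m.*2 n.*2) ?leq_double ?(ltnW mn)//.
rewrite (@pip_tail m n (gather p x)) ?(ltnW mn)// !split.
have cancel (a b c d : A) : a + b - (c + d) - (a - c) = b - d.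
  by rewrite [- (c + d)]opprD addrACA [a - c + _]addrC addrK.
by rewrite cancel -pip_tail ?(ltnW mn)//; exact: nonneg_pip.
Qed.

Definition spreadE p x : ell2 A := Ell2 (spread_l2 p x).
Definition gatherE p x : ell2 A := Ell2 (gather_l2 p x).

(** The partial inner products match only when those on the left have even length, so the limit is
    taken along the subsequence [2n]. *)
Lemma spread_adj p : adjoint_to (spreadE p) (gatherE p).
Proof.
move=> x y; apply: tends_unique (dotP x (gatherE p y)).
have d n : (n <= n.*2)%N by rewrite -addnn leq_addr.
by apply: tends_ext (tends_sub d (dotP (spreadE p x) y)) => n; rewrite pip_spread.
Qed.

Lemma enorm_spread p x : enorm (spreadE p x) <= enorm x.
Proof.
apply: enorm_le => n; apply: le_trans (snorm_le_enorm n x).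
rewrite -(snorm0_spread p n x); apply: snorm_mono => //.
by rewrite -addnn leq_addr.
Qed.

Lemma spread_adjpred p : spreadE p \in adjpred.
Proof.
apply/adjpredP; split; first by exists (gatherE p); exact: spread_adj.
by exists 1 => x; rewrite mul1r enorm_spread.
Qed.

Definition cuntz p : opalg A := AdjOp (spread_adjpred p).

Lemma star_cuntzE p x : op_fun (star (cuntz p)) x = gatherE p x.
Proof.
apply/subr0_eq/dot_eq0 => y.
by rewrite -star_dot dotBr -op_adjP -spread_adj subrr star0.
Qed.

Lemma cuntz_ortho p q : star (cuntz p) * cuntz q = if p == q then 1 else 0.
Proof.
apply: adjop_eq => x.
have -> : op_fun (star (cuntz p) * cuntz q) x = gatherE p (spreadE q x).
  exact: star_cuntzE.
by apply: ell2_eq => i; have := gather_spread p q x; case: (p == q) => /(congr1 (@^~ i)).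
Qed.

Lemma cuntz_sum : cuntz false * star (cuntz false) + cuntz true * star (cuntz true) = 1.
Proof.
apply: adjop_eq => x.
have -> : op_fun (cuntz false * star (cuntz false) + cuntz true * star (cuntz true)) x
    = spreadE false (gatherE false x) + spreadE true (gatherE true x).
  by rewrite -!star_cuntzE.
by apply: ell2_eq => i; have /(congr1 (@^~ i)) := spread_gather x.
Qed.

Lemma cuntz_comm p a : cuntz p * diag_op a = diag_op a * cuntz p.
Proof.
apply: adjop_eq => x; apply: ell2_eq => i; rewrite [LHS]/(spread p (lmulseq a x) i).
rewrite [RHS]/(a * spread p x i) /spread.
by case: ifP => _; [exact: erefl|exact/esym/mulr0].
Qed.

Lemma rnorm_cuntz p : rnorm (cuntz p) <= 1.
Proof.
rewrite /rnorm normr_adjop /=; apply: opnorm_le => // x.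
by rewrite mul1r enorm_spread.
Qed.

End CuntzIsometries.

(** * Doubling classes in K_1 *)

Section ApproximateSolutions.
Context {R : realType}.

Lemma sum_coord_continuous k : continuous (fun v : 'rV[R]_k => \sum_i v 0 i).
Proof.
suff H (r : seq 'I_k) : continuous (fun v : 'rV[R]_k => \sum_(i <- r) v 0 i) by exact: H.
elim: r => [|i r IH] v.
  have -> : (fun v : 'rV[R]_k => \sum_(i <- [::]) v 0 i) = fun=> 0.
    by apply/funext => w; rewrite big_nil.
  exact: cst_continuous.
have -> : (fun v : 'rV[R]_k => \sum_(j <- i :: r) v 0 j) =
    (fun v => v 0 i + \sum_(j <- r) v 0 j).
  by apply/funext => w; rewrite big_cons.
by apply: cvgD; [exact: nbhs_filter|exact: coord_continuous|exact: IH].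
Qed.

(** The sum of the norms of all [ts i] is one quantifier-free formula. The point [c] makes its
    infimum over the unit ball of [B] at most 0, so some point of the unit ball of [A] has value
    below [e], and this bounds every summand. *)
Lemma ec_approx (A B : cstarAlgType R) (f : A -> B) (p q : nat) (I : finType)
    (ts : I -> starpoly R (p + q)) (a : 'I_p -> A) (c : 'I_q -> B) (e : R) :
  existentially_closed_in f -> (forall i, rnorm (c i) <= 1) ->
  (forall i, speval (joint (f \o a) c) (ts i) = 0) -> 0 < e ->
  exists b : 'I_q -> A, (forall i, rnorm (b i) <= 1) /\
    forall i, rnorm (speval (joint a b) (ts i)) < e.
Proof.
move=> ec c1 c0 e0.
pose phi := QFFormula (fun i : 'I_#|I| => ts (enum_val i)) (@sum_coord_continuous #|I|).
have infB : (inf_ball phi 1 (f \o a) <= 0)%E.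
  apply: ereal_inf_lbound; exists c => //; congr EFin.
  rewrite /qfeval /= big1// => i _; rewrite mxE c0; exact: rnorm0.
have : (inf_ball phi 1 a < e%:E)%E.
  by rewrite (ec _ _ phi 1%N a)// (le_lt_trans infB)// lte_fin.
move=> /ereal_inf_lt[_ [b b1 <-]]; rewrite lte_fin => be.
exists b; split=> // i; apply: le_lt_trans be.
rewrite /qfeval /= (bigD1 (enum_rank i))//= mxE enum_rankK lerDl.
by apply: sumr_ge0 => j _; rewrite mxE rnorm_ge0.
Qed.

Lemma speval_mul (A : cstarAlgType R) m (x : 'I_m -> A) t t' :
  speval x (SPmul t t') = speval x t * speval x t'.
Proof. by []. Qed.

Lemma speval_add (A : cstarAlgType R) m (x : 'I_m -> A) t t' :
  speval x (SPadd t t') = speval x t + speval x t'.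
Proof. by []. Qed.

Lemma speval_star (A : cstarAlgType R) m (x : 'I_m -> A) t :
  speval x (SPstar t) = star (speval x t).
Proof. by []. Qed.

Lemma speval_const (A : cstarAlgType R) m (x : 'I_m -> A) c :
  speval x (SPconst m c) = c *: (1 : A).
Proof. by []. Qed.

Let spevalE := (speval_mul, speval_add, speval_star, speval_const).

Lemma joint_l (T : Type) p q (a : 'I_p -> T) (b : 'I_q -> T) i :
  joint a b (lshift q i) = a i.
Proof. by rewrite /joint (unsplitK (inl i)). Qed.

Lemma joint_r (T : Type) p q (a : 'I_p -> T) (b : 'I_q -> T) i :
  joint a b (rshift p i) = b i.
Proof. by rewrite /joint (unsplitK (inr i)). Qed.

(* The operators [cuntz p] solve these equations exactly in [opalg A]. *)
Lemma approx_cuntz (A : cstarAlgType R) n (u : 'M[A]_n) (e : R) :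
  existentially_closed A -> 0 < e -> exists s : bool -> A,
  [/\ (forall p, rnorm (s p) <= 1),
      (forall p q, rnorm (star (s p) * s q - (p == q)%:R) < e),
      rnorm (s false * star (s false) + s true * star (s true) - 1) < e &
      (forall p i j, rnorm (s p * u i j - u i j * s p) < e)].
Proof.
move=> /(_ _ _ diag_embedding) ec e0.
pose P := #|{: 'I_n * 'I_n}|.
pose a (k : 'I_P) := u (enum_val k).1 (enum_val k).2.
pose bo (p : bool) : 'I_2 := if p then 1 else 0.
pose S (p : bool) : starpoly R (P + 2) := SPvar _ (rshift P (bo p)).
pose V i j : starpoly R (P + 2) := SPvar _ (lshift 2 (enum_rank (i, j))).
pose sub (t t' : starpoly R (P + 2)) := SPadd t (SPmul (SPconst _ (-1)) t').
pose ts (x : (bool * bool + unit) + bool * ('I_n * 'I_n)) := match x with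
  | inl (inl (p, q)) => sub (SPmul (SPstar (S p)) (S q)) (SPconst _ (if p == q then 1 else 0))
  | inl (inr _) => sub (SPadd (SPmul (S false) (SPstar (S false)))
                              (SPmul (S true) (SPstar (S true)))) (SPconst _ 1)
  | inr (p, (i, j)) => sub (SPmul (S p) (V i j)) (SPmul (V i j) (S p))
  end.
have subE (B : cstarAlgType R) (x : 'I_(P + 2) -> B) t t' :
    speval x (sub t t') = speval x t - speval x t'.
  by rewrite /= scaleN1r mulN1r.
have SE (B : cstarAlgType R) (f : 'I_P -> B) (g : 'I_2 -> B) p : speval (joint f g) (S p) = g (bo p).
  exact: joint_r.
have VE (B : cstarAlgType R) (h : A -> B) (g : 'I_2 -> B) i j :
    speval (joint (h \o a) g) (V i j) = h (u i j).
  by rewrite /= joint_l /= /a enum_rankK.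
pose c (i : 'I_2) : opalg A := cuntz (i == 1).
have cbo p : c (bo p) = cuntz p by case: p.
have [||b [b1 bt]] := @ec_approx _ _ _ P 2 _ ts a c e ec _ _ e0.
- by move=> i; exact: rnorm_cuntz.
- move=> [[[p q]|[]]|[p [i j]]]; rewrite subE !spevalE ?SE ?cbo.
  + by rewrite cuntz_ortho; case: (p == q); rewrite ?scale1r ?scale0r subrr.
  + by rewrite cuntz_sum scale1r subrr.
  + by rewrite VE cuntz_comm subrr.
have VE' g i j : speval (joint a g) (V i j) = u i j by exact: (VE A id g i j).
exists (b \o bo); split.
- by move=> p; exact: b1.
- move=> p q; have := bt (inl (inl (p, q))); rewrite subE !spevalE !SE.
  by case: (p == q); rewrite ?scale1r ?scale0r.
- by have := bt (inl (inr tt)); rewrite subE !spevalE !SE scale1r.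
- by move=> p i j; have := bt (inr (p, (i, j))); rewrite subE !spevalE !SE !VE'.
Qed.

End ApproximateSolutions.

(** * From a nearly unitary matrix to a unitary one *)

Section PolarCorrection.
Context {R : realType} {A : cstarAlgType R}.

(* The unitary is [W (W^2)^(-1/2)]; the bound on [d] makes its conjugate of [D]
   close enough to [b]. *)
Lemma polar_conj n (W D b : 'M[A]_n) (d : R) :
  adjmx W = W -> unitary D -> unitary b ->
  mnorm (1%:M - W *m W) <= d -> mnorm (W *m D *m W - b) <= d -> d <= 1 / 4 ->
  d * (mnorm b * (2 * (mnorm b + 1) * (mnorm (1%:M : 'M[A]_n) + 2) + 1)) <= 1 / 4 ->
  exists2 V, unitary V & homotopic b (V *m D *m adjmx V).
Proof.
move=> aW uD ub; set Y := 1%:M - W *m W => Yd Xd d4 small.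
have aY : adjmx Y = Y by rewrite adjmxB adjmx1 adjmxM aW.
have Y34 : mnorm Y <= 3 / 4 by lra.
have Y1 : mnorm Y <= 1 by lra.
have Z12 := msq_small Y34; have Zd := le_trans (msq_le Y34) Yd.
have aZ := msq_adj Y1 aY.
have Z2 : (1%:M - msq Y) *m (1%:M - msq Y) = W *m W by rewrite msqK// subKr.
have WZ : W *m msq Y = msq Y *m W.
  by apply: msq_comm => //; rewrite mulmxBl mulmxBr mulmx1 mul1mx mulmxA.
have [P [PZ ZP Pd]] := inverse_near1 Z12.
set Q := 1%:M - msq Y in Z2 PZ ZP.
have aQ : adjmx Q = Q by rewrite adjmxB adjmx1 aZ.
have aP : adjmx P = P.
  have : adjmx P *m Q = 1%:M by rewrite -{1}aQ -adjmxM ZP adjmx1.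
  move/(congr1 (fun M => M *m P)); by rewrite -mulmxA ZP mulmx1 mul1mx.
have WQ : W *m Q = Q *m W by rewrite mulmxBl mulmxBr mulmx1 mul1mx WZ.
have WP : W *m P = P *m W.
  rewrite -[W *m P]mul1mx -PZ -[P *m Q *m _]mulmxA [Q *m (W *m P)]mulmxA -WQ.
  by rewrite -[W *m Q *m P]mulmxA ZP mulmx1.
clearbody Q.
have PQQP : P *m (Q *m Q) *m P = 1%:M by rewrite mulmxA PZ mul1mx ZP.
have uV : unitary (W *m P).
  rewrite /unitary adjmxM aP aW; apply/andP; split; apply/eqP.
    by rewrite mulmxA -[P *m W *m W]mulmxA -Z2 PQQP.
  have -> : W *m P *m (P *m W) = P *m (W *m W) *m P.
    by rewrite -[X in _ *m X]WP {1}WP !mulmxA.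
  by rewrite -Z2 PQQP.
exists (W *m P) => //.
apply: near_homotopic => //; first exact: unitaryM (unitaryM uV uD) (unitary_adj uV).
rewrite adjmxM aP aW.
set X := W *m D *m W in Xd.
have -> : W *m P *m D *m (P *m W) = P *m X *m P.
  have -> : W *m P *m D *m (P *m W) = P *m W *m D *m (W *m P) by rewrite WP.
  by rewrite /X !mulmxA.
clearbody X.
(* Telescoping from [P X P] through [X P] and [X] to [b]. The bounds [|P - 1| <= 2 d],
   [|X| <= beta + 1] and [|P| <= N1 + 1] then produce exactly the constant in the smallness
   hypothesis, the outer factor being the norm of [adjmx b]. *)
have -> : adjmx b *m (P *m X *m P) - 1%:M =
    adjmx b *m ((P - 1%:M) *m X *m P + X *m (P - 1%:M) + (X - b)).
  rewrite !mulmxBl mul1mx [X *m (P - _)]mulmxBr mulmx1.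
  by rewrite [_ - X *m P + _]addrA subrK addrA subrK mulmxBr unitaryVl.
set beta := mnorm b in small; set N1 := mnorm 1%:M in small.
have X0 : mnorm X <= beta + 1.
  by have := mnormD (X - b) b; rewrite subrK -/beta; lra.
have P0 : mnorm P <= N1 + 1.
  by have := mnormD (P - 1%:M) 1%:M; rewrite subrK -/N1; lra.
apply: le_trans (mnormM _ _) _; rewrite mnorm_adj -/beta.
have b0 : 0 <= beta by exact: mnorm_ge0.
have step : mnorm ((P - 1%:M) *m X *m P + X *m (P - 1%:M) + (X - b)) <=
    d * (2 * (beta + 1) * (N1 + 2) + 1).
  have Pd2 : mnorm (P - 1%:M) <= 2 * d by rewrite (le_trans Pd)// ler_wpM2l.
  have -> : d * (2 * (beta + 1) * (N1 + 2) + 1) =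
    2 * d * (beta + 1) * (N1 + 1) + (beta + 1) * (2 * d) + d by ring.
  apply: le_trans (mnormD _ _) _; apply: lerD => //.
  apply: le_trans (mnormD _ _) _; apply: lerD; apply: le_trans (mnormM _ _) _.
    apply: ler_pM; rewrite ?mnorm_ge0//; apply: le_trans (mnormM _ _) _.
    by apply: ler_pM; rewrite ?mnorm_ge0.
  by apply: ler_pM; rewrite ?mnorm_ge0.
apply: le_trans (ler_wpM2l b0 step) _.
by rewrite mulrCA.
Qed.

End PolarCorrection.

Section Blocks.
Context {R : realType} {A : cstarAlgType R} {m : nat}.
Implicit Types a b c d e f g h i : 'M[A]_m.

Definition block3 a b c d e f g h i : 'M[A]_(m + (m + m)) :=
  block_mx a (row_mx b c) (col_mx d g) (block_mx e f h i).

Lemma block3M a b c d e f g h i a' b' c' d' e' f' g' h' i' :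
  block3 a b c d e f g h i *m block3 a' b' c' d' e' f' g' h' i' =
  block3 (a *m a' + (b *m d' + c *m g')) (a *m b' + (b *m e' + c *m h'))
         (a *m c' + (b *m f' + c *m i'))
         (d *m a' + (e *m d' + f *m g')) (d *m b' + (e *m e' + f *m h'))
         (d *m c' + (e *m f' + f *m i'))
         (g *m a' + (h *m d' + i *m g')) (g *m b' + (h *m e' + i *m h'))
         (g *m c' + (h *m f' + i *m i')).
Proof.
rewrite /block3 mulmx_block mul_mx_row mul_col_mx mul_row_block mul_row_col.
rewrite mul_block_col mul_col_row mulmx_block.
by rewrite add_row_mx add_col_mx add_block_mx.
Qed.

Lemma block3B a b c d e f g h i a' b' c' d' e' f' g' h' i' :
  block3 a b c d e f g h i - block3 a' b' c' d' e' f' g' h' i' =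
  block3 (a - a') (b - b') (c - c') (d - d') (e - e') (f - f') (g - g') (h - h') (i - i').
Proof.
by rewrite /block3 !opp_block_mx opp_row_mx opp_col_mx !add_block_mx add_row_mx add_col_mx.
Qed.

Lemma adj_block3 a b c d e f g h i : adjmx (block3 a b c d e f g h i) =
  block3 (adjmx a) (adjmx d) (adjmx g) (adjmx b) (adjmx e) (adjmx h)
         (adjmx c) (adjmx f) (adjmx i).
Proof.
by rewrite /adjmx /block3 !tr_block_mx tr_row_mx tr_col_mx !map_block_mx map_row_mx map_col_mx.
Qed.

Lemma block3_1 : block3 1%:M 0 0 0 1%:M 0 0 0 1%:M = 1%:M.
Proof. by rewrite /block3 row_mx0 col_mx0 -!scalar_mx_block. Qed.

Lemma mnorm_block3 a b c d e f g h i : mnorm (block3 a b c d e f g h i) =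
  mnorm a + (mnorm b + mnorm c) + (mnorm d + mnorm g + (mnorm e + mnorm f + (mnorm h + mnorm i))).
Proof.
have mnorm_row (x y : 'M[A]_m) : mnorm (row_mx x y) = mnorm x + mnorm y.
  rewrite /mnorm -big_split; apply: eq_bigr => k _; rewrite big_split_ord.
  by congr (_ + _); apply: eq_bigr => l _; rewrite ?row_mxEl ?row_mxEr.
have mnorm_col (x y : 'M[A]_m) : mnorm (col_mx x y) = mnorm x + mnorm y.
  rewrite /mnorm big_split_ord; congr (_ + _); apply: eq_bigr => k _;
    by apply: eq_bigr => l _; rewrite ?col_mxEu ?col_mxEd.
by rewrite /block3 !mnorm_block mnorm_row mnorm_col.
Qed.

Lemma unitary_diag3 a b c : unitary a -> unitary b -> unitary c ->
  unitary (block3 a 0 0 0 b 0 0 0 c).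
Proof.
move=> ua ub uc; rewrite /unitary adj_block3 !adjmx0 !block3M.
rewrite !(mulmx0, mul0mx, addr0, add0r).
by rewrite !unitaryVl// !unitaryVr// block3_1 eqxx.
Qed.

End Blocks.

Lemma mulmx_scalarE (T : pzRingType) m n (M : 'M[T]_(m, n)) (a : T) i j :
  (M *m a%:M) i j = M i j * a.
Proof.
rewrite mxE (bigD1 j)//= mxE eqxx mulr1n big1 ?addr0// => l lj.
by rewrite mxE (negbTE lj) mulr0n mulr0.
Qed.

(** * Computing with classes of unitary matrices *)

Section K1Classes.
Local Open Scope quotient_scope.
Context {R : realType} {A : cstarAlgType R}.

Definition K1class n (M : 'M[A]_n.+1) (uM : unitary M) : K1 A := \pi_(K1 A) (mkU uM).

Lemma K1class_homotopic n (M N : 'M[A]_n.+1) (uM : unitary M) (uN : unitary N) :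
  homotopic M N -> K1class uM = K1class uN.
Proof.
move=> h; apply/eqmodP.
apply: (@K1relI _ _ (mkU uM) (mkU uN) n.+1 (leqnn _) (leqnn _)).
by rewrite !pad_id.
Qed.

Lemma K1class_eq n (M N : 'M[A]_n.+1) (uM : unitary M) (uN : unitary N) :
  M = N -> K1class uM = K1class uN.
Proof. by move=> e; apply: K1class_homotopic; rewrite -e; exact: homotopic_refl. Qed.

Lemma K1classM n (M N : 'M[A]_n.+1) (uM : unitary M) (uN : unitary N)
    (uMN : unitary (M *m N)) :
  K1class uMN = K1class uM + K1class uN.
Proof.
apply/esym; rewrite -[LHS]/(K1add _ _) pi_K1add; apply/eqmodP.
have hk : (Udim (mkU uM) <= n.+1)%N by [].
have hk' : (Udim (mkU uN) <= n.+1)%N by [].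
apply: (@K1relI_eq _ _ _ (mkU uMN) n.+1 (Udim_mul hk hk') (leqnn _)).
by rewrite (pad_Umul _ hk hk') !pad_id.
Qed.

Lemma K1class1 n (u1 : unitary (1%:M : 'M[A]_n.+1)) : K1class u1 = 0.
Proof.
apply/eqmodP.
have h1 : (Udim (@Uone R A) <= n.+1)%N by [].
apply: (@K1relI_eq _ _ (mkU u1) Uone n.+1 (leqnn _) h1).
by rewrite pad_Uone pad_id.
Qed.

(* [K1 A] is commutative, so conjugation by a unitary is invisible in it. *)
Lemma K1class_conj n (V M N : 'M[A]_n.+1) (uM : unitary M) (uN : unitary N) :
  unitary V -> N = V *m M *m adjmx V -> K1class uN = K1class uM.
Proof.
move=> uV eN; have uVM := unitaryM uV uM; have uV' := unitary_adj uV.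
rewrite (K1class_eq uN (unitaryM uVM uV') eN) (K1classM uVM uV') (K1classM uV uM).
rewrite [K1class uV + _]addrC -addrA -(K1classM uV uV' (unitaryM uV uV')).
rewrite (K1class_eq (unitaryM uV uV') (unitary1 n.+1)); last exact: unitaryVr.
by rewrite K1class1 addr0.
Qed.

Lemma K1class_pad n k (M : 'M[A]_n.+1) (N : 'M[A]_k.+1) (nk : (n.+1 <= k.+1)%N)
    (uM : unitary M) (uN : unitary N) :
  N = pad nk M -> K1class uN = K1class uM.
Proof.
move=> e; apply/eqmodP.
apply: (@K1relI_eq _ _ (mkU uN) (mkU uM) k.+1 (leqnn _) nk).
by rewrite pad_id.
Qed.

Lemma pad_block m n (mn : (m <= m + n)%N) (M : 'M[A]_m) :
  pad mn M = block_mx M 0 0 1%:M.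
Proof.
apply/matrixP => i j; rewrite padE.
case: (split_ordP i) => i' ->; case: (split_ordP j) => j' ->.
- by rewrite block_mxEul !insubT//= => p q; congr (M _ _); exact: val_inj.
- rewrite block_mxEur mxE insubT//= insubF ?ltnNge ?leq_addr//.
  by rewrite eq_lrshift.
- by rewrite block_mxEdl mxE insubF ?ltnNge ?leq_addr// eq_rlshift.
- by rewrite block_mxEdr mxE insubF ?ltnNge ?leq_addr// eq_rshift.
Qed.

End K1Classes.

Theorem proposition2p21 (R : realType) (A : cstarAlgType R) :
  existentially_closed A -> forall x : K1 A, x = 0.
Proof.
move=> ecA; elim/quotW => -[[n u] uu].
rewrite -[X in X = _]/(K1class uu); rewrite /= in u uu *.
(* With this choice [k.+1] is convertible to [m + (m + m)], so 3-by-3 block matrices have classes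
   without any cast. *)
pose m := n.+1; pose k := (n + (m + m))%N.
pose one : 'M[A]_m := 1%:M.
have u1 : unitary one by exact: unitary1.
pose cls (M : 'M[A]_(m + (m + m))) (uM : unitary M) : K1 A := @K1class R A k M uM.
pose b := block3 u 0 0 0 one 0 0 0 one.
pose D2 := block3 one 0 0 0 u 0 0 0 one.
pose D3 := block3 one 0 0 0 one 0 0 0 u.
pose D := block3 one 0 0 0 u 0 0 0 u.
have ub : unitary b := unitary_diag3 uu u1 u1.
have uD2 : unitary D2 := unitary_diag3 u1 uu u1.
have uD3 : unitary D3 := unitary_diag3 u1 u1 uu.
have uD : unitary D := unitary_diag3 u1 uu uu.
have clsJ V (M N : 'M[A]_(m + (m + m))) (uM : unitary M) (uN : unitary N) :
    unitary V -> N = V *m M *m adjmx V -> cls N uN = cls M uM.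
  exact: (@K1class_conj R A k).
have cb : cls b ub = K1class uu.
  have nk : (m <= m + (m + m))%N by rewrite leq_addr.
  apply: (@K1class_pad R A n k u b nk uu ub).
  by rewrite [RHS]pad_block /b /block3 row_mx0 col_mx0 -scalar_mx_block.
have simpm := (mulmx0, mul0mx, addr0, add0r, @mulmx1, @mul1mx).
have swap (V : 'M[A]_(m + (m + m))) : adjmx V = V -> V *m V = 1%:M -> unitary V.
  by move=> aV VV; rewrite /unitary aV VV eqxx.
(* [D2], and likewise [D3] below, is conjugate to [b] by a transposition of blocks. *)
have c2 : cls D2 uD2 = K1class uu.
  rewrite -cb; pose V := block3 0 one 0 one 0 0 0 0 one.
  have aV : adjmx V = V by rewrite /V adj_block3 !adjmx0 adjmx1.
  have VV : V *m V = 1%:M by rewrite /V block3M !simpm block3_1.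
  apply: (clsJ _ _ _ _ _ (swap _ aV VV)).
  by rewrite aV /V /b !block3M !simpm.
have c3 : cls D3 uD3 = K1class uu.
  rewrite -cb; pose V := block3 0 0 one 0 one 0 one 0 0.
  have aV : adjmx V = V by rewrite /V adj_block3 !adjmx0 adjmx1.
  have VV : V *m V = 1%:M by rewrite /V block3M !simpm block3_1.
  apply: (clsJ _ _ _ _ _ (swap _ aV VV)).
  by rewrite aV /V /b !block3M !simpm.
have cD : cls D uD = K1class uu + K1class uu.
  have e : D = D2 *m D3 by rewrite /D2 block3M !simpm.
  have u23 := unitaryM uD2 uD3.
  rewrite -{1}c2 -c3; apply: etrans (@K1class_eq R A k _ _ uD u23 e) _.
  exact: K1classM.
(* Such a [V] gives [[u] = [b] = [D] = 2 [u]]. *)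
suff [V uV h] : exists2 V, unitary V & homotopic b (V *m D *m adjmx V).
  have uVD := unitaryM (unitaryM uV uD) (unitary_adj uV).
  have : cls b ub = cls D uD.
    by rewrite -(clsJ _ _ _ uD uVD uV erefl); exact: (@K1class_homotopic R A k).
  rewrite cb cD => /(congr1 (fun x => x - K1class uu)).
  by rewrite addrK subrr => /esym.
(* All constants depend on [u] alone, as the tolerance must be fixed before existential closedness
   yields [s]. [K] is the factor in [polar_conj], and [d = 1 / (4 (K + 1))] meets both conditions
   [d <= 1/4] and [d K <= 1/4]. *)
pose beta := mnorm b.
pose N1 := mnorm (1%:M : 'M[A]_(m + (m + m))).
pose K := beta * (2 * (beta + 1) * (N1 + 2) + 1).
(* [C e] dominates both errors. [W^2 - 1] has five possibly nonzero blocks of norm at most [m e].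
   [W D W - b] has four of them and a corner of norm at most [2 m^3 e + |u| m e], where [m^3] is
   [m^2] from a commutator times [m] from [S']. *)
pose C : R := 2 * m%:R ^+ 3 + mnorm u * m%:R + 5 * m%:R + 1.
have K0 : 0 <= K.
  have := mnorm_ge0 b; have := mnorm_ge0 (1%:M : 'M[A]_(m + (m + m))).
  by rewrite /K /beta /N1 => ? ?; rewrite mulr_ge0 ?addr_ge0 ?mulr_ge0 ?addr_ge0.
have C0 : 1 <= C.
  by rewrite /C lerDr !addr_ge0 ?mulr_ge0 ?exprn_ge0 ?mnorm_ge0.
pose d : R := (4 * (K + 1))^-1.
have d0 : 0 < d by rewrite invr_gt0 mulr_gt0// ltr_wpDl.
have dK : d * (4 * (K + 1)) = 1 by rewrite mulVf// gt_eqF// mulr_gt0// ltr_wpDl.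
have d4 : d <= 1 / 4 by nra.
have dK4 : d * K <= 1 / 4 by nra.
pose e := d / C; have C1 : 0 < C by rewrite (lt_le_trans ltr01).
have e0 : 0 < e by rewrite divr_gt0.
have eC : e * C = d by rewrite divfK// gt_eqF.
have [s [s1 so ss sc]] := approx_cuntz u ecA e0.
pose S p : 'M[A]_m := (s p)%:M; pose S' p : 'M[A]_m := (star (s p))%:M.
have aS p : adjmx (S p) = S' p.
  by apply/matrixP => i j; rewrite !mxE eq_sym; case: eqP => _; rewrite ?mulr1n ?mulr0n ?star0.
pose W := block3 0 (S false) (S true) (S' false) 0 0 (S' true) 0 0.
have aW : adjmx W = W.
  by rewrite /W adj_block3 !adjmx0 !aS -!aS !adjmxK !aS.
have WW : W *m W = block3 (S false *m S' false + S true *m S' true) 0 0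
    0 (S' false *m S false) (S' false *m S true)
    0 (S' true *m S false) (S' true *m S true).
  by rewrite /W block3M !simpm.
have WDW : W *m D *m W = block3 (S false *m u *m S' false + S true *m u *m S' true) 0 0
    0 (S' false *m S false) (S' false *m S true)
    0 (S' true *m S false) (S' true *m S true).
  by rewrite /W /D !block3M !simpm.
have SS p q : mnorm (S' p *m S q - (p == q)%:R%:M) <= m%:R * e.
  by rewrite /S /S' -scalar_mxM -raddfB mnorm_scalar ler_wpM2l// ltW.
have SSs : mnorm (S false *m S' false + S true *m S' true - 1%:M) <= m%:R * e.
  by rewrite /S /S' -!scalar_mxM -raddfD -raddfB mnorm_scalar ler_wpM2l// ltW.
have SSn p : mnorm (S' p *m S (~~ p)) <= m%:R * e.
  by have := SS p (~~ p); case: p; rewrite /= raddf0 subr0.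
have SSp p : mnorm (S' p *m S p - 1%:M) <= m%:R * e.
  by have := SS p p; rewrite eqxx.
have Sc p : mnorm (S p *m u - u *m S p) <= m%:R * m%:R * e.
  apply: (@le_trans _ _ (\sum_(i < m) \sum_(j < m) e)).
    apply: ler_sum => i _; apply: ler_sum => j _.
    by rewrite mxE mul_scalar_mx mxE [X in _ + X]mxE mulmx_scalarE; exact/ltW/sc.
  rewrite (eq_bigr (fun=> m%:R * e)) => [|i _]; last by rewrite sumr_const card_ord mulr_natl.
  by rewrite sumr_const card_ord -[_ *+ m]mulr_natl mulrA.
have nS' p : mnorm (S' p) <= m%:R.
  by rewrite mnorm_scalar rnorm_star ler_piMr// s1.
have m0 : 0 <= m%:R :> R by [].
have U0 := mnorm_ge0 u.
have cubic (x y z : R) : 0 <= x -> 0 <= y -> 0 <= z ->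
    5 * (z * x) <= x * (2 * z ^+ 3 + y * z + 5 * z + 1) /\
    2 * (z * z * x * z) + y * (z * x) + 4 * (z * x) <= x * (2 * z ^+ 3 + y * z + 5 * z + 1).
  move=> x0 y0 z0; have h1 := mulr_ge0 x0 (exprn_ge0 3 z0).
  have h2 := mulr_ge0 x0 (mulr_ge0 y0 z0); have h3 := mulr_ge0 x0 z0.
  by split; lra.
have [] := cubic e _ _ (ltW e0) U0 m0; rewrite -/C eC => bound1 bound2.
refine (@polar_conj R A _ W D b d aW uD ub _ _ d4 dK4).
- rewrite mnormC WW -block3_1 block3B !subr0 mnorm_block3 !mnorm0.
  apply: le_trans bound1.
  have := SSs; have := SSp false; have := SSp true.
  have := SSn false; have := SSn true => /=.
  move: (mnorm _) (mnorm _) (mnorm _) (mnorm _) (mnorm _) (m%:R * e) => x1 x2 x3 x4 x5 t.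
  lra.
- have corner : mnorm (S false *m u *m S' false + S true *m u *m S' true - u) <=
      2 * (m%:R * m%:R * e * m%:R) + mnorm u * (m%:R * e).
    (* Move [u] to the left past each [S p] at the cost of a commutator; the rest is [u] times the
       defect in the sum relation. *)
    have -> : S false *m u *m S' false + S true *m u *m S' true - u =
        (S false *m u - u *m S false) *m S' false + (S true *m u - u *m S true) *m S' true
        + u *m (S false *m S' false + S true *m S' true - 1%:M).
      have telescope (x y z t v : 'M[A]_m) : x + z - v = (x - y) + (z - t) + (y + t - v).
        by rewrite [x - y + _]addrACA -opprD addrA subrK.
      by rewrite !mulmxBl mulmxBr mulmx1 mulmxDr !mulmxA -telescope.
    have t p : mnorm ((S p *m u - u *m S p) *m S' p) <= m%:R * m%:R * e * m%:R.
      by rewrite (le_trans (mnormM _ _))// ler_pM ?mnorm_ge0 ?Sc ?nS'.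
    apply: le_trans (mnormD _ _) _; apply: lerD.
      by rewrite mulrDl mul1r (le_trans (mnormD _ _))// lerD.
    by rewrite (le_trans (mnormM _ _))// ler_wpM2l.
  rewrite WDW /b block3B !subr0 mnorm_block3 !mnorm0.
  apply: le_trans bound2.
  have := corner; have := SSp false; have := SSp true.
  have := SSn false; have := SSn true => /=.
  move: (mnorm _) (mnorm _) (mnorm _) (mnorm _) (mnorm _) (m%:R * e) => x1 x2 x3 x4 x5 t.
  move: (mnorm _ * t) (_ * m%:R) => x6 x7; lra.
Qed.
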